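(* Let $0<\alpha<1/2$. The half-Hilbert transform $$(H_+f)(x)=\frac1\pi\,PV\!\int_0^\infty\frac{f(t)}{t-x}\,dt,\qquad x>0,$$ extends to a bounded invertible map $H_+:L_2(\mathbb{R}_+;x^{2\alpha-1}dx)\to L_2(\mathbb{R}_+;x^{2\alpha-1}dx)$. For every $f\in L_2(\mathbb{R}_+;x^{2\alpha-1}dx)$, with $h=H_+f$, the following reciprocal formulas hold for almost all $x\in\mathbb{R}_+$: $$h(x)=(H_+f)(x)=-\frac1\pi\frac{d}{dx}\int_0^\infty\log\left|1-\frac xt\right|f(t)\,dt,$$ $$f(x)=\frac1\pi\int_0^\infty\frac{h(t)}{\sqrt x+\sqrt t}\,\frac{dt}{\sqrt t}-(H_+h)(x).$$ Moreover, writing $\|\cdot\|$ for the norm of $L_2(\mathbb{R}_+;x^{2\alpha-1}dx)$, the norm inequalities $$\|f\|\le\|H_+f\|\le\cot(\pi\alpha)\,\|f\|\qquad\text{if }0<\alpha\le\tfrac14,$$ $$\cot(\pi\alpha)\,\|f\|\le\|H_+f\|\le\|f\|\qquad\text{if }\tfrac14\le\alpha<\tfrac12$$ hold for all $f\in L_2(\mathbb{R}_+;x^{2\alpha-1}dx)$.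
   Context: $\mathbb{R}_+=(0,\infty)$. $L_2(\mathbb{R}_+;x^{2\alpha-1}dx)$ is the space of complex-valued measurable $f$ on $\mathbb{R}_+$ with norm $\|f\|=\left(\int_0^\infty|f(x)|^2x^{2\alpha-1}dx\right)^{1/2}<\infty$. $PV$ denotes the Cauchy principal value at $t=x$. The operator $H_+$ is initially defined by the principal value integral on $C_c^{(3)}(\mathbb{R}_+)$, the space of three times continuously differentiable functions of compact support in $\mathbb{R}_+$, which is dense in $L_2(\mathbb{R}_+;x^{2\alpha-1}dx)$; ''extends'' refers to the (unique) continuous extension from this dense subspace, also denoted $H_+$. *)

(* Defs.v *)
From HB Require Import structures.
From mathcomp Require Import all_boot all_order all_algebra.
From mathcomp Require Import all_classical all_reals all_analysis.
From mathcomp Require Export complex.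

Set Implicit Arguments.
Unset Strict Implicit.
Unset Printing Implicit Defensive.

Import Order.TTheory GRing.Theory Num.Theory.
Import numFieldNormedType.Exports.

Local Open Scope classical_set_scope.
Local Open Scope ring_scope.
Local Open Scope complex_scope.

Section HalfHilbert.
Variable R : realType.
Implicit Types (f g h : R -> R[i]) (T : (R -> R[i]) -> (R -> R[i])).

Local Notation mu := (@lebesgue_measure R).

(* Functions on (0, oo) are represented by functions on R; none of the notions
   below depends on their values outside (0, oo). *)
Definition Rpos : set R := `]0, +oo[.

Definition ReF f : R -> R := fun x => complex.Re (f x).
Definition ImF f : R -> R := fun x => complex.Im (f x).

Definition cmeasurable (D : set R) f : Prop :=
  measurable_fun D (ReF f) /\ measurable_fun D (ImF f).

Definition cintegrable (D : set R) f : Prop :=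
  mu.-integrable D (EFin \o ReF f) /\ mu.-integrable D (EFin \o ImF f).

Definition cintegral (D : set R) f : R[i] :=
  (\int[mu]_(x in D) ReF f x) +i* (\int[mu]_(x in D) ImF f x).

Definition cderivable f (x : R) : Prop :=
  derivable (ReF f) x 1 /\ derivable (ImF f) x 1.

Definition cderive1 f (x : R) : R[i] :=
  derive1 (ReF f) x +i* derive1 (ImF f) x.

(* Extended-real valued, so that it is +oo rather than a default value outside
   the space. *)
Definition wnorm (alpha : R) f : \bar R :=
  ((\int[mu]_(x in Rpos)
     (complex.ComplexField.Normc.normc (f x) ^+ 2
        * x `^ (2 * alpha - 1))%:E) `^ (2^-1))%E.

Definition L2w (alpha : R) : set (R -> R[i]) :=
  [set f | cmeasurable Rpos f /\ (wnorm alpha f < +oo)%E].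

(* A bounded linear operator of L_2(R_+; x^(2 alpha - 1) dx), presented by its
   action on representatives of almost-everywhere classes. *)
Definition bounded_linear_operator (alpha : R) T : Prop :=
  [/\ forall f, L2w alpha f -> L2w alpha (T f),
      forall f g, L2w alpha f -> L2w alpha g ->
        ae_eq mu Rpos f g -> ae_eq mu Rpos (T f) (T g),
      forall (c : R[i]) f g, L2w alpha f -> L2w alpha g ->
        ae_eq mu Rpos (T (fun x => c * f x + g x))
                      (fun x => c * T f x + T g x) &
      exists M : R, forall f, L2w alpha f ->
        (wnorm alpha (T f) <= M%:E * wnorm alpha f)%E].

Definition invertible_operator (alpha : R) T : Prop :=
  exists2 S, bounded_linear_operator alpha S &
    forall f, L2w alpha f ->
      ae_eq mu Rpos (S (T f)) f /\ ae_eq mu Rpos (T (S f)) f.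

Definition C3_on_Rpos (u : R -> R) : Prop :=
  forall x, Rpos x ->
    (forall k, (k < 3)%N -> derivable (derive1n k u) x 1) /\ {for x, continuous (derive1n 3 u)}.

Definition Cc3 : set (R -> R[i]) :=
  [set f | [/\ C3_on_Rpos (ReF f), C3_on_Rpos (ImF f) &
     exists K : set R, [/\ compact K, K `<=` Rpos &
       forall x, Rpos x -> ~ K x -> f x = 0]]].

Definition hilbert_trunc f (x e : R) : R[i] :=
  (pi^-1)%:C *
  cintegral (Rpos `&` [set t | e < `|t - x|]) (fun t => f t / (t - x)%:C).

Definition is_pv_hilbert f (x : R) (l : R[i]) : Prop :=
  (complex.Re (hilbert_trunc f x e) @[e --> 0^'+] --> complex.Re l) /\
  (complex.Im (hilbert_trunc f x e) @[e --> 0^'+] --> complex.Im l).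

(* H is the continuous extension of the principal value transform from the
   dense subspace Cc3; it is unique up to almost-everywhere equality. *)
Definition half_hilbert_extension (alpha : R) H : Prop :=
  bounded_linear_operator alpha H /\
  forall f, Cc3 f ->
    exists2 g, (forall x, Rpos x -> is_pv_hilbert f x (g x)) &
      ae_eq mu Rpos (H f) g.

Definition log_potential f (x : R) : R[i] :=
  cintegral Rpos (fun t => (ln `|1 - x / t|)%:C * f t).

Definition inversion_integrand h (x t : R) : R[i] :=
  h t / (Num.sqrt x + Num.sqrt t)%:C / (Num.sqrt t)%:C.

Definition cot (x : R) : R := cos x / sin x.

End HalfHilbert.

(* Main.v *)
Require Import Defs.
From HB Require Import structures.
From mathcomp Require Import all_boot all_order all_algebra.
From mathcomp Require Import all_classical all_reals all_analysis.
From mathcomp Require Import measurable_realfun.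
From mathcomp Require Import ring lra.

(* With |.| the weighted norm, the principal value transform H is the limit, as phi
   tends to pi, of the operators H_phi with kernels Re (t + x e^{i phi})^-1 / pi; the
   companion operators P_phi, with kernels - Im (t + x e^{i phi})^-1 / pi, converge to
   the identity.  All these kernels are dominated by multiples of Schur kernels such
   as that of the Stieltjes operator S, (x + t)^-1 / pi.  Rotating contours by e^{i phi}
   in the integrals that express squared norms and composed kernels gives
     |H_phi f|^2 = |P_phi f|^2 + cos(2 alpha phi) |S f|^2,
     H_phi H_phi + P_phi P_phi = S S,
   and, for A with kernel 1 / (pi (sqrt x + sqrt t) sqrt t), that H_phi A tends to S S.
   In the limit |H f|^2 = |f|^2 + cos(2 pi alpha) |S f|^2 and H H + 1 = S S = H A.
   The Schur test bounds S by 1 / sin(pi alpha), which yields the norm inequalities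
   and the injectivity of H; then H (A - H) = 1 makes A - H a two-sided inverse.
   Pairing H_phi f with the indicator of ]0, x] produces regularised logarithms
   with limit ln |1 - x / t|, and Lebesgue differentiation gives the formula for
   H f as the derivative of the logarithmic potential. *)

Set Implicit Arguments.
Unset Strict Implicit.
Unset Printing Implicit Defensive.

Import Order.TTheory GRing.Theory Num.Theory.
Import numFieldNormedType.Exports.
Import ComplexField.Normc.

Local Open Scope classical_set_scope.
Local Open Scope ring_scope.
Local Open Scope complex_scope.

(** * Integrals over the half-line *)

(** The kernel 1 / (t - x) is not absolutely integrable, so neither Fubini's theorem nor the Schur
    test applies to H itself. For phi < pi the kernels have no pole on the half-line and both apply,
    but the bound on H_phi obtained by comparison with the Stieltjes kernel blows up as phi tends to
    pi. A uniform bound comes from the norm identity instead, whose right-hand side involves only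
    P_phi and S, positive kernels with uniform Schur constants. Convergence is computed explicitly
    on compactly supported Lipschitz functions; uniform boundedness and completeness extend it to
    the whole space. The rotation of contours uses no theory of holomorphic functions: in polar
    coordinates the angular derivative of the integrand is i s times its radial derivative, so the
    derivative of the integral with respect to the angle is a boundary term, which vanishes. The
    analysis is carried out for real functions. Complex ones are treated by components, once an
    arbitrary extension is known to agree on real functions with the constructed operator. *)

Ltac ge0 := repeat (first [assumption | apply: ltW; assumption | exact: ler01
  | exact: powR_ge0 | exact: sqr_ge0 | exact: normr_ge0 | exact: sqrtr_ge0
  | exact: exprn_ge0 | exact: expR_ge0 | apply: mulr_ge0 | apply: addr_ge0
  | rewrite invr_ge0]).

Section PositiveHalfLine.
Variable R : realType.
Implicit Types (r x s t k M : R) (f g u v : R -> R) (F G : R -> R -> R).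

Local Notation mu := (@lebesgue_measure R).
Local Notation Rp := (@Rpos R).

(* The carrier is annotated because [lebesgue_measure] lives on
   [measurableTypeR R], whose measurable display differs from that of [R]. *)
Definition mpos f := measurable_fun (Rp : set (measurableTypeR R)) f.
Definition integ f := mu.-integrable Rp (EFin \o f).
Definition Ipos f : R := \int[mu]_(x in Rp) f x.

Lemma ae_imp (P Q : R -> Prop) : (forall x, P x -> Q x) ->
  {ae mu, forall x, P x} -> {ae mu, forall x, Q x}.
Proof.
move=> PQ; have : Filter (nbhs (almost_everywhere mu)) by exact: ae_filter_ringOfSetsType.
by move=> ?; exact: filterS.
Qed.

Lemma ae_imp2 (P Q S : R -> Prop) : (forall x, P x -> Q x -> S x) ->
  {ae mu, forall x, P x} -> {ae mu, forall x, Q x} -> {ae mu, forall x, S x}.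
Proof.
move=> PQ; have : Filter (nbhs (almost_everywhere mu)) by exact: ae_filter_ringOfSetsType.
by move=> ?; exact: filterS2.
Qed.

Lemma cvgn_ext (u v : nat -> R) (l l' : R) : (forall n, v n = u n) -> l = l' ->
  u n @[n --> \oo] --> l -> v n @[n --> \oo] --> l'.
Proof. by move=> vu <-; rewrite (_ : v = u)//; apply/funext. Qed.

Lemma powRD_gt0 x r s : 0 < x -> x `^ (r + s) = x `^ r * x `^ s.
Proof. by move=> x0; rewrite powRD// (gt_eqF x0) implybT. Qed.

Lemma RposE x : Rp x = (0 < x) :> Prop.
Proof. by rewrite /Rpos /= in_itv /= andbT. Qed.

Lemma in_Rpos x : (x \in Rp) = (0 < x).
Proof. by apply/idP/idP; rewrite inE RposE. Qed.

Lemma measurable_Rpos : measurable (Rp : set (measurableTypeR R)).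
Proof. exact: measurable_itv. Qed.
Hint Resolve measurable_Rpos : core.

Lemma eq_mpos f g : (forall x, 0 < x -> f x = g x) -> mpos f -> mpos g.
Proof.
move=> fg; apply: eq_measurable_fun => x; rewrite in_Rpos; exact: fg.
Qed.

Lemma mposT f : measurable_fun setT f -> mpos f.
Proof. exact: measurable_funS. Qed.

Lemma integ_mpos f : integ f -> mpos f.
Proof. by move=> /measurable_int /measurable_EFinP. Qed.

Lemma eq_integ f g : (forall x, 0 < x -> f x = g x) -> integ f -> integ g.
Proof.
move=> fg; apply: eq_integrable => // x; rewrite in_Rpos => x0 /=.
by rewrite fg.
Qed.

Lemma eq_Ipos f g : (forall x, 0 < x -> f x = g x) -> Ipos f = Ipos g.
Proof. by move=> fg; apply: eq_Rintegral => x; rewrite in_Rpos; exact: fg. Qed.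

Lemma le_integ f g : mpos f -> (forall x, 0 < x -> `|f x| <= g x) ->
  integ g -> integ f.
Proof.
move=> mf fg; apply: le_integrable => //; first exact/measurable_EFinP.
move=> x; rewrite RposE => x0 /=; rewrite lee_fin.
by rewrite (le_trans (fg _ x0))// ler_norm.
Qed.

Lemma integD f g : integ f -> integ g -> integ (fun x => f x + g x).
Proof. by move=> If Ig; have := integrableD measurable_Rpos If Ig. Qed.

Lemma integB f g : integ f -> integ g -> integ (fun x => f x - g x).
Proof. by move=> If Ig; have := integrableB measurable_Rpos If Ig. Qed.

Lemma integZl k f : integ f -> integ (fun x => k * f x).
Proof. by move=> If; have := integrableZl measurable_Rpos k If. Qed.

Lemma integZr k f : integ f -> integ (fun x => f x * k).
Proof.
by move=> /(integZl k); apply: eq_integ => x _; rewrite mulrC.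
Qed.

Lemma integ_abs f : integ f -> integ (fun x => `|f x|).
Proof. by move=> If; have := integrable_abse If. Qed.

Lemma integ_absE f : mpos f -> integ (fun x => `|f x|) -> integ f.
Proof. by move=> mf; apply: le_integ. Qed.

Lemma integ0 : integ (fun=> 0).
Proof. exact: integrable0. Qed.

Lemma IposD f g : integ f -> integ g ->
  Ipos (fun x => f x + g x) = Ipos f + Ipos g.
Proof. exact: RintegralD. Qed.

Lemma IposB f g : integ f -> integ g ->
  Ipos (fun x => f x - g x) = Ipos f - Ipos g.
Proof. exact: RintegralB. Qed.

Lemma IposZl k f : integ f -> Ipos (fun x => k * f x) = k * Ipos f.
Proof. exact: RintegralZl. Qed.

Lemma IposZr k f : integ f -> Ipos (fun x => f x * k) = Ipos f * k.
Proof. exact: RintegralZr. Qed.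

Lemma Ipos0 : Ipos (fun=> 0) = 0.
Proof. by rewrite /Ipos Rintegral_cst// mul0r. Qed.

Lemma le_Ipos f g : integ f -> integ g -> (forall x, 0 < x -> f x <= g x) ->
  Ipos f <= Ipos g.
Proof.
by move=> If Ig fg; apply: le_Rintegral => // x; rewrite RposE; exact: fg.
Qed.

Lemma Ipos_ge0 f : (forall x, 0 < x -> 0 <= f x) -> 0 <= Ipos f.
Proof. by move=> f0; apply: Rintegral_ge0 => x; rewrite RposE; exact: f0. Qed.

Lemma ler_norm_Ipos f : integ f -> `|Ipos f| <= Ipos (fun x => `|f x|).
Proof. exact: le_normr_Rintegral. Qed.

Lemma ler_norm_Ipos_le f g : integ f -> integ g ->
  (forall x, 0 < x -> `|f x| <= g x) -> `|Ipos f| <= Ipos g.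
Proof.
move=> If Ig fg; apply: le_trans (ler_norm_Ipos If) _.
by apply: le_Ipos => //; exact: integ_abs.
Qed.

Lemma EFin_Ipos f : integ f -> ((Ipos f)%:E = \int[mu]_(x in Rp) (f x)%:E)%E.
Proof.
by move=> If; rewrite fineK//; exact: integrable_fin_num.
Qed.

Lemma integ_ge0P f : mpos f -> (forall x, 0 < x -> 0 <= f x) ->
  integ f <-> (\int[mu]_(x in Rp) (f x)%:E < +oo)%E.
Proof.
move=> mf f0; split => [/integrableP[_]|fi].
  apply: le_lt_trans; apply: ge0_le_integral => //=.
  - by move=> x; rewrite RposE lee_fin => /f0.
  - exact/measurable_EFinP.
  - by apply/measurable_EFinP; exact: measurableT_comp.
  - by move=> x _; rewrite lee_fin ler_norm.
apply/integrableP; split; first exact/measurable_EFinP.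
apply: le_lt_trans fi; apply: ge0_le_integral => //=.
- by apply/measurable_EFinP; exact: measurableT_comp.
- exact/measurable_EFinP.
- by move=> x; rewrite RposE lee_fin => /f0 ?; rewrite ger0_norm.
Qed.

Lemma integ_ge0_le f M : mpos f -> (forall x, 0 < x -> 0 <= f x) ->
  (\int[mu]_(x in Rp) (f x)%:E <= M%:E)%E -> integ f /\ Ipos f <= M.
Proof.
move=> mf f0 fM; have If : integ f.
  by apply/(integ_ge0P mf f0); rewrite (le_lt_trans fM)// ltry.
by split => //; rewrite -lee_fin EFin_Ipos.
Qed.

Lemma mpos_cvg (fn : nat -> R -> R) f : (forall n, mpos (fn n)) ->
  (forall x, 0 < x -> fn n x @[n --> \oo] --> f x) -> mpos f.
Proof.
move=> mfn ff; apply: (@measurable_fun_cvg _ _ _ _ fn) => // x.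
by rewrite RposE; exact: ff.
Qed.

Lemma Ipos_dct (fn : nat -> R -> R) f g : (forall n, mpos (fn n)) ->
  (forall x, 0 < x -> fn n x @[n --> \oo] --> f x) ->
  (forall n x, 0 < x -> `|fn n x| <= g x) -> integ g ->
  integ f /\ Ipos (fn n) @[n --> \oo] --> Ipos f.
Proof.
move=> mfn ff fg Ig.
have [|||||If _ h] := @dominated_convergence _ _ _ mu _ measurable_Rpos
    (fun n => EFin \o fn n) (EFin \o f) (EFin \o g).
- by move=> n; apply/measurable_EFinP; exact: mfn.
- by apply/measurable_EFinP; exact: mpos_cvg ff.
- apply/aeW => x; rewrite RposE => x0; apply/cvg_EFin; first exact/nearW.
  exact: ff.
- exact: Ig.
- by apply/aeW => x n; rewrite RposE /= lee_fin; exact: fg.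
split => //; apply: fine_cvg; rewrite -/(Ipos f) EFin_Ipos//; exact: h.
Qed.

Lemma Ipos_fatou (fn : nat -> R -> R) f M : (forall n, integ (fn n)) ->
  (forall n x, 0 < x -> 0 <= fn n x) ->
  (forall x, 0 < x -> fn n x @[n --> \oo] --> f x) ->
  (forall n, Ipos (fn n) <= M) -> integ f /\ Ipos f <= M.
Proof.
move=> ifn fn0 ff fM.
have mf : mpos f by apply: mpos_cvg ff => n; exact: integ_mpos.
have f0 x : 0 < x -> 0 <= f x.
  move=> x0; have <- : limn (fn^~ x) = f x by apply/cvg_lim => //; exact: ff.
  apply: limr_ge; first by apply/cvg_ex; exists (f x); exact: ff.
  by apply: nearW => n; exact: fn0.
apply: integ_ge0_le => //.
have := @fatou _ _ _ mu Rp measurable_Rpos (fun n => EFin \o fn n).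
move=> /(_ _ _)/le_trans/=.
have -> : (\int[mu]_(x in Rp) (f x)%:E =
    \int[mu]_(x in Rp) limn_einf (fun n => (fn n x)%:E))%E.
  apply: eq_integral => x; rewrite in_Rpos => x0.
  have h : (fn n x)%:E @[n --> \oo] --> (f x)%:E.
    by apply/cvg_EFin; [exact/nearW|exact: ff].
  by have [] := cvg_limn_einf_sup h.
apply.
- by move=> n; apply/measurable_EFinP; exact: integ_mpos.
- by move=> n x; rewrite RposE lee_fin; exact: fn0.
rewrite limn_einf_lim; apply: lime_le; first exact: is_cvg_einfs.
apply: nearW => n; apply: le_trans (_ : (Ipos (fn n))%:E <= _)%E; last first.
  by rewrite lee_fin.
by rewrite EFin_Ipos//; apply: ereal_inf_lbound; exists n => /=.
Qed.

Lemma Ipos_eq0 f : integ f -> (forall x, 0 < x -> 0 <= f x) -> Ipos f = 0 ->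
  ae_eq mu Rp f (fun=> 0).
Proof.
move=> If f0 I0.
have : (\int[mu]_(x in Rp) `|(EFin \o f) x| = 0)%E.
  rewrite -[RHS]/(0%:E) -I0 EFin_Ipos//; apply: eq_integral => x.
  by rewrite in_Rpos /= => x0; rewrite ger0_norm// f0.
move/ae_eq_integral_abs => /(_ measurable_Rpos (measurable_int _ If)).
by apply: filterS => x /= h Dx; have := h Dx; case.
Qed.

Lemma ae_Ipos f g : mpos f -> mpos g -> ae_eq mu Rp f g -> Ipos f = Ipos g.
Proof.
move=> mf mg fg; congr fine; apply: ae_eq_integral => //.
- exact/measurable_EFinP.
- exact/measurable_EFinP.
- by apply: ae_imp fg => x /= h Dx; rewrite h.
Qed.

Lemma ae_integ f g : mpos g -> ae_eq mu Rp f g -> integ f -> integ g.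
Proof.
move=> mg fg If; apply: integ_absE => //.
have If' := integ_abs If.
apply/integrableP; split.
  by apply/measurable_EFinP; exact: measurableT_comp.
have /integrableP[_] := If'; rewrite /=.
rewrite (@ae_eq_integral _ _ _ mu Rp (fun x => (`| `|g x| |)%:E))//.
- by do 2 apply: measurableT_comp => //; exact: integ_mpos.
- by do 3 apply: measurableT_comp => //.
- by apply: ae_imp fg => x /= h Dx; rewrite h.
Qed.

Local Notation RR := (measurableTypeR R * measurableTypeR R)%type.

Definition mpos2 F := measurable_fun (Rp `*` Rp : set RR) (fun z => F z.1 z.2).

Lemma measurable_Rpos2 : measurable (Rp `*` Rp : set RR).
Proof. exact: measurableX. Qed.
Hint Resolve measurable_Rpos2 : core.

Lemma mpos2_fst f : mpos f -> mpos2 (fun s _ => f s).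
Proof.
move=> mf; apply: (measurable_comp (F := Rp)) mf _ => //.
- by move=> _ [[s t] [/= ? ?] <-].
- exact: measurable_funS measurable_fst.
Qed.

Lemma mpos2_snd f : mpos f -> mpos2 (fun _ t => f t).
Proof.
move=> mf; apply: (measurable_comp (F := Rp)) mf _ => //.
- by move=> _ [[s t] [/= ? ?] <-].
- exact: measurable_funS measurable_snd.
Qed.

Lemma mpos2M F G : mpos2 F -> mpos2 G -> mpos2 (fun s t => F s t * G s t).
Proof. exact: measurable_funM. Qed.

Lemma mpos2D F G : mpos2 F -> mpos2 G -> mpos2 (fun s t => F s t + G s t).
Proof. exact: measurable_funD. Qed.

Lemma mpos2_cst k : mpos2 (fun _ _ => k).
Proof. exact: measurable_cst. Qed.

Lemma mpos2_comp (h : R -> R) F : measurable_fun setT h -> mpos2 F ->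
  mpos2 (fun s t => h (F s t)).
Proof. by move=> mh mF; exact: measurableT_comp. Qed.

Lemma mpos2_flip F : mpos2 F -> mpos2 (fun s t => F t s).
Proof.
move=> mF; apply: (measurable_comp (F := Rp `*` Rp : set RR) (g := fun z : RR => (z.2, z.1))) mF _ => //.
- by move=> _ [[s t] [/= ? ?] <-].
- apply: (measurable_funS _ _ (@measurable_swap _ _ (measurableTypeR R) (measurableTypeR R))) => //.
Qed.

Lemma mpos2_mposr F s : mpos2 F -> 0 < s -> mpos (F s).
Proof.
move=> mF s0.
apply: (measurable_comp (F := Rp `*` Rp : set RR) (g := pair s)) mF _ => //.
  by move=> _ [t t0 <-]; split => //=; rewrite RposE.
exact: measurable_funS (pair1_measurable s).
Qed.

Lemma mpos2_mposl F t : mpos2 F -> 0 < t -> mpos (F^~ t).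
Proof. by move=> /mpos2_flip /mpos2_mposr; exact. Qed.

(** Extension by zero outside the quadrant: the product-measure theorems are applied on the whole
    plane, while [F] is measurable on the quadrant only. *)
Let patch2 F : RR -> \bar R :=
  fun z => (((fun z : R * R => F z.1 z.2) \_ (Rp `*` Rp)) z)%:E.

Let patch2E F s t : 0 < s -> 0 < t -> patch2 F (s, t) = (F s t)%:E.
Proof.
move=> s0 t0; rewrite /patch2 patchE mem_set//.
by split; rewrite /= RposE.
Qed.

Let patch20l F s t : ~ Rp s -> patch2 F (s, t) = 0%E.
Proof. by move=> s0; rewrite /patch2 patchE memNset// => -[]. Qed.

Let patch20r F s t : ~ Rp t -> patch2 F (s, t) = 0%E.
Proof. by move=> s0; rewrite /patch2 patchE memNset// => -[]. Qed.

Let measurable_patch2 F : mpos2 F -> measurable_fun setT (patch2 F).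
Proof.
by move=> mF; apply/measurable_EFinP; apply/(measurable_restrictT _ _).1.
Qed.

Let integral_patch2r F s : 0 < s ->
  (\int[mu]_t patch2 F (s, t) = \int[mu]_(t in Rp) (F s t)%:E)%E.
Proof.
move=> s0; rewrite [RHS]integral_mkcond; apply: eq_integral => t _.
rewrite patchE; case: ifPn; first by rewrite in_Rpos => t0; rewrite patch2E.
by move/negP; rewrite inE => t0; rewrite patch20r.
Qed.

Let patch2_flip F s t : patch2 F (s, t) = patch2 (fun s t => F t s) (t, s).
Proof.
have [s0|s0] := pselect (Rp s); last by rewrite patch20l// patch20r.
have [t0|t0] := pselect (Rp t); last by rewrite patch20r// patch20l.
by rewrite !RposE in s0 t0; rewrite !patch2E.
Qed.

Let integral2_patch2 F : (\int[mu]_s \int[mu]_t patch2 F (s, t) =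
  \int[mu]_(s in Rp) \int[mu]_(t in Rp) (F s t)%:E)%E.
Proof.
rewrite [RHS]integral_mkcond; apply: eq_integral => s _.
rewrite patchE; case: ifPn; first by rewrite in_Rpos => s0; rewrite integral_patch2r.
move/negP; rewrite inE => s0.
by under eq_integral do rewrite patch20l//; rewrite integral0.
Qed.

Let integral2_patch2' F : (\int[mu]_t \int[mu]_s patch2 F (s, t) =
  \int[mu]_(t in Rp) \int[mu]_(s in Rp) (F s t)%:E)%E.
Proof.
rewrite -(integral2_patch2 (fun s t => F t s)); apply: eq_integral => t _.
by apply: eq_integral => s _; rewrite patch2_flip.
Qed.

(** Tonelli's theorem gives the measurability of the section integrals of the positive and of the
    negative part; the signed integral is their difference. *)
Lemma measurable_integral_mpos2 F : mpos2 F ->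
  measurable_fun (Rp : set (measurableTypeR R))
    (fun s => \int[mu]_(t in Rp) (F s t)%:E)%E.
Proof.
move=> mF.
have h : measurable_fun (setT : set (measurableTypeR R)) (fun s => \int[mu]_t patch2 F (s, t))%E.
  have mp := measurable_patch2 mF.
  have p0 z : (0 <= (patch2 F)^\+ z)%E by exact: funepos_ge0.
  have n0 z : (0 <= (patch2 F)^\- z)%E by exact: funeneg_ge0.
  have hp := measurable_fun_fubini_tonelli_F (m2 := mu) _ (measurable_funepos mp) p0.
  have hn := measurable_fun_fubini_tonelli_F (m2 := mu) _ (measurable_funeneg mp) n0.
  apply: eq_measurable_fun (emeasurable_funB hp hn) => s _.
  rewrite /fubini_F [RHS]integralE.
  by congr (_ - _)%E; apply: eq_integral => t _; rewrite ?funeposE ?funenegE.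
apply: eq_measurable_fun (measurable_funS _ _ h) => //.
by move=> s; rewrite in_Rpos => s0; rewrite integral_patch2r.
Qed.

Lemma mpos_Ipos F : mpos2 F -> mpos (fun s => Ipos (F s)).
Proof.
move=> mF; have := measurable_integral_mpos2 mF.
by move=> h; apply: measurableT_comp.
Qed.

Lemma tonelli F : mpos2 F -> (forall s t, 0 < s -> 0 < t -> 0 <= F s t) ->
  (\int[mu]_(s in Rp) \int[mu]_(t in Rp) (F s t)%:E =
   \int[mu]_(t in Rp) \int[mu]_(s in Rp) (F s t)%:E)%E.
Proof.
move=> mF F0; rewrite -integral2_patch2 -integral2_patch2'.
apply: (fubini_tonelli (patch2 F)); first exact: measurable_patch2.
move=> [s t].
have [s0|s0] := pselect (Rp s); last by rewrite patch20l// patch20r.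
have [t0|t0] := pselect (Rp t); last by rewrite patch20r// patch20l.
by rewrite !RposE in s0 t0; rewrite patch2E// lee_fin F0.
Qed.

Let integrable_patch2 F : mpos2 F ->
  (\int[mu]_(s in Rp) \int[mu]_(t in Rp) `|(F s t)%:E| < +oo)%E ->
  (mu \x mu)%E.-integrable setT (patch2 F).
Proof.
move=> mF iiF; apply/integrable12ltyP; first exact: measurable_patch2.
have -> : (fun x => \int[mu]_y `|patch2 F (x, y)|)%E =
    (fun x => \int[mu]_y patch2 (fun s t => `|F s t|%R) (x, y))%E.
  apply/funext => x; apply: eq_integral => y _.
  by rewrite /patch2 !patchE; case: ifPn => //= _; rewrite normr0.
by rewrite integral2_patch2.
Qed.

Lemma fubini F : mpos2 F -> (forall s, 0 < s -> integ (F s)) ->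
  integ (fun s => Ipos (fun t => `|F s t|)) ->
  integ (fun t => Ipos (F^~ t)) /\
  Ipos (fun s => Ipos (F s)) = Ipos (fun t => Ipos (F^~ t)).
Proof.
move=> mF iF iiF.
have iiF' : (\int[mu]_(s in Rp) \int[mu]_(t in Rp) `|(F s t)%:E| < +oo)%E.
  rewrite (_ : (\int[mu]_(s in Rp) _ = \int[mu]_(s in Rp)
    (Ipos (fun t => `|F s t|))%:E)%E); last first.
    apply: eq_integral => s; rewrite in_Rpos => s0.
    by rewrite EFin_Ipos//; apply: integ_abs; exact: iF.
  apply/integ_ge0P => //; first by apply: mpos_Ipos; apply: mpos2_comp.
  by move=> x x0; exact: Ipos_ge0.
have ip := integrable_patch2 mF iiF'.
have ip' : (mu \x mu)%E.-integrable setT (patch2 (fun s t => F t s)).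
  apply: integrable_patch2; first exact: mpos2_flip.
  rewrite (tonelli (F := fun s t => `|F t s|)) ?iiF'//.
  by apply: mpos2_comp => //; exact: mpos2_flip.
have := Fubini ip.
rewrite integral2_patch2 integral2_patch2' => E.
have Il : (\int[mu]_(s in Rp) \int[mu]_(t in Rp) (F s t)%:E)%E =
   (\int[mu]_(s in Rp) (Ipos (F s))%:E)%E.
  apply: eq_integral => s; rewrite in_Rpos => s0.
  by rewrite EFin_Ipos//; exact: iF.
have := integrable_fubini_F ip'.
rewrite /fubini_F => iG.
have iG' : mu.-integrable Rp (fun t => \int[mu]_(s in Rp) (F s t)%:E)%E.
  apply: eq_integrable (integrableS _ measurable_Rpos _ iG) => //.
  by move=> t; rewrite in_Rpos => t0; rewrite integral_patch2r.
have iF' : integ (fun t => Ipos (F^~ t)).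
  apply: (le_integrable measurable_Rpos _ _ iG').
    by apply/measurable_EFinP; apply: mpos_Ipos; exact: mpos2_flip.
  move=> t _ /=; rewrite /Ipos /Rintegral.
  by case: (\int[mu]_(s in Rp) (F s t)%:E)%E => [r||] //=; rewrite ?leey.
split; first exact: iF'.
have iFs : integ (fun s => Ipos (F s)).
  apply: le_integ iiF; first exact: mpos_Ipos.
  by move=> x x0; apply: ler_norm_Ipos; exact: iF.
have E1 : (Ipos (fun s => Ipos (F s)))%:E =
    (\int[mu]_(t in Rp) \int[mu]_(s in Rp) (F s t)%:E)%E.
  by rewrite (EFin_Ipos iFs) -Il.
apply: EFin_inj; rewrite E1 (EFin_Ipos iF').
apply: ae_eq_integral.
- exact: measurable_Rpos.
- exact: measurable_int iG'.
- exact: measurable_int iF'.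
(* The inner integral is finite for almost every t only; elsewhere [Ipos] returns the default value
   0, which the outer integral does not see. *)
have := integrable_ae measurable_Rpos iG'.
by apply: filterS => t h Dt; rewrite /Ipos /Rintegral fineK//; exact: h.
Qed.

End PositiveHalfLine.

#[local] Hint Resolve measurable_Rpos measurable_Rpos2 : core.

(** * Weighted square-integrable functions *)

Section WeightedL2.
Variable R : realType.
Implicit Types (x s t k M p : R) (f g u v : R -> R).

Local Notation mu := (@lebesgue_measure R).
Local Notation Rp := (@Rpos R).

Lemma sqr_le_cvg0 (u v : nat -> R) k : (forall n, u n ^+ 2 <= k * v n) ->
  v n @[n --> \oo] --> 0 -> u n @[n --> \oo] --> 0.
Proof.
move=> uv v0; have kv : k * v n @[n --> \oo] --> 0.
  by rewrite -[X in _ --> X](mulr0 k); exact: cvgMr.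
apply/cvgrPdist_le => e e0.
have e20 : 0 < e ^+ 2 by rewrite exprn_gt0.
have /cvgrPdist_le/(_ _ e20)[N _ hN] := kv.
exists N => // n /hN /=; rewrite !sub0r !normrN => h.
rewrite -ler_sqr ?nnegrE// ?(ltW e0)// real_normK ?num_real//.
by rewrite (le_trans (uv n))// (le_trans _ h)// ler_norm.
Qed.

Lemma cvgn_addn (u : nat -> R) (l : R) N : u n @[n --> \oo] --> l ->
  u (n + N)%N @[n --> \oo] --> l.
Proof. by rewrite -(cvg_shiftn N). Qed.

Lemma mposD f g : mpos f -> mpos g -> mpos (fun x => f x + g x).
Proof. exact: measurable_funD. Qed.

Lemma mposB f g : mpos f -> mpos g -> mpos (fun x => f x - g x).
Proof. exact: measurable_funB. Qed.

Lemma mposM f g : mpos f -> mpos g -> mpos (fun x => f x * g x).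
Proof. exact: measurable_funM. Qed.

Lemma mposX f n : mpos f -> mpos (fun x => f x ^+ n).
Proof. exact: measurable_funX. Qed.

Lemma mpos_comp (h : R -> R) f : measurable_fun setT h -> mpos f ->
  mpos (h \o f).
Proof. by move=> mh mf; exact: measurableT_comp. Qed.

Lemma mpos_powR p : mpos (fun x => x `^ p).
Proof. by apply: mposT; exact: measurable_powR. Qed.

Lemma mpos_norm f : mpos f -> mpos (fun x => `|f x|).
Proof. exact: mpos_comp. Qed.

Lemma mpos_cst k : mpos (fun=> k).
Proof. exact: measurable_cst. Qed.

Lemma mpos_id : mpos (fun x => x).
Proof. by apply: mposT; exact: measurable_id. Qed.

Lemma measurable_inv : measurable_fun setT (@GRing.inv R).
Proof.
(* Real powers are measurable and invert positive numbers; passing through the square covers both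
   signs and respects the convention that the inverse of 0 is 0. *)
rewrite (_ : @GRing.inv R = (fun x => x * (x ^+ 2) `^ (-1))).
  apply: measurable_funM => //.
  apply: (@measurableT_comp _ _ _ _ _ _ (@powR R ^~ (-1))).
    exact: measurable_powR.
  exact: measurable_funX.
apply/funext => x; rewrite powR_inv1 ?sqr_ge0//.
have [->|x0] := eqVneq x 0; first by rewrite invr0 mul0r.
by field.
Qed.

Lemma mposV f : mpos f -> mpos (fun x => (f x)^-1).
Proof. by move=> mf; apply: mpos_comp => //; exact: measurable_inv. Qed.

Lemma mpos2V (F : R -> R -> R) : mpos2 F -> mpos2 (fun s t => (F s t)^-1).
Proof. by move=> mF; apply: mpos2_comp => //; exact: measurable_inv. Qed.

(** Multiplication by the indicator of the complement of a measurable null set reduces the claim to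
    convergence at every point. *)
Lemma Ipos_fatou_ae (fn : nat -> R -> R) f M : (forall n, integ (fn n)) ->
  mpos f -> (forall n x, 0 < x -> 0 <= fn n x) ->
  (forall x, 0 < x -> 0 <= f x) ->
  {ae mu, forall x, Rp x -> fn n x @[n --> \oo] --> f x} ->
  (forall n, Ipos (fn n) <= M) -> integ f /\ Ipos f <= M.
Proof.
move=> ifn mf fn0 f0 [A [mA A0 hA]] fM.
have mAc : mpos (\1_(~` A) : R -> R).
  by apply: measurable_indic; exact: measurableC.
pose gn n x := fn n x * \1_(~` A) x.
have h1 n x : 0 < x -> `|gn n x| <= fn n x.
  move=> x0; rewrite /gn indicE; case: (_ \in _) => /=.
    by rewrite mulr1 ger0_norm// fn0.
  by rewrite mulr0 normr0 fn0.
have ign n : integ (gn n).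
  apply: (le_integ _ (h1 n)) => //.
  by apply: mposM => //; exact: integ_mpos.
have [||||ig gM] := @Ipos_fatou _ gn (fun x => f x * \1_(~` A) x) M.
- exact: ign.
- move=> n x x0; rewrite /gn; apply: mulr_ge0; first exact: fn0.
  by rewrite indicE.
- move=> x x0; have [Ax|Ax] := pselect (A x).
    rewrite /gn !indicE (_ : x \in ~` A = false) ?mulr0; last first.
      by apply/negbTE/negP; rewrite inE; exact.
    by under eq_fun do rewrite mulr0; exact: cvg_cst.
  rewrite /gn !indicE (_ : x \in ~` A = true) ?mulr1; last by apply/mem_set.
  under eq_fun do rewrite mulr1.
  apply: contrapT => nc; apply: Ax; apply: hA => /= /(_ _)/nc; apply.
  by rewrite RposE.
- move=> n; apply: le_trans (fM n); apply: le_Ipos => // x x0.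
  by apply: le_trans (h1 _ _ x0); exact: ler_norm.
have E : ae_eq mu Rp (fun x => f x * \1_(~` A) x) f.
  exists A; split => // x /=; apply: contra_notP => Ax Dx.
  by rewrite indicE mem_set// mulr1.
split; first exact: ae_integ E ig.
by rewrite -(ae_Ipos (integ_mpos ig) mf E).
Qed.

(** The integral of (k u + v)^2 is a nonnegative quadratic in k. Its value at [- b / a] gives the
    inequality; if [a = 0] and [b] were nonzero, the point [- (c + 1) / (2 * b)] would give the
    value - 1. *)
Lemma cauchy_schwarz u v : mpos u -> mpos v ->
  integ (fun x => u x ^+ 2) -> integ (fun x => v x ^+ 2) ->
  integ (fun x => u x * v x) /\
  Ipos (fun x => u x * v x) ^+ 2 <=
    Ipos (fun x => u x ^+ 2) * Ipos (fun x => v x ^+ 2).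
Proof.
move=> mu' mv iu iv.
have iuv : integ (fun x => u x * v x).
  apply: le_integ (integD iu iv); first exact: mposM.
  move=> x _; rewrite ler_norml; apply/andP; split; last by nra.
  by have := sqr_ge0 (u x + v x); rewrite sqrrD; nra.
split => //.
set a := Ipos (fun x => u x ^+ 2); set b := Ipos _; set c := Ipos _.
have a0 : 0 <= a by apply: Ipos_ge0 => x _; exact: sqr_ge0.
have c0 : 0 <= c by apply: Ipos_ge0 => x _; exact: sqr_ge0.
have H k : 0 <= a * k ^+ 2 + 2 * b * k + c.
  have -> : a * k ^+ 2 + 2 * b * k + c =
      Ipos (fun x => u x ^+ 2 * k ^+ 2 + u x * v x * (2 * k) + v x ^+ 2).
    rewrite IposD//; last by apply: integD; exact: integZr.
    rewrite IposD//; [|exact: integZr|exact: integZr].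
    by rewrite !IposZr// -/a -/b -/c; ring.
  apply: Ipos_ge0 => x _.
  by have := sqr_ge0 (u x * k + v x); rewrite sqrrD exprMn; nra.
have [a_gt0|] := ltP 0 a.
  have := H (- b / a); rewrite -(pmulr_rge0 _ a_gt0).
  have -> : a * (a * (- b / a) ^+ 2 + 2 * b * (- b / a) + c) =
    a * c - b ^+ 2 by field; rewrite gt_eqF.
  by rewrite subr_ge0.
move=> a_le0; have a00 : a = 0 by apply/eqP; rewrite eq_le a_le0.
rewrite a00 mul0r.
have [->|bn0] := eqVneq b 0; first by rewrite expr0n.
have := H (- (c + 1) / (2 * b)); rewrite a00.
have -> : 0 * (- (c + 1) / (2 * b)) ^+ 2 + 2 * b * (- (c + 1) / (2 * b)) + c =
  - 1 by field.
by rewrite oppr_ge0 ler10.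
Qed.

Definition L2 p f := mpos f /\ integ (fun x => f x ^+ 2 * x `^ p).

Definition sqnorm p f := Ipos (fun x => f x ^+ 2 * x `^ p).

Definition dotp p f g := Ipos (fun x => f x * g x * x `^ p).

Lemma sqw_ge0 p f x : 0 <= f x ^+ 2 * x `^ p.
Proof. by rewrite mulr_ge0 ?sqr_ge0 ?powR_ge0. Qed.

Lemma sqnorm_ge0 p f : 0 <= sqnorm p f.
Proof. by apply: Ipos_ge0 => x _; exact: sqw_ge0. Qed.

Lemma eq_L2 p f g : (forall x, 0 < x -> f x = g x) -> L2 p f -> L2 p g.
Proof.
move=> fg [mf If]; split; first exact: eq_mpos fg mf.
by apply: eq_integ If => x x0; rewrite fg.
Qed.

Lemma eq_sqnorm p f g : (forall x, 0 < x -> f x = g x) ->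
  sqnorm p f = sqnorm p g.
Proof. by move=> fg; apply: eq_Ipos => x x0; rewrite fg. Qed.

Let sqw p f x : 0 < x -> (f x * x `^ (p / 2)) ^+ 2 = f x ^+ 2 * x `^ p.
Proof.
move=> x0; rewrite exprMn -[_ `^ _ ^+ 2]powR_mulrn ?powR_ge0//.
by rewrite -powRrM divfK.
Qed.

Lemma dotp_cs p f g : L2 p f -> L2 p g ->
  integ (fun x => f x * g x * x `^ p) /\
  dotp p f g ^+ 2 <= sqnorm p f * sqnorm p g.
Proof.
move=> [mf If] [mg Ig].
have E x : 0 < x -> f x * x `^ (p / 2) * (g x * x `^ (p / 2)) =
    f x * g x * x `^ p.
  move=> x0; rewrite mulrACA -powRD_gt0//.
  by congr (_ * _ `^ _); field.
have [||||] := @cauchy_schwarz (fun x => f x * x `^ (p / 2))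
    (fun x => g x * x `^ (p / 2)).
- by apply: mposM => //; exact: mpos_powR.
- by apply: mposM => //; exact: mpos_powR.
- by apply: eq_integ If => x x0; rewrite sqw.
- by apply: eq_integ Ig => x x0; rewrite sqw.
move=> i1 i2; split; first exact: eq_integ i1.
move: i2; rewrite (eq_Ipos E) (eq_Ipos (@sqw p f)).
by rewrite (eq_Ipos (@sqw p g)).
Qed.

(** Without a weight in the pairing, the exponents p and - p are dual to each other. Kernels whose
    sections lie in [L2 (- p)] therefore have absolutely convergent integrals against every element
    of [L2 p]. *)
Lemma pairing_cs p f g : L2 p f -> L2 (- p) g ->
  integ (fun x => f x * g x) /\
  Ipos (fun x => f x * g x) ^+ 2 <= sqnorm p f * sqnorm (- p) g.
Proof.
move=> [mf If] [mg Ig].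
have E x : 0 < x -> f x * x `^ (p / 2) * (g x * x `^ (- p / 2)) = f x * g x.
  move=> x0; rewrite mulrACA -powRD_gt0//.
  by rewrite (_ : p / 2 + - p / 2 = 0) ?powRr0 ?mulr1//; field.
have [||||] := @cauchy_schwarz (fun x => f x * x `^ (p / 2))
    (fun x => g x * x `^ (- p / 2)).
- by apply: mposM => //; exact: mpos_powR.
- by apply: mposM => //; exact: mpos_powR.
- by apply: eq_integ If => x x0; rewrite sqw.
- by apply: eq_integ Ig => x x0; rewrite sqw.
move=> i1 i2; split; first exact: eq_integ i1.
move: i2; rewrite (eq_Ipos E) (eq_Ipos (@sqw p f)).
by rewrite (eq_Ipos (@sqw (- p) g)).
Qed.

Lemma L2Z p k f : L2 p f -> L2 p (fun x => k * f x).
Proof.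
move=> [mf If]; split; first by apply: mposM => //; exact: mpos_cst.
apply: eq_integ (integZl (k ^+ 2) If) => x _.
by rewrite exprMn mulrA.
Qed.

Lemma sqnormZ p k f : L2 p f ->
  sqnorm p (fun x => k * f x) = k ^+ 2 * sqnorm p f.
Proof.
move=> [mf If]; rewrite /sqnorm -IposZl//; apply: eq_Ipos => x _.
by rewrite exprMn mulrA.
Qed.

Let sq2 p f g x : (f x + g x) ^+ 2 * x `^ p <=
  2 * (f x ^+ 2 * x `^ p) + 2 * (g x ^+ 2 * x `^ p).
Proof.
rewrite !mulrA -mulrDl ler_wpM2r ?powR_ge0//.
by have := sqr_ge0 (f x - g x); nra.
Qed.

Lemma L2D p f g : L2 p f -> L2 p g -> L2 p (fun x => f x + g x).
Proof.
move=> [mf If] [mg Ig]; split; first exact: mposD.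
apply: le_integ (integD (integZl 2 If) (integZl 2 Ig)).
  by apply: mposM; [apply: mposX; exact: mposD|exact: mpos_powR].
by move=> x _; rewrite ger0_norm ?(sqw_ge0 p (fun x => f x + g x)).
Qed.

Lemma sqnormD_le p f g : L2 p f -> L2 p g ->
  sqnorm p (fun x => f x + g x) <= 2 * sqnorm p f + 2 * sqnorm p g.
Proof.
move=> Lf Lg; have [mf If] := Lf; have [mg Ig] := Lg.
rewrite /sqnorm -!IposZl// -IposD; [|exact: integZl..].
apply: le_Ipos => //; first exact: (L2D Lf Lg).2.
by apply: integD; exact: integZl.
Qed.

Lemma L2N p f : L2 p f -> L2 p (fun x => - f x).
Proof. by move=> /(L2Z (-1)); apply: eq_L2 => x _; rewrite mulN1r. Qed.

Lemma L2B p f g : L2 p f -> L2 p g -> L2 p (fun x => f x - g x).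
Proof. by move=> Lf Lg; apply: L2D => //; exact: L2N. Qed.

Lemma sqnormN p f : sqnorm p (fun x => - f x) = sqnorm p f.
Proof. by apply: eq_Ipos => x _; rewrite sqrrN. Qed.

Lemma sqnormBC p f g :
  sqnorm p (fun x => f x - g x) = sqnorm p (fun x => g x - f x).
Proof. by apply: eq_Ipos => x _; rewrite -sqrrN opprB. Qed.

Lemma sqnormB_le p f g : L2 p f -> L2 p g ->
  sqnorm p (fun x => f x - g x) <= 2 * sqnorm p f + 2 * sqnorm p g.
Proof.
by move=> Lf Lg; rewrite -(sqnormN p g); apply: sqnormD_le => //; exact: L2N.
Qed.

Lemma sqnormB3_le p f g h : L2 p f -> L2 p g -> L2 p h ->
  sqnorm p (fun x => f x - h x) <=
  2 * sqnorm p (fun x => f x - g x) + 2 * sqnorm p (fun x => g x - h x).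
Proof.
move=> Lf Lg Lh; apply: le_trans (sqnormD_le (L2B Lf Lg) (L2B Lg Lh)).
by rewrite (@eq_sqnorm p (fun x => f x - h x)
  (fun x => f x - g x + (g x - h x)))// => x _; rewrite addrA subrK.
Qed.

Lemma L20 p : L2 p (fun=> 0).
Proof.
split; first exact: mpos_cst.
by apply: eq_integ (integ0 R) => x _; rewrite expr0n mul0r.
Qed.

Lemma sqnormDE p f g : L2 p f -> L2 p g ->
  sqnorm p (fun x => f x + g x) = sqnorm p f + 2 * dotp p f g + sqnorm p g.
Proof.
move=> Lf Lg; have [mf If] := Lf; have [mg Ig] := Lg.
have [Ifg _] := dotp_cs Lf Lg.
rewrite /sqnorm /dotp -IposZl// -IposD//; last exact: integZl.
rewrite -IposD//; last by apply: integD => //; exact: integZl.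
by apply: eq_Ipos => x _; ring.
Qed.

Lemma L2_norm p f : L2 p f -> L2 p (fun x => `|f x|).
Proof.
move=> [mf If]; split; first exact: mpos_norm.
by apply: eq_integ If => x _; rewrite real_normK// num_real.
Qed.

Lemma le_L2 p f g : mpos f -> (forall x, 0 < x -> `|f x| <= g x) -> L2 p g ->
  L2 p f /\ sqnorm p f <= sqnorm p g.
Proof.
move=> mf fg [mg Ig].
have h x : 0 < x -> f x ^+ 2 * x `^ p <= g x ^+ 2 * x `^ p.
  move=> x0; rewrite ler_wpM2r ?powR_ge0//.
  rewrite -[leLHS]real_normK ?num_real// ler_pXn2r// ?nnegrE ?fg//.
  exact: le_trans (fg _ x0).
have If : integ (fun x => f x ^+ 2 * x `^ p).
  apply: le_integ Ig.
    by apply: mposM; [exact: mposX|exact: mpos_powR].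
  by move=> x x0; rewrite ger0_norm ?sqw_ge0// h.
by split; [split|apply: le_Ipos].
Qed.

Lemma ae_L2 p f g : mpos g -> ae_eq mu Rp f g -> L2 p f ->
  L2 p g /\ sqnorm p f = sqnorm p g.
Proof.
move=> mg fg [mf If].
have E : ae_eq mu Rp (fun x => f x ^+ 2 * x `^ p) (fun x => g x ^+ 2 * x `^ p).
  by apply: ae_imp fg => x h Dx; rewrite h.
have mg2 : mpos (fun x => g x ^+ 2 * x `^ p).
  by apply: mposM; [exact: mposX|exact: mpos_powR].
split; first by split => //; exact: ae_integ E If.
by apply: ae_Ipos => //; exact: integ_mpos.
Qed.

Lemma sqnorm_eq0 p f : L2 p f -> sqnorm p f = 0 -> ae_eq mu Rp f (fun=> 0).
Proof.
move=> [mf If] /(Ipos_eq0 If) h.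
have {h} : ae_eq mu Rp (fun x => f x ^+ 2 * x `^ p) (fun=> 0).
  by apply: h => x _; rewrite mulr_ge0 ?sqr_ge0 ?powR_ge0.
apply: ae_imp => x h Dx; have /eqP := h Dx.
have x0 : 0 < x by rewrite -RposE.
by rewrite mulf_eq0 sqrf_eq0 (gt_eqF (powR_gt0 p x0)) orbF => /eqP.
Qed.

Lemma sqnorm_eq0B p f g : L2 p f -> L2 p g ->
  sqnorm p (fun x => f x - g x) = 0 -> ae_eq mu Rp f g.
Proof.
move=> Lf Lg /(sqnorm_eq0 (L2B Lf Lg)).
by apply: ae_imp => x h Dx; have /eqP := h Dx; rewrite subr_eq0 => /eqP.
Qed.

Lemma L2_dct p (fn : nat -> R -> R) f g : (forall n, mpos (fn n)) ->
  (forall x, 0 < x -> fn n x @[n --> \oo] --> f x) ->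
  (forall n x, 0 < x -> `|fn n x| <= g x) -> L2 p g ->
  L2 p f /\ sqnorm p (fun x => fn n x - f x) @[n --> \oo] --> 0.
Proof.
move=> mfn ff fg Lg; have [mg Ig] := Lg.
have mf : mpos f by apply: mpos_cvg ff.
have fg' x : 0 < x -> `|f x| <= g x.
  move=> x0; have <- : limn (fun n => `|fn n x|) = `|f x|.
    by apply/cvg_lim => //; apply: cvg_norm; exact: ff.
  apply: limr_le; last by apply: nearW => n; exact: fg.
  by apply/cvg_ex; exists `|f x|; apply: cvg_norm; exact: ff.
have [Lf _] := le_L2 mf fg' Lg; split => //.
have [||||_] := @Ipos_dct _ (fun n x => (fn n x - f x) ^+ 2 * x `^ p)
  (fun=> 0) (fun x => 4 * (g x ^+ 2 * x `^ p)).
- by move=> n; apply: mposM; [apply: mposX; exact: mposB|exact: mpos_powR].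
- move=> x x0; rewrite -[X in _ --> X](mul0r (x `^ p)); apply: cvgMl.
  have h : fn n x - f x @[n --> \oo] --> f x - f x.
    by apply: cvgB; [exact: ff|exact: cvg_cst].
  by apply: cvgn_ext (cvgM h h) => //; rewrite subrr mulr0.
- move=> n x x0; rewrite ger0_norm ?(sqw_ge0 p (fun x => fn n x - f x))// mulrA.
  rewrite ler_wpM2r ?powR_ge0//.
  have := fg n x x0; have := fg' x x0; rewrite !ler_norml.
  by move=> /andP[? ?] /andP[? ?]; nra.
- exact: integZl.
by rewrite Ipos0; exact.
Qed.

Lemma L2_fatou p (fn : nat -> R -> R) f M : mpos f -> (forall n, L2 p (fn n)) ->
  {ae mu, forall x, Rp x -> fn n x @[n --> \oo] --> f x} ->
  (forall n, sqnorm p (fn n) <= M) -> L2 p f /\ sqnorm p f <= M.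
Proof.
move=> mf Lfn ff fM.
have [||||||If fM'] := @Ipos_fatou_ae (fun n x => fn n x ^+ 2 * x `^ p)
  (fun x => f x ^+ 2 * x `^ p) M.
- by move=> n; exact: (Lfn n).2.
- by apply: mposM; [exact: mposX|exact: mpos_powR].
- by move=> n x _; rewrite mulr_ge0 ?sqr_ge0 ?powR_ge0.
- by move=> x _; rewrite mulr_ge0 ?sqr_ge0 ?powR_ge0.
- apply: ae_imp ff => x h Dx; apply: cvgMl.
  by apply: cvgn_ext (cvgM (h Dx) (h Dx)).
- exact: fM.
by split.
Qed.

(** Fatou's lemma on the tails of [fn - g] bounds the squared norm of f - g by every positive
    number, so a pointwise limit and a norm limit of one sequence coincide. *)
Lemma L2_lim_unique p (fn : nat -> R -> R) f g : mpos f ->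
  (forall n, L2 p (fn n)) -> L2 p g ->
  {ae mu, forall x, Rp x -> fn n x @[n --> \oo] --> f x} ->
  sqnorm p (fun x => fn n x - g x) @[n --> \oo] --> 0 -> ae_eq mu Rp f g.
Proof.
move=> mf Lfn Lg ff fg.
have h (e : R) : 0 < e -> L2 p (fun x => f x - g x) /\
    sqnorm p (fun x => f x - g x) <= e.
  move=> e0; have [N _ hN] := (cvgrPdist_le _ _).1 fg _ e0.
  apply: (@L2_fatou p (fun n x => fn (n + N)%N x - g x)).
  - by apply: mposB => //; case: Lg.
  - by move=> n; exact: L2B.
  - apply: ae_imp ff => x hx Dx; apply: cvgB; last exact: cvg_cst.
    by apply: (@cvgn_addn (fn^~ x)); exact: hx.
  - move=> n; have := hN (n + N)%N (leq_addl _ _).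
    by rewrite sub0r normrN ger0_norm// sqnorm_ge0.
have Lfg := (h 1 ltr01).1.
have := @sqnorm_eq0 p _ Lfg; move=> /(_ _)/ae_imp; apply.
  by move=> x /= h' Dx; have /eqP := h' Dx; rewrite subr_eq0 => /eqP.
apply/eqP; rewrite eq_le sqnorm_ge0 andbT; apply/ler_addgt0Pl => e e0.
by rewrite addr0; exact: (h e e0).2.
Qed.

Lemma sqnorm_cvg p (fn : nat -> R -> R) f : (forall n, L2 p (fn n)) -> L2 p f ->
  sqnorm p (fun x => fn n x - f x) @[n --> \oo] --> 0 ->
  sqnorm p (fn n) @[n --> \oo] --> sqnorm p f.
Proof.
move=> Lfn Lf h.
have E n : sqnorm p (fn n) = sqnorm p f +
    2 * dotp p f (fun x => fn n x - f x) + sqnorm p (fun x => fn n x - f x).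
  rewrite -sqnormDE//; last exact: L2B.
  by apply: eq_sqnorm => x _; rewrite addrC subrK.
apply: (cvgn_ext E (addr0 _)); apply: cvgD => //.
rewrite -[X in _ --> X]addr0; apply: cvgD; first exact: cvg_cst.
rewrite -[X in _ --> X](mulr0 2); apply: cvgMr.
apply: (sqr_le_cvg0 _ h) => n.
exact: (dotp_cs Lf (L2B (Lfn n) Lf)).2.
Qed.

Lemma pairing_cvg p (fn : nat -> R -> R) f g : (forall n, L2 p (fn n)) ->
  L2 p f -> L2 (- p) g ->
  sqnorm p (fun x => fn n x - f x) @[n --> \oo] --> 0 ->
  Ipos (fun x => fn n x * g x) @[n --> \oo] --> Ipos (fun x => f x * g x).
Proof.
move=> Lfn Lf Lg h.
have If := (pairing_cs Lf Lg).1.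
have E n : Ipos (fun x => fn n x * g x) =
    Ipos (fun x => f x * g x) + Ipos (fun x => (fn n x - f x) * g x).
  rewrite -IposD//; last exact: (pairing_cs (L2B (Lfn n) Lf) Lg).1.
  by apply: eq_Ipos => x _; ring.
apply: (cvgn_ext E (addr0 _)); apply: cvgD; first exact: cvg_cst.
apply: (sqr_le_cvg0 (k := sqnorm (- p) g) _ h) => n; rewrite mulrC.
exact: (pairing_cs (L2B (Lfn n) Lf) Lg).2.
Qed.

End WeightedL2.

(** * Completeness and the Schur test *)

Section Completeness.
Variable R : realType.
Implicit Types (x s t k M p e : R) (f g v : R -> R) (u : nat -> R -> R).

Local Notation mu := (@lebesgue_measure R).
Local Notation Rp := (@Rpos R).

Lemma cvgn_geometric_step (a : nat -> R) k :
  (forall n, `|a n.+1 - a n| <= k / 2 ^+ n) -> cvgn a.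
Proof.
move=> ak.
have k0 : 0 <= k.
  by have := le_trans (normr_ge0 _) (ak 0%N); rewrite expr0 divr1.
have : cvgn (series (telescope a)).
  apply: normed_cvg; apply: (@series_le_cvg _ _ (geometric k 2^-1)).
  - by move=> n; exact: normr_ge0.
  - by move=> n; rewrite /= mulr_ge0// exprn_ge0.
  - by move=> n; rewrite /= exprVn; exact: ak.
  - by apply: is_cvg_geometric_series; rewrite ger0_norm// invf_lt1// ltr1n.
move=> /cvg_ex[l hl]; apply/cvg_ex; exists (a 0%N + l).
rewrite [X in X @ _ --> _](_ : a = fun n => a 0%N + series (telescope a) n).
  exact: (cvgD (cvg_cst _) hl).
by apply/funext => n; exact: eq_sum_telescope.
Qed.

(** The core of the Riesz-Fischer theorem. The series of terms 4^n |u (n+1) - u n|^2 x^p has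
    integrals at most 4^n / 8^n = 2^-n, hence a finite sum almost everywhere; at such a point the
    increments are at most a multiple of 2^-n, and the sequence converges. *)
Lemma L2_fast_cauchy_cvg p u : (forall n, L2 p (u n)) ->
  (forall n, sqnorm p (fun x => u n.+1 x - u n x) <= (8 ^+ n)^-1) ->
  exists2 g, mpos g & {ae mu, forall x, Rp x -> u n x @[n --> \oo] --> g x}.
Proof.
move=> Lu hu.
pose d n x := u n.+1 x - u n x.
have Ld n : L2 p (d n) by exact: L2B.
pose T n x : R := 4 ^+ n * (d n x ^+ 2 * x `^ p).
have T0 n x : 0 <= T n x by rewrite mulr_ge0 ?exprn_ge0 ?sqw_ge0.
have iT n : integ (T n) by apply: integZl; exact: (Ld n).2.
have mT n : measurable_fun (Rp : set (measurableTypeR R)) (fun x => (T n x)%:E).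
  by apply/measurable_EFinP; exact: integ_mpos.
pose S : R -> \bar R := fun x => (\sum_(n <oo) (T n x)%:E)%E.
have iS : mu.-integrable Rp S.
  apply/integrableP; split.
    by apply: ge0_emeasurable_sum => // n x _ _; rewrite lee_fin.
  rewrite (_ : (\int[mu]_(x in Rp) `|S x|)%E = (\int[mu]_(x in Rp) S x)%E); last first.
    apply: eq_integral => x _; rewrite gee0_abs//.
    by apply: nneseries_ge0 => n _ _; rewrite lee_fin.
  rewrite integral_nneseries//; last by move=> n x _; rewrite lee_fin.
  have h n : (\int[mu]_(x in Rp) (T n x)%:E <= (2 / (2 ^ (n + 1))%:R)%:E)%E.
    rewrite -EFin_Ipos// lee_fin /T IposZl; last exact: (Ld n).2.
    apply: le_trans (_ : 4 ^+ n * (8 ^+ n)^-1 <= _).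
      by rewrite ler_wpM2l ?exprn_ge0//; exact: hu.
    rewrite -exprVn -exprMn natrX addn1 exprS invfM mulrA divff// mul1r.
    by rewrite -exprVn lerXn2r// ?nnegrE//; lra.
  apply: (@le_lt_trans _ _ (\sum_(n <oo) (2 / (2 ^ (n + 1))%:R)%:E)%E).
    apply: lee_nneseries => // n _ _.
    by apply: integral_ge0 => x _; rewrite lee_fin.
  have /cvg_lim := @cvg_geometric_eseries_half R 2 0.
  by move=> ->//; rewrite ltry.
(* The upper limit is measurable whether or not the sequence converges, and equals the limit where
   there is one. *)
exists (fun x => fine (limn_esup (fun n => (u n x)%:E))).
  apply: measurableT_comp => //; apply: measurable_fun_limn_esup => n.
  by apply/measurable_EFinP; exact: (Lu n).1.
have Sfin : {ae mu, forall x, Rp x -> exists r, S x = r%:E}.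
  have := integrable_ae (@measurable_Rpos R) iS.
  by apply: filterS => x h Dx; exists (fine (S x)); rewrite fineK// h.
apply: ae_imp Sfin => x Sx Dx.
have x0 : 0 < x by rewrite -RposE.
suff : cvgn (u^~ x).
  move=> /cvg_ex[l hl].
  have hl' : (u n x)%:E @[n --> \oo] --> l%:E by apply/cvg_EFin => //; exact: nearW.
  by have [_ ->] := cvg_limn_einf_sup hl'.
have {Sx} [r E] := Sx Dx.
have Tr n : T n x <= r.
  rewrite -lee_fin -E; apply: le_trans (nneseries_lim_ge n.+1 _) => /=.
    by rewrite big_nat_recr//= leeDr//; apply: sume_ge0 => i _; rewrite lee_fin.
  by move=> i _ _; rewrite lee_fin.
have xp : 0 < x `^ p by exact: powR_gt0.
apply: (@cvgn_geometric_step _ (Num.sqrt (r / x `^ p))) => n.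
rewrite -/(d n x) ler_pdivlMr ?exprn_gt0// -sqrtr_sqr.
rewrite -[2 ^+ n]ger0_norm ?exprn_ge0// -[`|2 ^+ n|]sqrtr_sqr -sqrtrM ?sqr_ge0//.
rewrite ler_wsqrtr// ler_pdivlMr// -exprM mulnC exprM.
have := Tr n; rewrite /T (_ : 2 ^+ 2 = 4 :> R); last by rewrite -natrX.
by apply: le_trans; rewrite le_eqVlt; apply/orP; left; apply/eqP; ring.
Qed.

Lemma L2_complete p u : (forall n, L2 p (u n)) ->
  (forall e, 0 < e -> exists N, forall m n, (N <= m)%N -> (N <= n)%N ->
     sqnorm p (fun x => u m x - u n x) <= e) ->
  exists2 g, L2 p g & sqnorm p (fun x => u n x - g x) @[n --> \oo] --> 0.
Proof.
move=> Lu cu.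
have /choice[N hN] : forall k : nat, exists N, forall m n, (N <= m)%N -> (N <= n)%N ->
    sqnorm p (fun x => u m x - u n x) <= (8 ^+ k)^-1.
  by move=> k; apply: cu; rewrite invr_gt0 exprn_gt0.
(* Adding the partial sums of [N] makes [phi] nondecreasing, at least [N k] and at least k. *)
pose phi (k : nat) := (k + \sum_(i < k.+1) N i)%N.
have phiN (k : nat) : (N k <= phi k)%N.
  by rewrite /phi big_ord_recr/= addnA leq_addl.
have phiS (k : nat) : (phi k <= phi k.+1)%N.
  by rewrite /phi [in leqRHS]big_ord_recr/= addnA (leq_trans _ (leq_addr _ _))// leq_add2r.
have phik (k : nat) : (k <= phi k)%N by rewrite leq_addr.
pose v (k : nat) := u (phi k).
have [||g mg gv] := @L2_fast_cauchy_cvg p v.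
- by move=> k; exact: Lu.
- by move=> k; apply: hN => //; exact: leq_trans (phiS k).
(* Fatou's lemma along the subsequence, with n fixed, transfers the Cauchy estimate from u n - v k
   to u n - g. *)
have key e : 0 < e -> exists M : nat, forall n, (M <= n)%N ->
    L2 p (fun x => u n x - g x) /\ sqnorm p (fun x => u n x - g x) <= e.
  move=> /cu[M hM]; exists M => n Mn.
  apply: (@L2_fatou _ _ (fun (k : nat) x => u n x - v (k + M)%N x)).
  - by apply: mposB => //; case: (Lu n).
  - by move=> k; apply: L2B; exact: Lu.
  - apply: ae_imp gv => x gx Dx; apply: cvgB; first exact: cvg_cst.
    by apply: (@cvgn_addn _ (v^~ x)); exact: gx.
  - by move=> k; apply: hM => //; rewrite (leq_trans _ (phik _))// leq_addl.
have Lg : L2 p g.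
  have [M hM] := key 1 ltr01; have [L _] := hM M (leqnn _).
  apply: eq_L2 (L2B (Lu M) L) => x _.
  by rewrite opprB addrCA subrr addr0.
exists g => //; apply/cvgrPdist_le => e /key[M hM].
exists M => // n /hM[_]; rewrite sub0r normrN ger0_norm//.
exact: sqnorm_ge0.
Qed.

End Completeness.

(** * The Schur test with power weights *)

Section Schur.
Variable R : realType.
Implicit Types (x s t k M p e : R) (f g v : R -> R) (K : R -> R -> R).

Local Notation mu := (@lebesgue_measure R).
Local Notation Rp := (@Rpos R).

(** Cauchy-Schwarz is applied to the splitting of K |f| into sqrt K t^(-a/2) and sqrt K t^(a/2) |f|.
    The first factor yields C1 x^(-a), which the weight x^(2a - 1) turns into C1 x^(a - 1), the
    power tested by the second hypothesis; [F] is the resulting majorant, and Tonelli's theorem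
    integrates it in x first. *)
Lemma schur_test K (a C1 C2 : R) f : mpos2 K ->
  (forall x t, 0 < x -> 0 < t -> 0 <= K x t) -> 0 < C1 -> 0 <= C2 ->
  (forall x, 0 < x -> integ (fun t => K x t * t `^ (- a)) /\
     Ipos (fun t => K x t * t `^ (- a)) <= C1 * x `^ (- a)) ->
  (forall t, 0 < t -> integ (fun x => K x t * x `^ (a - 1)) /\
     Ipos (fun x => K x t * x `^ (a - 1)) <= C2 * t `^ (a - 1)) ->
  L2 (2 * a - 1) f -> (forall x, 0 < x -> integ (fun t => K x t * `|f t|)) ->
  L2 (2 * a - 1) (fun x => Ipos (fun t => K x t * `|f t|)) /\
  sqnorm (2 * a - 1) (fun x => Ipos (fun t => K x t * `|f t|)) <=
    C1 * C2 * sqnorm (2 * a - 1) f.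
Proof.
move=> mK K0 C10 C20 h1 h2 [mf If] iKf.
pose F x t := C1 * x `^ (a - 1) * (K x t * (t `^ a * f t ^+ 2)).
have F0 x t : 0 < x -> 0 < t -> 0 <= F x t.
  by move=> x0 t0; have := K0 x t x0 t0; rewrite /F => ?; ge0.
have mF : mpos2 F.
  apply: mpos2M.
    by apply: (@mpos2_fst _ (fun x => _ * _)); apply: mposM; [exact: mpos_cst|exact: mpos_powR].
  apply: mpos2M => //; apply: (@mpos2_snd _ (fun t => _ * _)).
  by apply: mposM; [exact: mpos_powR|exact: mposX].
have mKf : mpos2 (fun x t => K x t * `|f t|).
  by apply: mpos2M => //; apply: mpos2_snd; exact: mpos_norm.
have mg : mpos (fun x => Ipos (fun t => K x t * `|f t|)) by exact: mpos_Ipos.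
have step1 x : 0 < x ->
    ((Ipos (fun t => K x t * `|f t|) ^+ 2 * x `^ (2 * a - 1))%:E <=
     \int[mu]_(t in Rp) (F x t)%:E)%E.
  move=> x0.
  have mFx : mpos (F x) by exact: mpos2_mposr.
  (* Where the majorant has an infinite integral there is nothing to prove. *)
  have [Fy|] := leP +oo%E (\int[mu]_(t in Rp) (F x t)%:E)%E.
    by rewrite (le_trans _ Fy)// leey.
  move=> /(integ_ge0P mFx (fun t => F0 x t x0)) iF.
  rewrite -EFin_Ipos// lee_fin.
  have c0 : 0 < C1 * x `^ (a - 1) by rewrite mulr_gt0// powR_gt0.
  have iG : integ (fun t => K x t * (t `^ a * f t ^+ 2)).
    apply: eq_integ (integZl (C1 * x `^ (a - 1))^-1 iF) => t _.
    by rewrite /F mulKf// gt_eqF.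
  have [h1i h1l] := h1 x x0.
  pose u t := Num.sqrt (K x t) * t `^ (- a / 2).
  pose v t := Num.sqrt (K x t) * (t `^ (a / 2) * `|f t|).
  have mKx : mpos (fun t => Num.sqrt (K x t)).
    have -> : (fun t => Num.sqrt (K x t)) = (fun t => Num.sqrt t) \o K x by [].
    apply: mpos_comp; last exact: mpos2_mposr.
    by apply: continuous_measurable_fun; exact: sqrt_continuous.
  have hp t b : (t `^ (b / 2)) ^+ 2 = t `^ b.
    by rewrite -[_ ^+ 2]powR_mulrn ?powR_ge0// -powRrM divfK.
  have uE t : 0 < t -> u t ^+ 2 = K x t * t `^ (- a).
    by move=> t0; rewrite exprMn sqr_sqrtr ?K0// hp.
  have vE t : 0 < t -> v t ^+ 2 = K x t * (t `^ a * f t ^+ 2).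
    by move=> t0; rewrite 2!exprMn sqr_sqrtr ?K0// hp real_normK ?num_real.
  have uvE t : 0 < t -> u t * v t = K x t * `|f t|.
    move=> t0; rewrite /u /v mulrACA -expr2 sqr_sqrtr ?K0//; congr (_ * _).
    rewrite mulrA -powRD_gt0// (_ : - a / 2 + a / 2 = 0) ?powRr0 ?mul1r//.
    by field.
  have [||||_] := @cauchy_schwarz _ u v.
  - by apply: mposM => //; exact: mpos_powR.
  - by apply: mposM => //; apply: mposM; [exact: mpos_powR|exact: mpos_norm].
  - by apply: eq_integ h1i => t t0; rewrite uE.
  - by apply: eq_integ iG => t t0; rewrite vE.
  rewrite (eq_Ipos uE) (eq_Ipos vE) (eq_Ipos uvE) => cs.
  apply: le_trans (_ : (C1 * x `^ (- a)) *
      Ipos (fun t => K x t * (t `^ a * f t ^+ 2)) * x `^ (2 * a - 1) <= _).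
    rewrite ler_wpM2r ?powR_ge0// (le_trans cs)// ler_wpM2r//.
    by apply: Ipos_ge0 => t t0; have := K0 x t x0 t0 => ?; ge0.
  rewrite /F IposZl// (_ : a - 1 = - a + (2 * a - 1)); last by ring.
  by rewrite (@powRD_gt0 _ x (- a))// le_eqVlt; apply/orP; left; apply/eqP; ring.
have step2 t : 0 < t -> (\int[mu]_(x in Rp) (F x t)%:E <=
    (C1 * C2 * (f t ^+ 2 * t `^ (2 * a - 1)))%:E)%E.
  move=> t0; have [h2i h2l] := h2 t t0.
  have FE x : 0 < x -> K x t * x `^ (a - 1) * (C1 * (t `^ a * f t ^+ 2)) = F x t.
    by move=> x0; rewrite /F; ring.
  rewrite -EFin_Ipos; last by apply: eq_integ FE _; exact: integZr.
  rewrite lee_fin -(eq_Ipos FE) IposZr//.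
  apply: le_trans (_ : C2 * t `^ (a - 1) * (C1 * (t `^ a * f t ^+ 2)) <= _).
    by rewrite ler_wpM2r//; ge0.
  have -> : 2 * a - 1 = (a - 1) + a by ring.
  by rewrite (@powRD_gt0 _ t (a - 1))// le_eqVlt; apply/orP; left; apply/eqP; ring.
have key : (\int[mu]_(x in Rp)
    (Ipos (fun t => K x t * `|f t|) ^+ 2 * x `^ (2 * a - 1))%:E <=
    (C1 * C2 * sqnorm (2 * a - 1) f)%:E)%E.
  apply: (@le_trans _ _ (\int[mu]_(x in Rp) \int[mu]_(t in Rp) (F x t)%:E)%E).
    apply: ge0_le_integral => //=.
    - exact: measurable_Rpos.
    - by move=> x _; rewrite lee_fin; exact: (sqw_ge0 _ (fun x => Ipos (fun t => K x t * `|f t|))).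
    - apply/measurable_EFinP; apply: mposM; [exact: mposX|exact: mpos_powR].
    - exact: measurable_integral_mpos2.
    by move=> x; rewrite RposE; exact: step1.
  rewrite tonelli//.
  apply: (@le_trans _ _ (\int[mu]_(t in Rp)
      (C1 * C2 * (f t ^+ 2 * t `^ (2 * a - 1)))%:E)%E); last first.
    by rewrite -EFin_Ipos; [rewrite IposZl|exact: integZl].
  apply: ge0_le_integral => //=.
  - exact: measurable_Rpos.
  - move=> t; rewrite RposE => t0; apply: integral_ge0 => x; rewrite RposE => x0.
    by rewrite lee_fin F0.
  - by apply: measurable_integral_mpos2; exact: mpos2_flip.
  - apply/measurable_EFinP; apply: mposM; first exact: mpos_cst.
    by apply: mposM; [exact: mposX|exact: mpos_powR].
  by move=> t; rewrite RposE; exact: step2.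
have [i1 i2] := integ_ge0_le (mposM (mposX 2 mg) (mpos_powR _))
  (fun x _ => sqw_ge0 _ (fun x => Ipos (fun t => K x t * `|f t|)) x) key.
by split.
Qed.

End Schur.

(** * Elementary integrals *)

Section Antiderivatives.
Variable R : realType.
Implicit Types (x s t k M p e a b : R) (f g v F : R -> R) (D : set R).

Local Notation mu := (@lebesgue_measure R).
Local Notation Rp := (@Rpos R).

Lemma derivable_continuous f x : derivable f x 1 -> {for x, continuous f}.
Proof. by move=> fx; exact/differentiable_continuous/derivable1_diffP. Qed.

Lemma is_derive_continuous f x (d : R) : is_derive x 1 f d -> {for x, continuous f}.
Proof. by move=> [fx _]; exact: derivable_continuous. Qed.

Lemma mpos_indic (A : set (measurableTypeR R)) : measurable A ->
  mpos (\1_A : R -> R).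
Proof. by move=> mA; apply: measurable_indic. Qed.

Lemma itv_FTC F f a b : 0 < a -> a < b ->
  (forall x, a <= x <= b -> is_derive x 1 F (f x)) ->
  (forall x, a <= x <= b -> derivable f x 1) ->
  integ (fun x => f x * \1_`[a, b] x) /\
  Ipos (fun x => f x * \1_`[a, b] x) = F b - F a.
Proof.
move=> a0 ab dF df.
have sub : `[a, b] `<=` Rp.
  by move=> x; rewrite RposE /= in_itv/= => /andP[ax _]; exact: lt_le_trans ax.
have cf : {within `[a, b], continuous f}.
  by apply: derivable_within_continuous => x; rewrite in_itv; exact: df.
have intf : mu.-integrable `[a, b] (EFin \o f).
  by apply: continuous_compact_integrable => //; exact: segment_compact.
have E : Ipos (fun x => f x * \1_`[a, b] x) = \int[mu]_(x in `[a, b]) f x.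
  rewrite -[in RHS](setIidr sub) Rintegral_mkcondr.
  by rewrite (@patch_indic _ _ f).
split.
  rewrite /integ (_ : EFin \o _ = (EFin \o f) \_ `[a, b]); last first.
    apply/funext => x /=; rewrite patchE indicE.
    by case: (_ \in _); rewrite ?mulr1 ?mulr0.
  by apply/integrable_restrict => //; rewrite setIidr.
have cF x : a <= x <= b -> {for x, continuous F}.
  by move=> /dF; exact: is_derive_continuous.
rewrite E /Rintegral (@continuous_FTC2 _ f F)//.
- split.
  + by move=> x; rewrite in_itv/= => /andP[ax xb]; apply: ex_derive; apply: dF;
      rewrite !ltW.
  + by apply: cvg_at_right_filter; apply: cF; rewrite lexx ltW.
  + by apply: cvg_at_left_filter; apply: cF; rewrite lexx ltW.
- move=> x; rewrite in_itv/= => /andP[ax xb].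
  have [_] : is_derive x 1 F (f x) by apply: dF; rewrite !ltW.
  by rewrite derive1E.
Qed.

Lemma cvg_indic_exhaust D (A : nat -> set R) x :
  (forall n, A n `<=` A n.+1) -> D = \bigcup_n A n ->
  \forall n \near \oo, (\1_(A n) x : R) = \1_D x.
Proof.
move=> ndA ->; have [[N _ AN]|nA] := pselect ((\bigcup_n A n) x); last first.
  apply: nearW => n; rewrite !indicE !memNset//.
  by move=> An; apply: nA; exists n.
exists N => // n Nn; rewrite !indicE !mem_set//; first by exists N.
move/subnK : Nn => <-; elim: (n - N)%N => // m ih.
by rewrite addSn; exact: ndA.
Qed.

Variables (D : set R) (al be : nat -> R) (F f : R -> R) (l1 l2 : R).
Hypothesis albe : forall n, 0 < al n < be n.
Hypothesis nial : forall n, al n.+1 <= al n.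
Hypothesis ndbe : forall n, be n <= be n.+1.
Hypothesis DE : D = \bigcup_n `[al n, be n]%classic.
Hypothesis dF : forall x, D x -> is_derive x 1 F (f x).
Hypothesis df : forall x, D x -> derivable f x 1.
Hypothesis F1 : F (al n) @[n --> \oo] --> l1.
Hypothesis F2 : F (be n) @[n --> \oo] --> l2.

Let A n : set R := `[al n, be n].

Let ndA n : A n `<=` A n.+1.
Proof.
move=> x; rewrite /A /= !in_itv/= => /andP[h1 h2].
by rewrite (le_trans (nial n))// (le_trans h2).
Qed.

Let AD n : A n `<=` D. Proof. by rewrite DE => x Ax; exists n. Qed.

Let FTC_n n : integ (fun x => f x * \1_(A n) x) /\
  Ipos (fun x => f x * \1_(A n) x) = F (be n) - F (al n).
Proof.
have /andP[? ?] := albe n; apply: itv_FTC => // x h.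
  by apply/dF/(@AD n); rewrite /A /= in_itv.
by apply/df/(@AD n); rewrite /A /= in_itv.
Qed.

Let cvg_fA x : f x * \1_(A n) x @[n --> \oo] --> f x * \1_D x.
Proof.
apply: cvg_near_cst; apply: filterS (cvg_indic_exhaust x ndA DE) => n ->.
by [].
Qed.

(** The fundamental theorem holds on each compact interval of the exhaustion; dominated convergence
    carries it to the union. *)
Lemma FTC_exhaust_dct : integ (fun x => f x * \1_D x) ->
  Ipos (fun x => f x * \1_D x) = l2 - l1.
Proof.
move=> If.
have [||||_ h] := @Ipos_dct _ (fun n x => f x * \1_(A n) x)
  (fun x => f x * \1_D x) (fun x => `|f x * \1_D x|).
- by move=> n; apply: integ_mpos; case: (FTC_n n).
- by move=> x _; exact: cvg_fA.
- move=> n x _; rewrite !normrM ler_wpM2l// !indicE.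
  case: (boolP (x \in A n)) => [/set_mem/AD Dx|_].
    by rewrite mem_set.
  by rewrite normr0.
- exact: integ_abs.
apply: (cvg_unique _ h) => //.
apply: (@cvgn_ext _ (fun n => F (be n) - F (al n))) => //; last exact: cvgB.
by move=> n; rewrite (FTC_n n).2.
Qed.

(** For a nonnegative integrand integrability is a conclusion: the convergent increments of [F]
    bound the integrals over the compact intervals, and Fatou's lemma passes to the union. *)
Lemma FTC_exhaust_ge0 : (forall x, D x -> 0 <= f x) ->
  integ (fun x => f x * \1_D x) /\ Ipos (fun x => f x * \1_D x) = l2 - l1.
Proof.
move=> f0.
suff If : integ (fun x => f x * \1_D x) by split => //; exact: FTC_exhaust_dct.
have cB : F (be n) - F (al n) @[n --> \oo] --> l2 - l1 by exact: cvgB.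
have [M hM] : exists M, forall n, F (be n) - F (al n) <= M.
  have /cvg_seq_bounded : cvgn (fun n => F (be n) - F (al n)).
    by apply/cvg_ex; exists (l2 - l1).
  move=> [M [_ hM]]; exists (M + 1) => n.
  by apply: le_trans (ler_norm _) _; apply: hM => //; rewrite ltrDl.
have [||||//] := @Ipos_fatou _ (fun n x => f x * \1_(A n) x)
  (fun x => f x * \1_D x) M.
- by move=> n; case: (FTC_n n).
- move=> n x _; rewrite indicE; case: (boolP (x \in A n)) => [/set_mem/AD Dx|_].
    by rewrite mulr1 f0.
  by rewrite mulr0.
- by move=> x _; exact: cvg_fA.
- by move=> n; rewrite (FTC_n n).2.
Qed.

End Antiderivatives.

(** * Integrability of powers, and change of scale *)

Section PowerIntegrals.
Variable R : realType.
Implicit Types (x s t k M p e a b : R) (f g v F : R -> R) (D : set R).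

Lemma powR_cvg0_harmonic p : 0 < p -> n.+1%:R^-1 `^ p @[n --> \oo] --> (0 : R).
Proof.
move=> p0; have h := @powR_cvg0 R p p0.
apply: (cvg_at_rightP (fun a : R => a `^ p) 0 0).1; first exact: h.
by split=> [n|]; [rewrite invr_gt0|exact: cvg_harmonic].
Qed.

Lemma integ_powR_near0 p : -1 < p -> integ (fun x => x `^ p * \1_`]0, 1] x).
Proof.
move=> p1; have p10 : 0 < p + 1 by rewrite -ltrBlDr sub0r.
(* The left endpoints start at 1 / 2, not at 1, so that every interval is nondegenerate. *)
have [|||||||||r _] := @FTC_exhaust_ge0 R `]0, 1] (fun n => n.+2%:R^-1) (fun=> 1)
  (fun x => x `^ (p + 1) / (p + 1)) (fun x => x `^ p) 0 (1 / (p + 1)).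
- by move=> n; rewrite invr_gt0 ltr0n/= invf_lt1// ltr1n.
- by move=> n; rewrite lef_pV2// ?posrE// ler_nat.
- by [].
- apply/seteqP; split => [x|x [n _]]; rewrite /= !in_itv/=.
    move=> /andP[x0 x1]; have [n hn] := near_infty_natSinv_lt (PosNum x0).
    move=> /(_ n (leqnn _)); rewrite /= => h.
    by exists n => //=; rewrite in_itv/= x1 andbT (le_trans _ (ltW h))// lef_pV2// ?posrE// ler_nat.
  by move=> /andP[h ->]; rewrite (lt_le_trans _ h).
- move=> x; rewrite /= in_itv/= => /andP[x0 _].
  have h := is_derive1_powR (p + 1) x0.
  apply: is_derive_eq.
  by rewrite scaler0 add0r addrK /GRing.scale/= mulKf// gt_eqF.
- move=> x; rewrite /= in_itv/= => /andP[x0 _].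
  by apply: derivable_powR; rewrite in_itv/= x0.
- rewrite -[X in _ --> X](mul0r (p + 1)^-1); apply: cvgMl.
  apply: (@cvgn_ext _ (fun n => (n + 1).+1%:R^-1 `^ (p + 1))) => //.
    by move=> n; rewrite addn1.
  exact: (@cvgn_addn R (fun n => n.+1%:R^-1 `^ (p + 1)) 0 1 (powR_cvg0_harmonic p10)).
- by rewrite powR1; exact: cvg_cst.
- by move=> x _; exact: powR_ge0.
- exact: r.
Qed.

Lemma integ_powR_near_infty p : p < -1 ->
  integ (fun x => x `^ p * \1_`[1, +oo[ x).
Proof.
move=> p1; have p10 : p + 1 < 0 by rewrite -ltrBrDr sub0r.
have p11 : 0 < - (p + 1) by rewrite oppr_gt0.
have [|||||||||r _] := @FTC_exhaust_ge0 R `[1, +oo[ (fun=> 1) (fun n => n.+2%:R)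
  (fun x => x `^ (p + 1) / (p + 1)) (fun x => x `^ p) (1 / (p + 1)) 0.
- by move=> n; rewrite ltr01 ltr1n.
- by [].
- by move=> n; rewrite ler_nat.
- rewrite eqEsubset; split => [x|x [n _]]; rewrite /= !in_itv/= andbT.
    move=> x1; exists (Num.truncn x) => //=.
    rewrite in_itv/= x1/= (le_trans (ltW (truncnS_gt _)))//.
    by rewrite ler_nat.
  by move=> /andP[].
- move=> x; rewrite /= in_itv/= andbT => x1.
  have h := is_derive1_powR (p + 1) (lt_le_trans ltr01 x1).
  apply: is_derive_eq.
  by rewrite scaler0 add0r addrK /GRing.scale/= mulKf// lt_eqF.
- move=> x; rewrite /= in_itv/= andbT => x1.
  by apply: derivable_powR; rewrite in_itv/= (lt_le_trans ltr01 x1).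
- by rewrite powR1; exact: cvg_cst.
- rewrite -[X in _ --> X](mul0r (p + 1)^-1); apply: cvgMl.
  apply: (@cvgn_ext _ (fun n => (n + 1).+1%:R^-1 `^ (- (p + 1)))) => //.
    by move=> n; rewrite addn1 -powR_inv1// -powRrM mulN1r opprK.
  exact: (@cvgn_addn R (fun n => n.+1%:R^-1 `^ (- (p + 1))) 0 1 (powR_cvg0_harmonic p11)).
- by move=> x _; exact: powR_ge0.
- exact: r.
Qed.

Lemma integ_powR_le f p q k : -1 < p -> q < -1 -> mpos f ->
  (forall x, 0 < x <= 1 -> `|f x| <= k * x `^ p) ->
  (forall x, 1 <= x -> `|f x| <= k * x `^ q) -> integ f.
Proof.
move=> p1 q1 mf f0 f1.
apply: (le_integ mf _ (integD (integZl k (integ_powR_near0 p1))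
   (integZl k (integ_powR_near_infty q1)))) => x x0.
rewrite !indicE !mem_setE !in_itv/= x0/= andbT.
have k0 : 0 <= k.
  by have := le_trans (normr_ge0 _) (f1 1 (lexx _)); rewrite powR1 mulr1.
have [x1|x1] := leP x 1.
  rewrite mulr1 (le_trans (f0 x _)) ?x0//.
  by rewrite lerDl; case: (1 <= x); rewrite ?mulr1 ?mulr0//; ge0.
by rewrite mulr0 mulr0 add0r (ltW x1) mulr1 f1// ltW.
Qed.

(** This integrand majorises all the rotated ones below: it behaves as s^(b - 1) at 0 and as s^(b -
    1 - b1 - b2) at infinity, both integrable because b lies strictly between 0 and b1 + b2. *)
Lemma integ_powR_rational b b1 b2 r1 r2 : 0 < b < b1 + b2 -> 0 <= b1 -> 0 <= b2 ->
  0 < r1 -> 0 < r2 ->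
  integ (fun s => s `^ (b - 1) / ((r1 + s `^ b1) * (r2 + s `^ b2))).
Proof.
move=> /andP[b0 bb] b10 b20 r10 r20.
(* In the constant, [(r1 * r2)^-1] serves near 0 and 1 near infinity. *)
apply: (@integ_powR_le _ (b - 1) (b - 1 - (b1 + b2)) (1 + (r1 * r2)^-1)).
- by rewrite ltrBrDr addNr.
- by rewrite ltrBlDr ltrBlDr -addrA addrCA addNr addr0.
- apply: mposM; first exact: mpos_powR.
  apply: mposV; apply: mposM; apply: mposD;
    first [exact: mpos_cst|exact: mpos_powR].
- move=> x /andP[x0 _].
  have d1 : 0 < r1 + x `^ b1 by rewrite ltr_pwDl// powR_ge0.
  have d2 : 0 < r2 + x `^ b2 by rewrite ltr_pwDl// powR_ge0.
  rewrite ger0_norm; last by ge0; rewrite invr_ge0; ge0.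
  rewrite mulrC ler_wpM2r ?powR_ge0//.
  rewrite (@le_trans _ _ (r1 * r2)^-1) ?lerDr//.
  rewrite lef_pV2 ?posrE; [|exact: mulr_gt0..].
  by rewrite ler_pM ?(ltW r10) ?(ltW r20)// lerDl powR_ge0.
- move=> x x1.
  have x0 : 0 < x by exact: lt_le_trans x1.
  have d1 : 0 < r1 + x `^ b1 by rewrite ltr_pwDl// powR_ge0.
  have d2 : 0 < r2 + x `^ b2 by rewrite ltr_pwDl// powR_ge0.
  rewrite ger0_norm; last by ge0; rewrite invr_ge0; ge0.
  rewrite (@le_trans _ _ (x `^ (b - 1 - (b1 + b2))))//; last first.
    by rewrite ler_peMl ?powR_ge0// lerDl invr_ge0 mulr_ge0// ltW.
  rewrite powRB; last by rewrite (gt_eqF x0) implybT.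
  rewrite ler_wpM2l ?powR_ge0// powRD_gt0//.
  rewrite lef_pV2 ?posrE; [|exact: mulr_gt0|by rewrite mulr_gt0 ?powR_gt0].
  by rewrite ler_pM ?powR_ge0// lerDr ltW.
Qed.

Local Notation mu := (@lebesgue_measure R).
Local Notation Rp := (@Rpos R).

(** The image of Lebesgue measure under multiplication by k, rescaled by k, agrees with Lebesgue
    measure on half-open intervals; by uniqueness of the measure the two are equal, and the integral
    of a pushforward does the rest. *)
Lemma Ipos_scale k f : 0 < k -> mpos f -> (forall x, 0 < x -> 0 <= f x) ->
  integ (fun x => f (k * x)) ->
  integ f /\ Ipos f = k * Ipos (fun x => f (k * x)).
Proof.
move=> k0 mf f0 ifk.
pose h : measurableTypeR R -> measurableTypeR R := *%R k.
have mk : measurable_fun setT h by exact: mulrl_measurable.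
pose pm : {measure set (measurableTypeR R) -> \bar R} :=
  measure_function_pushforward__canonical__measure_function_Measure mu mk.
pose m : {measure set (measurableTypeR R) -> \bar R} :=
  mscale (NngNum (ltW k0)) pm.
have muE (A : set (measurableTypeR R)) : measurable A -> mu A = m A.
  apply: lebesgue_measure_unique => X /ocitvP[->|[[a b]] /= ab ->].
    by rewrite !measure0.
  rewrite /m /mscale/= /pushforward/=.
  have -> : (h @^-1` `]a, b] = `]a / k, b / k])%classic.
    apply/seteqP; split => x; rewrite /= !in_itv/= ltr_pdivrMr// ler_pdivlMr//;
      by rewrite (mulrC x).
  rewrite !lebesgue_measure_itv/= !lte_fin ab ltr_pM2r ?invr_gt0// ab.
  by rewrite -!EFinD -EFinM; congr EFin; field; rewrite gt_eqF.
have sub : h @^-1` Rp = Rp.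
  by apply/seteqP; split => x; rewrite /preimage/= !RposE /h pmulr_rgt0.
have mf' : measurable_fun (Rp : set (measurableTypeR R)) (EFin \o f).
  exact/measurable_EFinP.
have E : (\int[mu]_(x in Rp) (f x)%:E =
    k%:E * \int[mu]_(x in Rp) (f (k * x)%R)%:E)%E.
  rewrite (@eq_measure_integral _ _ _ _ m mu); last by move=> A mA _; exact: muE.
  rewrite /m ge0_integral_mscale//; last by move=> x; rewrite RposE lee_fin; exact: f0.
  congr (_ * _)%E.
  rewrite (ge0_integral_pushforward mk mu (@measurable_Rpos R) mf'); last first.
    by move=> x; rewrite in_Rpos lee_fin; exact: f0.
  by rewrite sub.
have If : integ f.
  by apply/integ_ge0P => //; rewrite E -(EFin_Ipos ifk) -EFinM ltry.
by split => //; apply: EFin_inj; rewrite (EFin_Ipos If) E -(EFin_Ipos ifk).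
Qed.

End PowerIntegrals.

(** * Rotation of the contour of integration *)

Section Flow.
Variable R : realType.
Implicit Types (x s t k M p e a b : R) (f g v F : R -> R) (D : set R).

Local Notation mu := (@lebesgue_measure R).
Local Notation Rp := (@Rpos R).

Lemma mpos_derivable f : (forall x, 0 < x -> derivable f x 1) -> mpos f.
Proof.
move=> df; apply: open_continuous_measurable_fun; first exact: interval_open.
by move=> x; rewrite inE RposE => x0; exact/derivable_continuous/df.
Qed.

Lemma Rpos_bigcup : Rp = \bigcup_n `[n.+2%:R^-1, n.+2%:R]%classic.
Proof.
rewrite eqEsubset; split => [x|x [n _]]; rewrite /= ?in_itv/= RposE.
  move=> x0; have xM1 : 1 <= Num.max x x^-1.
    have [x1|/ltW x1] := leP 1 x; first by rewrite le_max x1.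
    by rewrite le_max invf_ge1// x1 orbT.
  exists (Num.truncn (Num.max x x^-1)) => //=; rewrite in_itv/=.
  have h : Num.max x x^-1 <= (Num.truncn (Num.max x x^-1)).+2%:R.
    by rewrite (le_trans (ltW (truncnS_gt _)))// ler_nat.
  rewrite (le_trans _ h) ?le_max ?lexx// andbT.
  by rewrite invf_ple ?posrE// (le_trans _ h) ?le_max ?lexx ?orbT.
by move=> /andP[+ _]; apply: lt_le_trans; rewrite invr_gt0.
Qed.

Variables (lo hi : R) (U V Ud : R -> R -> R) (B : R -> R).
Hypothesis hU : forall psi s, lo < psi < hi -> 0 < s ->
  is_derive psi 1 (U^~ s) (Ud psi s).
Hypothesis hV : forall psi s, lo < psi < hi -> 0 < s ->
  is_derive s 1 (V psi) (Ud psi s / s).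
Hypothesis hUd : forall psi s, lo < psi < hi -> 0 < s ->
  derivable (fun s => Ud psi s / s) s 1.
Hypothesis mU : forall psi, lo < psi < hi -> mpos (U psi).
Hypothesis iB : integ B.
Hypothesis UB : forall psi s, lo < psi < hi -> 0 < s -> `|U psi s / s| <= B s.
Hypothesis UdB : forall psi s, lo < psi < hi -> 0 < s -> `|Ud psi s / s| <= B s.
Hypothesis V0 : forall psi, lo < psi < hi -> V psi n.+2%:R^-1 @[n --> \oo] --> 0.
Hypothesis Vy : forall psi, lo < psi < hi -> V psi n.+2%:R @[n --> \oo] --> 0.

Lemma integ_flow psi : lo < psi < hi -> integ (fun s => U psi s / s).
Proof.
move=> hpsi; apply: le_integ iB; last by move=> x; exact: UB.
by apply: mposM; [exact: mU|apply: mposV; exact: mpos_id].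
Qed.

Let integ_flowd psi : lo < psi < hi -> integ (fun s => Ud psi s / s).
Proof.
move=> hpsi; apply: le_integ iB; last by move=> x; exact: UdB.
by apply: mpos_derivable => x; exact: hUd.
Qed.

Let indic1 f s : 0 < s -> f s * \1_Rp s = f s.
Proof. by move=> s0; rewrite indicE mem_set ?mulr1// RposE. Qed.

Let Ipos_flowd psi : lo < psi < hi -> Ipos (fun s => Ud psi s / s) = 0.
Proof.
move=> hpsi.
have := @FTC_exhaust_dct R Rp (fun n => n.+2%:R^-1) (fun n => n.+2%:R) (V psi)
  (fun s => Ud psi s / s) 0 0.
rewrite subr0 (eq_Ipos (g := fun s => Ud psi s / s)); last first.
  by move=> x x0; exact: (indic1 (fun s => Ud psi s / s)).
apply.
- move=> n; rewrite invr_gt0 ltr0n/= (@lt_trans _ _ 1)// ?ltr1n//.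
  by rewrite invf_lt1// ltr1n.
- by move=> n; rewrite lef_pV2// ?posrE// ler_nat.
- by move=> n; rewrite ler_nat.
- exact: Rpos_bigcup.
- by move=> x; rewrite RposE; exact: hV.
- by move=> x; rewrite RposE; exact: hUd.
- exact: V0.
- exact: Vy.
- apply: eq_integ (integ_flowd hpsi) => x x0.
  by rewrite (indic1 (fun s => Ud psi s / s)).
Qed.

Let is_derive_flow psi : lo < psi < hi ->
  is_derive psi 1 (fun psi => Ipos (fun s => U psi s / s)) 0.
Proof.
move=> hpsi.
have I1 : `]lo, hi[%classic psi by rewrite /= in_itv.
have I2 x : `]lo, hi[%classic x -> mu.-integrable Rp (EFin \o (fun s => U x s / s)).
  by rewrite /= in_itv/=; exact: integ_flow.
have dU x s : `]lo, hi[%classic x -> Rp s ->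
    is_derive x 1 (fun x => U x s / s) (Ud x s / s).
  rewrite RposE /= in_itv/= => hx s0; have h := hU hx s0.
  by apply: is_derive_eq; rewrite scaler0 add0r mulrC.
have I3 x s : `]lo, hi[%classic x -> Rp s -> derivable (fun x => U x s / s) x 1.
  by move=> hx s0; apply: ex_derive; exact: dU.
have I5 : mu.-integrable Rp (EFin \o (fun s => `|B s|)) by exact: integ_abs.
have dUE x s : `]lo, hi[%classic x -> Rp s ->
    partial1of2 (fun x s => U x s / s) x s = Ud x s / s.
  move=> hx s0; have [_] := dU x s hx s0.
  by rewrite partial1of2E.
have I6 x s : `]lo, hi[%classic x -> Rp s ->
    `|partial1of2 (fun x s => U x s / s) x s| <= `|B s|.
  move=> hx s0; rewrite dUE//; move: hx s0; rewrite RposE /= in_itv/= => hx s0.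
  by rewrite (le_trans (UdB hx s0))// ler_norm.
have D1 := derivable_under_integral (@measurable_Rpos R) I1 I2 I3
  (fun s => normr_ge0 (B s)) I5 I6.
have D2 := differentiation_under_integral (@measurable_Rpos R) I1 I2 I3
  (fun s => normr_ge0 (B s)) I5 I6.
split; first exact: D1.
rewrite -derive1E; transitivity (Ipos (fun s => Ud psi s / s)); last first.
  exact: Ipos_flowd.
rewrite [LHS]D2; apply: eq_Rintegral => s; rewrite inE => s0.
by rewrite dUE.
Qed.

(** A real form of Cauchy's theorem in a sector. For the measure ds / s the Cauchy-Riemann equations
    in polar coordinates say that [Ud], the angular derivative of [U], is s times the radial
    derivative of a conjugate function [V]. Differentiation under the integral, allowed by the
    majorant [B], then leaves the difference of the limits of [V] at infinity and at 0, which is 0;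
    the mean value theorem concludes. *)
Lemma flow_invariant psi1 psi2 : lo < psi1 < hi -> lo < psi2 < hi ->
  Ipos (fun s => U psi1 s / s) = Ipos (fun s => U psi2 s / s).
Proof.
wlog h12 : psi1 psi2 / psi1 <= psi2.
  by move=> W h1 h2; have [/W|/ltW/W] := leP psi1 psi2; [exact|move=> /(_ h2 h1)].
move=> /andP[h1 _] /andP[_ h2].
pose G psi := Ipos (fun s => U psi s / s).
have h x : psi1 <= x <= psi2 -> is_derive x 1 G 0.
  move=> /andP[x1 x2]; apply: is_derive_flow.
  by rewrite (lt_le_trans h1 x1) (le_lt_trans x2 h2).
have [||c _] := @MVT_segment R G (fun=> 0) psi1 psi2 h12.
- by move=> x; rewrite in_itv/= => /andP[? ?]; apply: h; rewrite !ltW.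
- by apply: derivable_within_continuous => x; rewrite in_itv/= => /h[].
by rewrite mul0r => /eqP; rewrite subr_eq0 => /eqP.
Qed.

End Flow.

(** * Derivatives of complex-valued functions of a real variable *)

Section ComplexDerivative.
Variable R : realType.
Implicit Types (f g : R -> R[i]) (x y : R) (z w : R[i]).

Definition cder f x (d : R[i]) :=
  is_derive x 1 (fun x => complex.Re (f x)) (complex.Re d) /\
  is_derive x 1 (fun x => complex.Im (f x)) (complex.Im d).

Lemma cReD z w : complex.Re (z + w) = complex.Re z + complex.Re w.
Proof. by case: z w => [? ?] [? ?]. Qed.

Lemma cImD z w : complex.Im (z + w) = complex.Im z + complex.Im w.
Proof. by case: z w => [? ?] [? ?]. Qed.

Lemma cReM z w : complex.Re (z * w) =
  complex.Re z * complex.Re w - complex.Im z * complex.Im w.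
Proof. by case: z w => [? ?] [? ?]. Qed.

Lemma cImM z w : complex.Im (z * w) =
  complex.Re z * complex.Im w + complex.Im z * complex.Re w.
Proof. by case: z w => [? ?] [? ?]. Qed.

Lemma cReV z : complex.Re z^-1 =
  complex.Re z / (complex.Re z ^+ 2 + complex.Im z ^+ 2).
Proof. by case: z. Qed.

Lemma cImV z : complex.Im z^-1 =
  - complex.Im z / (complex.Re z ^+ 2 + complex.Im z ^+ 2).
Proof. by case: z => a b; rewrite /= mulNr. Qed.

Lemma cReN z : complex.Re (- z) = - complex.Re z. Proof. by case: z. Qed.
Lemma cImN z : complex.Im (- z) = - complex.Im z. Proof. by case: z. Qed.

Lemma cder_eq f x d d' : cder f x d -> d = d' -> cder f x d'.
Proof. by move=> ? <-. Qed.

Lemma cder_cst z x : cder (fun=> z) x 0.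
Proof. by split; exact: is_derive_cst. Qed.

Lemma cderD f g x df dg : cder f x df -> cder g x dg ->
  cder (fun x => f x + g x) x (df + dg).
Proof.
move=> [f1 f2] [g1 g2]; split.
  rewrite (_ : (fun x => _) = (fun x => complex.Re (f x) + complex.Re (g x))); last first.
    by apply/funext => y; rewrite cReD.
  by rewrite cReD; exact: is_deriveD.
rewrite (_ : (fun x => _) = (fun x => complex.Im (f x) + complex.Im (g x))); last first.
  by apply/funext => y; rewrite cImD.
by rewrite cImD; exact: is_deriveD.
Qed.

Lemma cderM f g x df dg : cder f x df -> cder g x dg ->
  cder (fun x => f x * g x) x (df * g x + f x * dg).
Proof.
move=> [f1 f2] [g1 g2]; split.
  rewrite (_ : (fun x => _) = (fun x => complex.Re (f x) * complex.Re (g x)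
     - complex.Im (f x) * complex.Im (g x))); last first.
    by apply/funext => y; rewrite cReM.
  by apply: is_derive_eq; rewrite cReD !cReM /GRing.scale/=; ring.
rewrite (_ : (fun x => _) = (fun x => complex.Re (f x) * complex.Im (g x)
   + complex.Im (f x) * complex.Re (g x))); last first.
  by apply/funext => y; rewrite cImM.
by apply: is_derive_eq; rewrite cImD !cImM /GRing.scale/=; ring.
Qed.

Lemma cnorm2_gt0 z : z != 0 -> 0 < complex.Re z ^+ 2 + complex.Im z ^+ 2.
Proof.
case: z => a b; rewrite eq_complex/= negb_and => /orP[a0|b0].
  by rewrite ltr_pwDl ?sqr_ge0// exprn_even_gt0.
by rewrite ltr_pwDr ?sqr_ge0// exprn_even_gt0.
Qed.

Lemma is_deriveV1 (f : R -> R) x (df : R) : f x != 0 -> is_derive x 1 f df ->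
  is_derive x 1 (fun x => (f x)^-1) (- df / f x ^+ 2).
Proof.
move=> fx0 [h1 h2]; split; first exact: derivableV.
by rewrite deriveV// h2 /GRing.scale/= mulNr mulrC mulNr.
Qed.

Lemma cderV f x df : f x != 0 -> cder f x df ->
  cder (fun x => (f x)^-1) x (- df / f x ^+ 2).
Proof.
move=> fx0 [f1 f2]; have n0 := cnorm2_gt0 fx0.
have h : is_derive x 1 (fun x => (complex.Re (f x) ^+ 2 + complex.Im (f x) ^+ 2)^-1)
  (- (2 * complex.Re (f x) * complex.Re df + 2 * complex.Im (f x) * complex.Im df)
    / (complex.Re (f x) ^+ 2 + complex.Im (f x) ^+ 2) ^+ 2).
  apply: is_deriveV1; first by rewrite gt_eqF.
  by apply: is_derive_eq; rewrite /GRing.scale/=; ring.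
move: fx0 n0 h f1 f2; case: df => dp dq /=; case E : (f x) => [p q] fx0 /= n0 h f1 f2.
have nz2 : (p * p - q * q) ^+ 2 + (p * q + q * p) ^+ 2 != 0.
  by rewrite (_ : _ + _ = (p ^+ 2 + q ^+ 2) ^+ 2) ?expf_neq0 ?gt_eqF//; ring.
split.
  rewrite (_ : (fun x => _) = (fun x => complex.Re (f x) *
      (complex.Re (f x) ^+ 2 + complex.Im (f x) ^+ 2)^-1)); last first.
    by apply/funext => y; rewrite cReV.
  apply: is_derive_eq; rewrite E /= /GRing.scale/=.
  by field; rewrite nz2 gt_eqF.
rewrite (_ : (fun x => _) = (fun x => - (complex.Im (f x) *
    (complex.Re (f x) ^+ 2 + complex.Im (f x) ^+ 2)^-1))); last first.
  by apply/funext => y; rewrite cImV mulNr.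
apply: is_derive_eq; rewrite E /= /GRing.scale/=.
by field; rewrite nz2 gt_eqF.
Qed.

Lemma normc2 z : normc z ^+ 2 = complex.Re z ^+ 2 + complex.Im z ^+ 2.
Proof. by case: z => a b /=; rewrite sqr_sqrtr// addr_ge0 ?sqr_ge0. Qed.

Lemma normc_ge0 z : 0 <= normc z.
Proof. by case: z => a b; exact: sqrtr_ge0. Qed.

Lemma Re_le_normc z : `|complex.Re z| <= normc z.
Proof.
rewrite -ler_sqr ?nnegrE ?normc_ge0// real_normK ?num_real// normc2.
by rewrite lerDl sqr_ge0.
Qed.

Lemma Im_le_normc z : `|complex.Im z| <= normc z.
Proof.
rewrite -ler_sqr ?nnegrE ?normc_ge0// real_normK ?num_real// normc2.
by rewrite lerDr sqr_ge0.
Qed.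

End ComplexDerivative.

(** * Powers and rational functions on rays *)

Section Rotation.
Variable R : realType.
Implicit Types (x s t b psi : R) (z w : R[i]).

Lemma powRB1M b s : 0 < s -> s `^ b = s `^ (b - 1) * s.
Proof.
by move=> s0; rewrite -{3}(powRr1 (ltW s0)) -powRD_gt0// subrK.
Qed.

Lemma rcM x s : (x * s)%:C = x%:C * s%:C :> R[i].
Proof. exact: rmorphM. Qed.

Lemma normc_real x : 0 <= x -> normc (x%:C : R[i]) = x.
Proof. by move=> x0 /=; rewrite expr0n addr0 sqrtr_sqr ger0_norm. Qed.

Lemma Re_realM x z : complex.Re (x%:C * z) = x * complex.Re z.
Proof. by case: z => ? ?; rewrite /= mul0r subr0. Qed.

Lemma Im_realM x z : complex.Im (x%:C * z) = x * complex.Im z.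
Proof. by case: z => ? ?; rewrite /= mul0r addr0. Qed.

(** The power (s e^(i psi))^b with its argument carried along explicitly, so that no branch has to
    be chosen. *)
Definition polar b psi s : R[i] := (s `^ b * cos (b * psi)) +i* (s `^ b * sin (b * psi)).

Lemma normc_polar b psi s : normc (polar b psi s) = s `^ b.
Proof.
apply/eqP; rewrite -(@eqrXn2 _ 2) ?normc_ge0 ?powR_ge0// normc2 /=.
by rewrite !exprMn -mulrDr cos2Dsin2 mulr1.
Qed.

Lemma polar0 psi s : polar 0 psi s = 1.
Proof. by rewrite /polar powRr0 mul0r cos0 sin0 mulr0 mulr1. Qed.

Lemma polar_angle0 b s : polar b 0 s = (s `^ b)%:C.
Proof. by rewrite /polar mulr0 cos0 sin0 mulr0 mulr1. Qed.

Lemma cder_polar_angle b psi s :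
  cder (fun psi => polar b psi s) psi ((0 +i* b) * polar b psi s).
Proof.
have h : is_derive psi 1 (fun psi => b * psi) b.
  by apply: is_derive_eq; rewrite /GRing.scale/= mulr1.
have hc := is_derive1_comp (is_derive_cos (b * psi)) h.
have hs := is_derive1_comp (is_derive_sin (b * psi)) h.
rewrite /comp /= in hc hs.
split => /=; apply: is_derive_eq; rewrite /GRing.scale/=; ring.
Qed.

Lemma cder_polar b psi s : 0 < s ->
  cder (polar b psi) s ((b / s)%:C * polar b psi s).
Proof.
move=> s0; have h := is_derive1_powR b s0.
have E : s `^ b = s `^ (b - 1) * s.
  exact: powRB1M.
split => /=; apply: is_derive_eq; rewrite /GRing.scale/= E; field;
  by rewrite gt_eqF.
Qed.

(** The function z^b / ((a1 + z^b1) (a2 + z^b2)) on the ray z = s e^(i psi). *)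
Definition rational_polar b a1 b1 a2 b2 psi s : R[i] :=
  polar b psi s * ((a1 + polar b1 psi s)^-1 * (a2 + polar b2 psi s)^-1).

(** The logarithmic derivative z Z'(z) / Z(z) of [rational_polar]. With L for it, the angular
    derivative of Z is i L Z and the radial one is L Z / s; this is the Cauchy-Riemann relation that
    [rotation] uses. *)
Definition logder_polar b a1 b1 a2 b2 psi s : R[i] :=
  b%:C - b1%:C * (polar b1 psi s * (a1 + polar b1 psi s)^-1)
       - b2%:C * (polar b2 psi s * (a2 + polar b2 psi s)^-1).

Variables (lo hi b b1 b2 r1 r2 k : R) (a1 a2 : R[i]).
Hypothesis b_gt0 : 0 < b.
Hypothesis b_lt : b < b1 + b2.
Hypothesis b1_ge0 : 0 <= b1.
Hypothesis b2_ge0 : 0 <= b2.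
Hypothesis r1_gt0 : 0 < r1.
Hypothesis r2_gt0 : 0 < r2.
Hypothesis k_gt0 : 0 < k.
Hypothesis low1 : forall psi s, lo < psi < hi -> 0 < s ->
  k * (r1 + s `^ b1) <= normc (a1 + polar b1 psi s).
Hypothesis low2 : forall psi s, lo < psi < hi -> 0 < s ->
  k * (r2 + s `^ b2) <= normc (a2 + polar b2 psi s).

Let Z := rational_polar b a1 b1 a2 b2.
Let L := logder_polar b a1 b1 a2 b2.

Let pos1 s : 0 < s -> 0 < r1 + s `^ b1.
Proof. by move=> s0; rewrite ltr_pwDl// powR_ge0. Qed.

Let pos2 s : 0 < s -> 0 < r2 + s `^ b2.
Proof. by move=> s0; rewrite ltr_pwDl// powR_ge0. Qed.

Let nz1 psi s : lo < psi < hi -> 0 < s -> a1 + polar b1 psi s != 0.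
Proof.
move=> hp s0; apply/eqP => h; have := low1 hp s0.
by rewrite h normc0 leNgt mulr_gt0 ?pos1.
Qed.

Let nz2 psi s : lo < psi < hi -> 0 < s -> a2 + polar b2 psi s != 0.
Proof.
move=> hp s0; apply/eqP => h; have := low2 hp s0.
by rewrite h normc0 leNgt mulr_gt0 ?pos2.
Qed.

Let iC : R[i] := 0 +i* 1.

Let i_real x : (0 +i* x : R[i]) = iC * x%:C.
Proof. by apply/eqP; rewrite eq_complex /= !mul0r !mulr0 mul1r subrr add0r !eqxx. Qed.

Lemma cder_rational_polar_angle psi s : lo < psi < hi -> 0 < s ->
  cder (fun psi => Z psi s) psi (iC * (L psi s * Z psi s)).
Proof.
move=> hp s0; have n1 := nz1 hp s0; have n2 := nz2 hp s0.
have d1 := cderD (cder_cst a1 psi) (cder_polar_angle b1 psi s).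
have d2 := cderD (cder_cst a2 psi) (cder_polar_angle b2 psi s).
apply: cder_eq (cderM (cder_polar_angle b psi s) (cderM (cderV n1 d1) (cderV n2 d2))) _.
rewrite /L /Z /logder_polar /rational_polar !i_real.
by field; rewrite n1 n2.
Qed.

Lemma cder_rational_polar psi s : lo < psi < hi -> 0 < s ->
  cder (Z psi) s (s^-1%:C * (L psi s * Z psi s)).
Proof.
move=> hp s0; have n1 := nz1 hp s0; have n2 := nz2 hp s0.
have d1 := cderD (cder_cst a1 s) (cder_polar b1 psi s0).
have d2 := cderD (cder_cst a2 s) (cder_polar b2 psi s0).
apply: cder_eq (cderM (cder_polar b psi s0) (cderM (cderV n1 d1) (cderV n2 d2))) _.
rewrite /L /Z /logder_polar /rational_polar !rcM.
move: (s^-1%:C) => c; by field; rewrite n1 n2.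
Qed.

Let cder_logder psi s : lo < psi < hi -> 0 < s -> exists d, cder (L psi) s d.
Proof.
move=> hp s0; have n1 := nz1 hp s0; have n2 := nz2 hp s0.
have p1 := cder_polar b1 psi s0; have p2 := cder_polar b2 psi s0.
have d1 := cderV n1 (cderD (cder_cst a1 s) p1).
have d2 := cderV n2 (cderD (cder_cst a2 s) p2).
eexists; rewrite /L /logder_polar.
have := cderD (cderD (cder_cst b%:C s) (cderM (cder_cst (- b1%:C) s) (cderM p1 d1)))
  (cderM (cder_cst (- b2%:C) s) (cderM p2 d2)).
rewrite (_ : (fun x => _ + _ + _) = logder_polar b a1 b1 a2 b2 psi); first exact.
by apply/funext => y; rewrite /logder_polar !mulNr.
Qed.

Let bd s := s `^ (b - 1) / ((r1 + s `^ b1) * (r2 + s `^ b2)).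

Lemma normc_rational_polar psi s : lo < psi < hi -> 0 < s ->
  normc (Z psi s) <= (k ^+ 2)^-1 * (bd s * s).
Proof.
move=> hp s0; rewrite /Z /rational_polar !normcM !normcV normc_polar.
have q1 := pos1 s0; have q2 := pos2 s0.
have l1 := low1 hp s0; have l2 := low2 hp s0.
have E := powRB1M b s0.
have -> : (k ^+ 2)^-1 * (bd s * s) =
    s `^ b * ((k * (r1 + s `^ b1))^-1 * (k * (r2 + s `^ b2))^-1).
  by rewrite /bd E; field; rewrite !gt_eqF.
rewrite ler_wpM2l ?powR_ge0// ler_pM ?invr_ge0 ?normc_ge0//.
  by rewrite lef_pV2 ?posrE ?mulr_gt0// (lt_le_trans _ l1) ?mulr_gt0.
by rewrite lef_pV2 ?posrE ?mulr_gt0// (lt_le_trans _ l2) ?mulr_gt0.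
Qed.

Let MB := b + b1 / k + b2 / k.

Lemma normc_logder_polar psi s : lo < psi < hi -> 0 < s -> normc (L psi s) <= MB.
Proof.
move=> hp s0.
have h a c (r : R) : 0 < r -> k * (r + s `^ c) <= normc (a + polar c psi s) -> 0 <= c ->
    normc (c%:C * (polar c psi s * (a + polar c psi s)^-1)) <= c / k.
  move=> r0 l c0; rewrite !normcM normcV normc_polar.
  rewrite normc_real//.
  rewrite ler_wpM2l// ler_pdivrMr; last first.
    by rewrite (lt_le_trans _ l)// mulr_gt0// ltr_pwDl// powR_ge0.
  rewrite mulrC ler_pdivlMr// (le_trans _ l)// mulrC ler_wpM2l ?(ltW k_gt0)//.
  by rewrite lerDr ltW.
rewrite /L /logder_polar /MB.
have e1 := le_normcD (b%:C - b1%:C * (polar b1 psi s * (a1 + polar b1 psi s)^-1))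
  (- (b2%:C * (polar b2 psi s * (a2 + polar b2 psi s)^-1))).
have e2 := le_normcD b%:C (- (b1%:C * (polar b1 psi s * (a1 + polar b1 psi s)^-1))).
rewrite !normcN in e1 e2.
rewrite (normc_real (ltW b_gt0)) in e2.
apply: le_trans e1 _; apply: lerD; last exact: h r2_gt0 (low2 hp s0) _.
by apply: le_trans e2 _; apply: lerD => //; exact: h r1_gt0 (low1 hp s0) _.
Qed.

Let bd_ge0 s : 0 <= bd s.
Proof.
rewrite /bd divr_ge0 ?powR_ge0//.
by rewrite mulr_ge0// addr_ge0 ?powR_ge0// ltW.
Qed.

Let MB_ge0 : 0 <= MB.
Proof. by rewrite /MB !addr_ge0 ?divr_ge0// ltW. Qed.

Let k2_ge0 : 0 <= (k ^+ 2)^-1. Proof. by rewrite invr_ge0 sqr_ge0. Qed.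

Let B s := (k ^+ 2)^-1 * (1 + MB) * bd s.

Let integ_B : integ B.
Proof. by apply: integZl; apply: integ_powR_rational => //; rewrite b_gt0. Qed.

Let normc_Z_le psi s : lo < psi < hi -> 0 < s -> normc (Z psi s) <= B s * s.
Proof.
move=> hp s0; apply: le_trans (normc_rational_polar hp s0) _.
rewrite /B -(mulrA _ (bd s)) -(mulrA _ (1 + MB)) ler_wpM2l//.
by rewrite ler_peMl ?lerDl// mulr_ge0// ltW.
Qed.

Let normc_LZ_le psi s : lo < psi < hi -> 0 < s ->
  normc (L psi s * Z psi s) <= B s * s.
Proof.
move=> hp s0; rewrite normcM.
apply: (@le_trans _ _ (MB * ((k ^+ 2)^-1 * (bd s * s)))).
  by rewrite ler_pM ?normc_ge0 ?normc_logder_polar ?normc_rational_polar.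
rewrite /B -(mulrA _ (bd s)) -(mulrA _ (1 + MB)) mulrCA ler_wpM2l//.
by rewrite ler_wpM2r ?lerDr// mulr_ge0// ltW.
Qed.

Let cvg0_le (u v : nat -> R) : (forall n, `|u n| <= v n) ->
  v n @[n --> \oo] --> 0 -> u n @[n --> \oo] --> 0.
Proof.
move=> uv v0; apply/norm_cvg0P; apply: (@squeeze_cvgr _ _ _ _ (fun=> 0) v) => //.
  by apply: nearW => n; rewrite normr_ge0 uv.
exact: cvg_cst.
Qed.

Let posn n : 0 < n.+2%:R :> R. Proof. by []. Qed.
Let posnV n : 0 < n.+2%:R^-1 :> R. Proof. by rewrite invr_gt0. Qed.

Let cvg_harmonic_powR p (c : R) : 0 < p ->
  c * n.+2%:R^-1 `^ p @[n --> \oo] --> 0.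
Proof.
move=> p0; rewrite -[X in _ --> X](mulr0 c); apply: cvgMr.
apply: (@cvgn_ext _ (fun n => (n + 1).+1%:R^-1 `^ p)) => //.
  by move=> n; rewrite addn1.
exact: (@cvgn_addn R (fun n => n.+1%:R^-1 `^ p) 0 1 (powR_cvg0_harmonic p0)).
Qed.

Let cvgZ0 psi : lo < psi < hi -> normc (Z psi n.+2%:R^-1) @[n --> \oo] --> 0.
Proof.
move=> hp; apply: cvg0_le (cvg_harmonic_powR ((k ^+ 2)^-1 * (r1 * r2)^-1) b_gt0) => n.
rewrite ger0_norm ?normc_ge0// (le_trans (normc_rational_polar hp (posnV n)))//.
set s := n.+2%:R^-1; have s0 : 0 < s by exact: posnV.
rewrite -[leRHS]mulrA ler_wpM2l// /bd mulrAC -powRB1M// mulrC ler_wpM2r ?powR_ge0//.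
rewrite lef_pV2 ?posrE; [|by rewrite mulr_gt0// ?pos1 ?pos2|exact: mulr_gt0].
by rewrite ler_pM ?(ltW r1_gt0) ?(ltW r2_gt0)// lerDl powR_ge0.
Qed.

Let cvgZy psi : lo < psi < hi -> normc (Z psi n.+2%:R) @[n --> \oo] --> 0.
Proof.
move=> hp; have b0 : 0 < b1 + b2 - b by rewrite subr_gt0.
apply: cvg0_le (cvg_harmonic_powR (k ^+ 2)^-1 b0) => n.
rewrite ger0_norm ?normc_ge0// (le_trans (normc_rational_polar hp (posn n)))//.
set s : R := n.+2%:R; have s0 : 0 < s by exact: posn.
rewrite ler_wpM2l// -powR_inv1 ?(ltW s0)// -powRrM mulN1r opprB.
rewrite powRB; last by rewrite (gt_eqF s0) implybT.
rewrite /bd mulrAC -powRB1M// ler_wpM2l ?powR_ge0// powRD_gt0//.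
rewrite lef_pV2 ?posrE; [|by rewrite mulr_gt0// ?pos1 ?pos2|by rewrite mulr_gt0 ?powR_gt0].
by rewrite ler_pM ?powR_ge0// lerDr ltW.
Qed.

Let cder_LZ psi s : lo < psi < hi -> 0 < s ->
  exists d, cder (fun s => s^-1%:C * (L psi s * Z psi s)) s d.
Proof.
move=> hp s0; have [d hd] := cder_logder hp s0.
eexists; apply: cderM; last by apply: cderM hd _; exact: cder_rational_polar.
have s_neq0 : (s%:C : R[i]) != 0 by rewrite eq_complex/= gt_eqF.
have -> : (fun s => s^-1%:C) = (fun s : R => (s%:C)^-1 :> R[i]).
  by apply/funext => y; rewrite fmorphV.
have hs : cder (fun s : R => s%:C) s 1.
  by split; [exact: is_derive_id|exact: is_derive_cst].
exact: cderV s_neq0 hs.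
Qed.

(** The conjugate of Re Z is - Im Z and that of Im Z is Re Z. The lower bounds [low1] and [low2]
    keep the zeros of the denominators away from the sector and make L bounded there, so that a
    single integrable [B] dominates Z / s and L Z / s at all angles and Z vanishes at both ends of
    each ray. *)
Lemma rotation psi1 psi2 : lo < psi1 < hi -> lo < psi2 < hi ->
  [/\ integ (fun s => complex.Re (Z psi1 s) / s),
      integ (fun s => complex.Im (Z psi1 s) / s),
      Ipos (fun s => complex.Re (Z psi1 s) / s) =
        Ipos (fun s => complex.Re (Z psi2 s) / s) &
      Ipos (fun s => complex.Im (Z psi1 s) / s) =
        Ipos (fun s => complex.Im (Z psi2 s) / s)].
Proof.
have leB (x s c : R) : 0 < s -> c <= B s * s -> `|x| <= c -> `|x / s| <= B s.
  move=> s0 h1 h2; rewrite normrM normfV (gtr0_norm s0) ler_pdivrMr//.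
  exact: le_trans h1.
have dRe psi s : lo < psi < hi -> 0 < s -> is_derive psi 1
    (fun psi => complex.Re (Z psi s)) (- complex.Im (L psi s * Z psi s)).
  move=> hp s0; have [h _] := cder_rational_polar_angle hp s0.
  by apply: is_derive_eq; rewrite cReM /= mul0r mul1r sub0r.
have dIm psi s : lo < psi < hi -> 0 < s -> is_derive psi 1
    (fun psi => complex.Im (Z psi s)) (complex.Re (L psi s * Z psi s)).
  move=> hp s0; have [_ h] := cder_rational_polar_angle hp s0.
  by apply: is_derive_eq; rewrite cImM /= mul0r mul1r add0r.
have dRes psi s : lo < psi < hi -> 0 < s -> is_derive s 1
    (fun s => complex.Re (Z psi s)) (complex.Re (L psi s * Z psi s) / s).
  move=> hp s0; have [h _] := cder_rational_polar hp s0.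
  by apply: is_derive_eq; rewrite Re_realM mulrC.
have dIms psi s : lo < psi < hi -> 0 < s -> is_derive s 1
    (fun s => - complex.Im (Z psi s)) (- complex.Im (L psi s * Z psi s) / s).
  move=> hp s0; have [_ h] := cder_rational_polar hp s0.
  by apply: is_derive_eq; rewrite Im_realM mulNr mulrC.
have dd1 psi s : lo < psi < hi -> 0 < s ->
    derivable (fun s => - complex.Im (L psi s * Z psi s) / s) s 1.
  move=> hp s0; have [d [_ h]] := cder_LZ hp s0.
  rewrite (_ : (fun s => _) = - (fun s => complex.Im (s^-1%:C * (L psi s * Z psi s)))).
    by apply: derivableN; case: h.
  by apply/funext => y; rewrite [RHS]/(- _) Im_realM mulNr mulrC.
have dd2 psi s : lo < psi < hi -> 0 < s ->
    derivable (fun s => complex.Re (L psi s * Z psi s) / s) s 1.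
  move=> hp s0; have [d [h _]] := cder_LZ hp s0.
  rewrite (_ : (fun s => _) = (fun s => complex.Re (s^-1%:C * (L psi s * Z psi s)))).
    by case: h.
  by apply/funext => y; rewrite Re_realM mulrC.
have mRe psi : lo < psi < hi -> mpos (fun s => complex.Re (Z psi s)).
  by move=> hp; apply: mpos_derivable => s s0; have [] := dRes psi s hp s0.
have mIm psi : lo < psi < hi -> mpos (fun s => complex.Im (Z psi s)).
  move=> hp; apply: mpos_derivable => s s0.
  by have [_ []] := cder_rational_polar hp s0.
have b1' psi s : lo < psi < hi -> 0 < s -> `|complex.Re (Z psi s) / s| <= B s.
  by move=> hp s0; apply: leB (Re_le_normc _) => //; exact: normc_Z_le.
have b2' psi s : lo < psi < hi -> 0 < s -> `|complex.Im (Z psi s) / s| <= B s.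
  by move=> hp s0; apply: leB (Im_le_normc _) => //; exact: normc_Z_le.
have b3' psi s : lo < psi < hi -> 0 < s -> `|complex.Re (L psi s * Z psi s) / s| <= B s.
  by move=> hp s0; apply: leB (Re_le_normc _) => //; exact: normc_LZ_le.
have b4' psi s : lo < psi < hi -> 0 < s -> `|- complex.Im (L psi s * Z psi s) / s| <= B s.
  move=> hp s0; rewrite mulNr normrN.
  by apply: leB (Im_le_normc _) => //; exact: normc_LZ_le.
move=> h1 h2; split.
- by apply: (@integ_flow _ lo hi (fun psi s => complex.Re (Z psi s)) B).
- by apply: (@integ_flow _ lo hi (fun psi s => complex.Im (Z psi s)) B).
- apply: (@flow_invariant _ lo hi (fun psi s => complex.Re (Z psi s))
    (fun psi s => - complex.Im (Z psi s))
    (fun psi s => - complex.Im (L psi s * Z psi s)) B) => // psi hp.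
  + apply: cvg0_le (cvgZ0 hp) => n; rewrite normrN; exact: Im_le_normc.
  + apply: cvg0_le (cvgZy hp) => n; rewrite normrN; exact: Im_le_normc.
- apply: (@flow_invariant _ lo hi (fun psi s => complex.Im (Z psi s))
    (fun psi s => complex.Re (Z psi s))
    (fun psi s => complex.Re (L psi s * Z psi s)) B) => // psi hp.
  + apply: cvg0_le (cvgZ0 hp) => n; exact: Re_le_normc.
  + apply: cvg0_le (cvgZy hp) => n; exact: Re_le_normc.
Qed.

End Rotation.

(** * The regularised kernels *)

Section Kernels.
Variable R : realType.
Implicit Types (x s t a b phi psi : R).

(** The squared modulus of t + x e^(i phi). The factor 1 / pi of the kernels below is supplied by
    [op]. *)
Definition den phi x t := t ^+ 2 + 2 * t * x * cos phi + x ^+ 2.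
Definition kerH phi x t := (t + x * cos phi) / den phi x t.
Definition kerP phi x t := x * sin phi / den phi x t.
Definition kerS x t := (x + t)^-1.
Definition kerA x t := ((Num.sqrt x + Num.sqrt t) * Num.sqrt t)^-1.

(** This is cos^2 (phi / 2), the best constant in low (x + t)^2 <= den, attained for x = t. It
    vanishes at phi = pi, which is why comparison with the Stieltjes kernel is not uniform in
    phi. *)
Definition low phi : R := (1 + cos phi) / 2.

Lemma low_gt0 phi : 0 <= phi < pi -> 0 < low phi.
Proof.
move=> /andP[p0 ppi]; rewrite /low divr_gt0// -ltrBlDl sub0r -cospi.
by rewrite ltr_cos ?in_itv/= ?p0 ?pi_ge0 ?lexx ?(ltW ppi).
Qed.

Lemma cos_le_cos psi phi : `|psi| <= phi -> phi <= pi -> cos phi <= cos psi.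
Proof.
move=> h hpi; have p0 : 0 <= phi := le_trans (normr_ge0 _) h.
have -> : cos psi = cos `|psi|.
  by have [_|_] := ger0P psi; rewrite ?cosN.
have h1 : phi \in `[0, pi] by rewrite in_itv/= p0.
have h2 : `|psi| \in `[0, pi] by rewrite in_itv/= normr_ge0 (le_trans h).
by rewrite leNgt ltr_cos// -leNgt.
Qed.

Lemma denC phi x t : den phi x t = den phi t x.
Proof. by rewrite /den; ring. Qed.

(** For c = cos phi the difference of the two sides is (1 - c) / 2 (x - t)^2, and lowering c only
    lowers the left side. *)
Lemma den_low phi x t c : 0 <= x -> 0 <= t -> c <= cos phi ->
  (1 + c) / 2 * (x + t) ^+ 2 <= den phi x t.
Proof.
move=> x0 t0 c1; rewrite /den.
have c1' := le_trans c1 (cos_le1 phi).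
have xt : 0 <= x * t by exact: mulr_ge0.
have := sqr_ge0 (x - t); nra.
Qed.

Lemma den_gt0 phi x t : 0 <= phi < pi -> 0 < x -> 0 < t -> 0 < den phi x t.
Proof.
move=> hp x0 t0; apply: lt_le_trans (den_low (ltW x0) (ltW t0) (lexx _)).
by rewrite mulr_gt0 ?low_gt0// exprn_gt0// addr_gt0.
Qed.

Lemma normc_add_polar x b psi s : normc (x%:C + polar b psi s) ^+ 2 =
  den (b * psi) x (s `^ b).
Proof.
rewrite normc2 /polar /den /=.
have e := cos2Dsin2 (b * psi).
transitivity ((s `^ b) ^+ 2 * (cos (b * psi) ^+ 2 + sin (b * psi) ^+ 2) +
  2 * s `^ b * x * cos (b * psi) + x ^+ 2); first by ring.
by rewrite e mulr1.
Qed.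

Lemma sqrt_low_le_normc x b psi s c : 0 <= x -> 0 <= 1 + c -> c <= cos (b * psi) ->
  Num.sqrt ((1 + c) / 2) * (x + s `^ b) <= normc (x%:C + polar b psi s).
Proof.
move=> x0 c0 hc; have p0 := powR_ge0 s b.
rewrite -ler_sqr ?nnegrE ?normc_ge0//; last by rewrite mulr_ge0 ?sqrtr_ge0 ?addr_ge0.
by rewrite exprMn sqr_sqrtr ?divr_ge0// normc_add_polar den_low.
Qed.

Lemma rotation_real b b1 b2 x t phi : 0 < b < b1 + b2 -> 0 <= b1 <= 1 ->
  0 <= b2 <= 1 -> 0 < x -> 0 < t -> 0 <= phi < pi ->
  let Z := rational_polar b x%:C b1 t%:C b2 phi in
  [/\ integ (fun s => complex.Re (Z s) / s),
      integ (fun s => complex.Im (Z s) / s),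
      Ipos (fun s => complex.Re (Z s) / s) =
        Ipos (fun s => s `^ (b - 1) / ((x + s `^ b1) * (t + s `^ b2))) &
      Ipos (fun s => complex.Im (Z s) / s) = 0].
Proof.
move=> /andP[b0 bb] /andP[b10 b11] /andP[b20 b21] x0 t0 /andP[p0 ppi] Z.
(* An angle strictly between phi and pi: the open sector of half-width [phi0] contains 0 and phi,
   and 1 + cos stays bounded below on it, also after multiplying angles by [b1] or [b2], which are
   at most 1. *)
pose phi0 := (phi + pi) / 2.
have [pp0 p0pi] : phi < phi0 /\ phi0 < pi by rewrite /phi0; lra.
have c0 : 0 < 1 + cos phi0.
  have h : 0 <= phi0 < pi by rewrite p0pi andbT (le_trans p0)// ltW.
  by have := low_gt0 h; rewrite /low pmulr_lgt0// invr_gt0.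
pose k := Num.sqrt ((1 + cos phi0) / 2).
have k0 : 0 < k by rewrite sqrtr_gt0 divr_gt0.
have hc c psi : 0 <= c <= 1 -> - phi0 < psi < phi0 -> cos phi0 <= cos (c * psi).
  move=> /andP[c0' c1] /andP[h1 h2]; apply: cos_le_cos; last exact: ltW.
  rewrite normrM (ger0_norm c0') (@le_trans _ _ `|psi|)//.
    by rewrite ler_piMl.
  by rewrite ler_norml !ltW.
have l1 psi s : - phi0 < psi < phi0 -> 0 < s ->
    k * (x + s `^ b1) <= normc (x%:C + polar b1 psi s).
  by move=> h s0; apply: sqrt_low_le_normc; [exact: ltW|exact: ltW|apply: hc; rewrite ?b10].
have l2 psi s : - phi0 < psi < phi0 -> 0 < s ->
    k * (t + s `^ b2) <= normc (t%:C + polar b2 psi s).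
  by move=> h s0; apply: sqrt_low_le_normc; [exact: ltW|exact: ltW|apply: hc; rewrite ?b20].
have h1 : - phi0 < phi < phi0 by rewrite pp0 andbT; lra.
have h2 : - phi0 < 0 < phi0 by lra.
have [i1 i2 e1 e2] := rotation b0 bb b10 b20 x0 t0 k0 l1 l2 h1 h2.
have E s : 0 < s -> rational_polar b x%:C b1 t%:C b2 0 s =
    (s `^ b / ((x + s `^ b1) * (t + s `^ b2)))%:C.
  move=> s0; rewrite /rational_polar !polar_angle0 -!rmorphD/=.
  by rewrite -!fmorphV -!rmorphM/= invfM.
split => //.
- rewrite e1; apply: eq_Ipos => s s0; rewrite E//=.
  by rewrite (powRB1M b s0) mulrAC mulfK// gt_eqF.
- rewrite e2 -[RHS](Ipos0 R); apply: eq_Ipos => s s0.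
  by rewrite E//= mul0r.
Qed.

Lemma complex_eq (z w : R[i]) : complex.Re z = complex.Re w ->
  complex.Im z = complex.Im w -> z = w.
Proof. by case: z w => [? ?] [? ?] /= -> ->. Qed.

Lemma inv_add_polar phi x s : 0 < s ->
  (x%:C + polar 1 phi s)^-1 = (kerH phi s x) +i* (- kerP phi s x).
Proof.
move=> s0; apply: complex_eq; rewrite ?cReV ?cImV -!normc2 normc_add_polar
  powRr1 ?(ltW s0)// mul1r /polar powRr1 ?(ltW s0)// mul1r /kerH /kerP denC //=.
by rewrite add0r mulNr.
Qed.

(** Cancelling e^(i phi) in z / (x + z) gives s / (s + x e^(- i phi)), that is s times the conjugate
    of (s + x e^(i phi))^-1. *)
Lemma inv_add_polar_flip phi x s : 0 <= phi < pi -> 0 < x -> 0 < s ->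
  (polar 1 phi s) * (x%:C + polar 1 phi s)^-1 =
  s%:C * ((kerH phi x s) +i* (kerP phi x s)).
Proof.
move=> hp x0 s0; rewrite inv_add_polar//.
have d1 : den phi s x != 0 by rewrite gt_eqF// den_gt0.
have dC : den phi s x = den phi x s by rewrite /den; ring.
rewrite /polar powRr1 ?(ltW s0)// mul1r.
apply: complex_eq; rewrite ?Re_realM ?Im_realM /= /kerH /kerP -dC.
  have := cos2Dsin2 phi; move: (cos phi) (sin phi) d1 => c d d1 e.
  transitivity (s * (x * c + s * (c ^+ 2 + d ^+ 2)) / den phi s x).
    by field.
  by rewrite e; field.
by field.
Qed.


Lemma sqr_kerHP phi x t : 0 <= phi < pi -> 0 < x -> 0 < t ->
  kerH phi x t ^+ 2 + kerP phi x t ^+ 2 = (den phi x t)^-1.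
Proof.
move=> hp x0 t0; have d0 := den_gt0 hp x0 t0.
have dn : den phi x t != 0 by rewrite gt_eqF.
have e := cos2Dsin2 phi.
rewrite /kerH /kerP !exprMn -mulrDl.
have -> : (t + x * cos phi) ^+ 2 + x ^+ 2 * sin phi ^+ 2 = den phi x t.
  rewrite /den; transitivity (t ^+ 2 + 2 * t * x * cos phi +
    x ^+ 2 * (cos phi ^+ 2 + sin phi ^+ 2)); first by ring.
  by rewrite e mulr1.
by field.
Qed.

Lemma ker_le_kerS phi x t : 0 <= phi < pi -> 0 < x -> 0 < t ->
  (den phi x t)^-1 <= ((Num.sqrt (low phi))^-1 * kerS x t) ^+ 2.
Proof.
move=> hp x0 t0; have d0 := den_gt0 hp x0 t0.
have l0 := low_gt0 hp; have xt := addr_gt0 x0 t0.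
rewrite exprMn exprVn sqr_sqrtr ?(ltW l0)// /kerS exprVn -invfM.
rewrite lef_pV2 ?posrE// ?(mulr_gt0 l0 (exprn_gt0 _ xt))//.
exact: den_low (ltW x0) (ltW t0) (lexx _).
Qed.

Let sqr_le (u v : R) : 0 <= v -> u ^+ 2 <= v ^+ 2 -> `|u| <= v.
Proof.
move=> v0 h; rewrite -ler_sqr ?nnegrE//.
by rewrite real_normK ?num_real.
Qed.

Lemma norm_kerH_le phi x t : 0 <= phi < pi -> 0 < x -> 0 < t ->
  `|kerH phi x t| <= (Num.sqrt (low phi))^-1 * kerS x t.
Proof.
move=> hp x0 t0; apply: sqr_le.
  by rewrite mulr_ge0 ?invr_ge0 ?sqrtr_ge0// ltW// addr_gt0.
apply: le_trans (ker_le_kerS hp x0 t0).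
by rewrite -sqr_kerHP// lerDl sqr_ge0.
Qed.

Lemma norm_kerP_le phi x t : 0 <= phi < pi -> 0 < x -> 0 < t ->
  `|kerP phi x t| <= (Num.sqrt (low phi))^-1 * kerS x t.
Proof.
move=> hp x0 t0; apply: sqr_le.
  by rewrite mulr_ge0 ?invr_ge0 ?sqrtr_ge0// ltW// addr_gt0.
apply: le_trans (ker_le_kerS hp x0 t0).
by rewrite -sqr_kerHP// lerDr sqr_ge0.
Qed.

Lemma mpos2_den phi : mpos2 (den phi).
Proof.
have mf : mpos2 (fun x _ : R => x) by apply: (@mpos2_fst _ id); exact: mpos_id.
have ms : mpos2 (fun _ t : R => t) by apply: (@mpos2_snd _ id); exact: mpos_id.
apply: mpos2D; last exact: (mpos2M mf mf).
apply: mpos2D; first exact: (mpos2M ms ms).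
apply: mpos2M; last exact: mpos2_cst.
by apply: mpos2M => //; apply: mpos2M => //; exact: mpos2_cst.
Qed.

Lemma mpos2_kerH phi : mpos2 (kerH phi).
Proof.
have mf : mpos2 (fun x _ : R => x) by apply: (@mpos2_fst _ id); exact: mpos_id.
have ms : mpos2 (fun _ t : R => t) by apply: (@mpos2_snd _ id); exact: mpos_id.
apply: mpos2M; last by apply: mpos2V; exact: mpos2_den.
by apply: mpos2D => //; apply: mpos2M => //; exact: mpos2_cst.
Qed.

Lemma mpos2_kerP phi : mpos2 (kerP phi).
Proof.
have mf : mpos2 (fun x _ : R => x) by apply: (@mpos2_fst _ id); exact: mpos_id.
apply: mpos2M; last by apply: mpos2V; exact: mpos2_den.
by apply: mpos2M => //; exact: mpos2_cst.
Qed.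

Lemma mpos2_kerS : mpos2 kerS.
Proof.
have mf : mpos2 (fun x _ : R => x) by apply: (@mpos2_fst _ id); exact: mpos_id.
have ms : mpos2 (fun _ t : R => t) by apply: (@mpos2_snd _ id); exact: mpos_id.
by apply: mpos2V; exact: mpos2D.
Qed.

Lemma mpos_sqrt : mpos (@Num.sqrt R).
Proof.
by apply: mposT; apply: continuous_measurable_fun; exact: sqrt_continuous.
Qed.

Lemma mpos2_kerA : mpos2 kerA.
Proof.
have mf : mpos2 (fun x _ : R => Num.sqrt x).
  by apply: (@mpos2_fst _ (@Num.sqrt R)); exact: mpos_sqrt.
have ms : mpos2 (fun _ t : R => Num.sqrt t).
  by apply: (@mpos2_snd _ (@Num.sqrt R)); exact: mpos_sqrt.
by apply: mpos2V; apply: mpos2M => //; exact: mpos2D.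
Qed.

(* The rotation [s -> s e^{i phi}] with [b = 2a] compares the quadratic forms
   of H_phi and of the Stieltjes transform in the weighted space. *)
Lemma rotation_norm a x t phi : 0 < a < 1 -> 0 < x -> 0 < t -> 0 <= phi < pi ->
  Ipos (fun s => s `^ (2 * a - 1) *
    (kerH phi s x * kerH phi s t - kerP phi s x * kerP phi s t)) =
  cos (2 * a * phi) * Ipos (fun s => s `^ (2 * a - 1) * (kerS s x * kerS s t)).
Proof.
move=> /andP[a0 a1] x0 t0 hp.
have h2a : 0 < 2 * a < 1 + 1 by lra.
have h1 : 0 <= (1 : R) <= 1 by rewrite ler01 lexx.
have [i1 i2 e1 e2] := rotation_real h2a h1 h1 x0 t0 hp.
set Z := rational_polar _ _ _ _ _ _ in i1 i2 e1 e2.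
have ZE s : 0 < s -> Z s = polar (2 * a) phi s *
   (((kerH phi s x) +i* (- kerP phi s x)) * ((kerH phi s t) +i* (- kerP phi s t))).
  by move=> s0; rewrite /Z /rational_polar !inv_add_polar.
(* This is Re (e^(- 2 i a phi) Z) / s: the phase of z^(2a) is undone, and since the integral of Im Z
   is 0 only the cosine term survives. *)
have E s : 0 < s -> cos (2 * a * phi) * (complex.Re (Z s) / s) +
      sin (2 * a * phi) * (complex.Im (Z s) / s) =
    s `^ (2 * a - 1) *
    (kerH phi s x * kerH phi s t - kerP phi s x * kerP phi s t).
  move=> s0; rewrite ZE// cReM cImM /polar /= (powRB1M (2 * a) s0).
  have e := cos2Dsin2 (2 * a * phi).
  move: e; move: (cos _) (sin _) (kerH _ _ _) (kerH _ _ _) (kerP _ _ _) (kerP _ _ _) => c d u v p q e.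
  transitivity (s `^ (2 * a - 1) * (u * v - p * q) * (c ^+ 2 + d ^+ 2)).
    by field; rewrite gt_eqF.
  by rewrite e; ring.
rewrite -(eq_Ipos E) IposD; [|exact: integZl|exact: integZl].
rewrite !IposZl// e1 e2 mulr0 addr0; congr (_ * _); apply: eq_Ipos => s s0.
by rewrite powRr1 ?(ltW s0)// /kerS -invfM (addrC x) (addrC t).
Qed.

(** With b = 1 the integrand is z / (x + z) times 1 / (t + z). By [inv_add_polar_flip] the first
    factor is s times a conjugate, so the product of the two imaginary parts enters the real part
    with a plus sign, and no phase remains. *)
Lemma rotation_compose x t phi : 0 < x -> 0 < t -> 0 <= phi < pi ->
  Ipos (fun s => kerH phi x s * kerH phi s t + kerP phi x s * kerP phi s t) =
  Ipos (fun s => kerS x s * kerS s t).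
Proof.
move=> x0 t0 hp.
have h2 : 0 < (1 : R) < 1 + 1 by lra.
have h1 : 0 <= (1 : R) <= 1 by rewrite ler01 lexx.
have [i1 i2 e1 e2] := rotation_real h2 h1 h1 x0 t0 hp.
set Z := rational_polar _ _ _ _ _ _ in i1 i2 e1 e2.
have E s : 0 < s -> complex.Re (Z s) / s =
    kerH phi x s * kerH phi s t + kerP phi x s * kerP phi s t.
  move=> s0; rewrite /Z /rational_polar mulrA inv_add_polar_flip// inv_add_polar//.
  by rewrite -mulrA Re_realM /=; field; rewrite gt_eqF.
rewrite -(eq_Ipos E) e1; apply: eq_Ipos => s s0.
by rewrite powRr1 ?(ltW s0)// subrr powRr0 mul1r /kerS -invfM (addrC t).
Qed.

Let inv_1D1 : (1%:C + 1)^-1 = 2^-1%:C :> R[i].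
Proof. by rewrite (_ : 1%:C + 1 = 2%:C) ?fmorphV//; apply: complex_eq => /=; ring. Qed.

(** The second denominator is made constant by a2 = 1 and b2 = 0; it equals 2, whence the factors 2.
    The kernel is the imaginary part of 2 e^(i a phi) Z / s, and Im Z integrates to 0. The resulting
    factor sin (a phi) serves twice: it bounds the Schur integrals of P_phi uniformly, and its limit
    evaluates the Stieltjes constant. *)
Lemma rotation_kerP_input a x phi : 0 < a < 1 -> 0 < x -> 0 <= phi < pi ->
  integ (fun t => kerP phi x t * t `^ (- a)) /\
  Ipos (fun t => kerP phi x t * t `^ (- a)) =
    sin (a * phi) * Ipos (fun t => kerS x t * t `^ (- a)).
Proof.
move=> /andP[a0 a1] x0 hp.
have h2a : 0 < 1 - a < 1 + 0 by lra.
have h1 : 0 <= (1 : R) <= 1 by rewrite ler01 lexx.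
have h0 : 0 <= (0 : R) <= 1 by rewrite ler01 lexx.
have [i1 i2 e1 e2] := rotation_real h2a h1 h0 x0 ltr01 hp.
set Z := rational_polar _ _ _ _ _ _ in i1 i2 e1 e2.
have E s : 0 < s -> kerP phi x s * s `^ (- a) =
    (2 * sin (a * phi)) * (complex.Re (Z s) / s) +
    (2 * cos (a * phi)) * (complex.Im (Z s) / s).
  move=> s0.
  have -> : Z s = (polar (- a) phi s * 2^-1%:C) *
      (s%:C * ((kerH phi x s) +i* (kerP phi x s))).
    rewrite -inv_add_polar_flip// /Z /rational_polar polar0.
    have -> : polar (1 - a) phi s = polar (- a) phi s * polar 1 phi s.
      rewrite /polar (addrC 1) powRD_gt0// mulrDl cosD sinD.
      by apply: complex_eq => /=; ring.
    rewrite inv_1D1.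
    by ring.
  rewrite cReM cImM (mulrC _ 2^-1%:C) !Re_realM !Im_realM /polar /= mulNr cosN sinN.
  have e := cos2Dsin2 (a * phi).
  move: e; move: (cos _) (sin _) (kerH _ _ _) (kerP _ _ _) => c d u p e.
  transitivity (p * s `^ (- a) * (c ^+ 2 + d ^+ 2)).
    by rewrite e mulr1.
  by field; rewrite gt_eqF.
split.
  apply: (@eq_integ _ (fun s => (2 * sin (a * phi)) * (complex.Re (Z s) / s) +
    (2 * cos (a * phi)) * (complex.Im (Z s) / s))).
    by move=> s s0; rewrite E.
  by apply: integD; exact: integZl.
rewrite (eq_Ipos E) IposD; [|exact: integZl|exact: integZl].
rewrite !IposZl// e1 e2 mulr0 addr0 (mulrC 2) -mulrA; congr (_ * _).
rewrite -IposZl; last by apply: integ_powR_rational.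
apply: eq_Ipos => s s0.
rewrite powRr1 ?(ltW s0)// powRr0 /kerS addrAC subrr add0r.
by field; rewrite gt_eqF// addr_gt0.
Qed.

Lemma rotation_kerP_output a t phi : 0 < a < 1 -> 0 < t -> 0 <= phi < pi ->
  integ (fun x => kerP phi x t * x `^ (a - 1)) /\
  Ipos (fun x => kerP phi x t * x `^ (a - 1)) =
    sin (a * phi) * Ipos (fun x => kerS x t * x `^ (a - 1)).
Proof.
move=> /andP[a0 a1] t0 hp.
have h2a : 0 < a < 1 + 0 by lra.
have h1 : 0 <= (1 : R) <= 1 by rewrite ler01 lexx.
have h0 : 0 <= (0 : R) <= 1 by rewrite ler01 lexx.
have [i1 i2 e1 e2] := rotation_real h2a h1 h0 t0 ltr01 hp.
set Z := rational_polar _ _ _ _ _ _ in i1 i2 e1 e2.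
have E s : 0 < s -> kerP phi s t * s `^ (a - 1) =
    (2 * sin (a * phi)) * (complex.Re (Z s) / s) +
    (- (2 * cos (a * phi))) * (complex.Im (Z s) / s).
  move=> s0.
  have -> : Z s = polar a phi s * (2^-1%:C * ((kerH phi s t) +i* (- kerP phi s t))).
    rewrite -inv_add_polar// /Z /rational_polar polar0.
    rewrite inv_1D1.
    by ring.
  rewrite !(cReM, cImM) /polar /= (powRB1M a s0).
  have e := cos2Dsin2 (a * phi).
  move: e; move: (cos _) (sin _) (kerH _ _ _) (kerP _ _ _) => c d u p e.
  transitivity (p * s `^ (a - 1) * (c ^+ 2 + d ^+ 2)).
    by rewrite e mulr1.
  by field; rewrite gt_eqF.
split.
  apply: (@eq_integ _ (fun s => (2 * sin (a * phi)) * (complex.Re (Z s) / s) +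
    (- (2 * cos (a * phi))) * (complex.Im (Z s) / s))).
    by move=> s s0; rewrite E.
  by apply: integD; exact: integZl.
rewrite (eq_Ipos E) IposD; [|exact: integZl|exact: integZl].
rewrite !IposZl// e1 e2 mulr0 addr0 (mulrC 2) -mulrA; congr (_ * _).
rewrite -IposZl; last by apply: integ_powR_rational.
apply: eq_Ipos => s s0.
rewrite powRr1 ?(ltW s0)// powRr0 /kerS (addrC s).
by field; rewrite gt_eqF// addr_gt0.
Qed.

End Kernels.

(** * The kernel of H_phi A *)

Section RotationHA.
Variable R : realType.
Implicit Types (x s t a b phi psi : R).

(** The factor (x + s)^-1 times the real part of (sqrt t + sqrt s e^(i phi / 2))^-1, divided by sqrt
    t. *)
Definition kerHA phi x t s := (Num.sqrt t + Num.sqrt s * cos (phi / 2)) /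
  ((x + s) * den (phi / 2) (Num.sqrt t) (Num.sqrt s) * Num.sqrt t).

Let angle_lt phi : 0 <= phi < pi -> (phi + pi) / 2 < pi.
Proof. by move=> /andP[p0 p1]; lra. Qed.

(* Rotating the contour by [phi] makes the kernel of [H_phi] real positive and
   moves the rotation onto [sqrt s], which turns by [phi / 2] only: the result
   stays bounded as [phi] tends to [pi]. *)
Lemma rotation_HA x t phi : 0 < x -> 0 < t -> 0 <= phi < pi ->
  Ipos (fun s => kerH phi x s * kerA s t) = Ipos (kerHA phi x t).
Proof.
move=> x0 t0 hp; have /andP[p0 ppi] := hp.
have pi0 := pi_gt0 R.
pose phi0 := (phi + pi) / 2.
have p0pi : phi0 < pi by exact: angle_lt.
have pp0 : phi < phi0 by rewrite /phi0; lra.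
have c0 : 0 < 1 + cos phi0.
  have h : 0 <= phi0 < pi by rewrite p0pi andbT (le_trans p0)// ltW.
  by have := low_gt0 h; rewrite /low pmulr_lgt0// invr_gt0.
pose k := Num.sqrt ((1 + cos phi0) / 2).
have k0 : 0 < k by rewrite sqrtr_gt0 divr_gt0.
have st0 : 0 < Num.sqrt t by rewrite sqrtr_gt0.
(* The bound psi > lo means phi - psi < phi0, which keeps x e^(i phi) + s e^(i psi) away from 0;
   half of psi also stays within [phi0]. *)
pose lo := - ((pi - phi) / 2); pose hi := phi0.
have l1 psi s : lo < psi < hi -> 0 < s ->
    k * (x + s `^ 1) <= normc (polar 1 phi x + polar 1 psi s).
  move=> /andP[h1 h2] s0.
  rewrite -ler_sqr ?nnegrE ?normc_ge0//; last first.
    by rewrite mulr_ge0 ?sqrtr_ge0 ?addr_ge0 ?powR_ge0 ?ltW.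
  rewrite exprMn sqr_sqrtr ?divr_ge0 ?(ltW c0)//.
  have -> : normc (polar 1 phi x + polar 1 psi s) ^+ 2 = den (phi - psi) x (s `^ 1).
    rewrite normc2 /polar /den /= (powRr1 (ltW x0)) (powRr1 (ltW s0)) !mul1r cosB.
    have e1 := cos2Dsin2 phi; have e2 := cos2Dsin2 psi.
    transitivity (x ^+ 2 * (cos phi ^+ 2 + sin phi ^+ 2) +
      2 * s * x * (cos phi * cos psi + sin phi * sin psi) +
      s ^+ 2 * (cos psi ^+ 2 + sin psi ^+ 2)); first by ring.
    by rewrite e1 e2; ring.
  apply: den_low; [exact: ltW|exact: powR_ge0|].
  apply: cos_le_cos; last exact: ltW.
  move: h1 h2; rewrite /lo /hi /phi0 => h1 h2.
  by rewrite ler_norml; apply/andP; split; lra.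
have l2 psi s : lo < psi < hi -> 0 < s ->
    k * (Num.sqrt t + s `^ 2^-1) <= normc ((Num.sqrt t)%:C + polar 2^-1 psi s).
  move=> /andP[h1 h2] s0; apply: sqrt_low_le_normc; [exact: ltW|exact: ltW|].
  apply: cos_le_cos; last exact: ltW.
  by rewrite ler_norml; apply/andP; split; rewrite /phi0 /lo /hi in h1 h2 *; lra.
have h1 : lo < 0 < hi by rewrite /lo /hi /phi0; lra.
have h2 : lo < phi < hi by rewrite /lo /hi /phi0; lra.
have b1 : (1 : R) < 1 + 2^-1 by lra.
have b2 : 0 <= 2^-1 :> R by lra.
have [_ _ e _] := @rotation R lo hi 1 1 2^-1 x (Num.sqrt t) k _ _ ltr01 b1 ler01
  b2 x0 st0 k0 l1 l2 0 phi h1 h2.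
have sq s : 0 < s -> s `^ 2^-1 = Num.sqrt s by move=> s0; rewrite powR12_sqrt ?ltW.
transitivity ((Num.sqrt t)^-1 * Ipos (fun s => complex.Re (rational_polar 1
   (polar 1 phi x) 1 (Num.sqrt t)%:C 2^-1 0 s) / s)).
  rewrite -IposZl; last first.
    by have [] := @rotation R lo hi 1 1 2^-1 x (Num.sqrt t) k _ _ ltr01 b1 ler01
      b2 x0 st0 k0 l1 l2 0 phi h1 h2.
  apply: eq_Ipos => s s0; rewrite /rational_polar !polar_angle0 powRr1 ?(ltW s0)//.
  rewrite sq// (addrC (polar _ _ _)) inv_add_polar// -rmorphD -fmorphV.
  rewrite mulrCA mulrC !Re_realM (mulrC _ (_^-1)%:C) Re_realM /= /kerA.
  rewrite (addrC (Num.sqrt s)); field.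
  by rewrite !gt_eqF// ?addr_gt0// sqrtr_gt0.
rewrite e -IposZl; last first.
  by have [] := @rotation R lo hi 1 1 2^-1 x (Num.sqrt t) k _ _ ltr01 b1 ler01
    b2 x0 st0 k0 l1 l2 phi phi h2 h2.
apply: eq_Ipos => s s0.
(* At psi = phi the factor e^(i phi) is common to the numerator and the first denominator. *)
have -> : rational_polar 1 (polar 1 phi x) 1 (Num.sqrt t)%:C 2^-1 phi s =
   (s / (x + s))%:C * ((Num.sqrt t)%:C + polar 2^-1 phi s)^-1.
  rewrite /rational_polar mulrA; congr (_ * _).
  have -> : polar 1 phi x + polar 1 phi s = (x + s)%:C * polar 1 phi 1.
    rewrite /polar !powRr1 ?ltW//; apply: complex_eq => /=; ring.
  have -> : polar 1 phi s = s%:C * polar 1 phi 1.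
    rewrite /polar !powRr1 ?ltW//; apply: complex_eq => /=; ring.
  have n0 : polar 1 phi 1 != 0.
    apply/eqP => n0; have := normc_polar 1 phi 1; rewrite n0 powR1 normc0.
    by move=> /eqP; rewrite eq_sym oner_eq0.
  rewrite invfM mulrACA divff// mulr1 -fmorphV -rmorphM//.
have d0 : 0 < den (phi / 2) (Num.sqrt t) (Num.sqrt s).
  by apply: den_gt0; rewrite ?sqrtr_gt0//; lra.
rewrite Re_realM cReV -normc2 normc_add_polar sq// (mulrC 2^-1) /kerHA /polar /=.
rewrite sq// (mulrC 2^-1).
rewrite -!mulrA; field.
by rewrite !gt_eqF// (addr_gt0 x0 s0).
Qed.

(** Since phi / 2 is at most a right angle, its cosine is nonnegative and the denominator does not
    degenerate. The majorant is independent of phi, which permits the passage to phi = pi under the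
    integral. *)
Lemma kerHA_le x t s phi : 0 < x -> 0 < t -> 0 < s -> 0 <= phi < pi ->
  `|kerHA phi x t s| <= 2 * (kerS x s * kerA s t).
Proof.
move=> x0 t0 s0 /andP[p0 ppi]; rewrite /kerHA /kerS /kerA.
have hc : 0 <= cos (phi / 2).
  by apply: cos_ge0_pihalf; lra.
have st : 0 < Num.sqrt t by rewrite sqrtr_gt0.
have ss : 0 < Num.sqrt s by rewrite sqrtr_gt0.
have d0 : 0 < den (phi / 2) (Num.sqrt t) (Num.sqrt s) by apply: den_gt0 => //; lra.
move: (Num.sqrt t) (Num.sqrt s) st ss d0 (cos_le1 (phi / 2)) => u v u0 v0 d0 c1.
rewrite ger0_norm; last first.
  by apply: divr_ge0; ge0; rewrite ?ltW ?addr_gt0.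
rewrite ler_pdivrMr ?(mulr_gt0 (mulr_gt0 (addr_gt0 x0 s0) d0) u0)//.
have -> : 2 * ((x + s)^-1 * ((v + u) * u)^-1) * ((x + s) * den (phi / 2) u v * u) =
   2 * den (phi / 2) u v / (v + u).
  by field; rewrite !gt_eqF// addr_gt0.
rewrite ler_pdivlMr ?addr_gt0// /den.
move: (cos _) hc c1 => c c0 c1.
have h1 : 0 <= u * v * c by ge0.
have h2 : 0 <= v ^+ 2 * (1 - c) by rewrite mulr_ge0 ?sqr_ge0 ?subr_ge0.
by have := sqr_ge0 (u - v); have := sqr_ge0 u; have := sqr_ge0 v; lra.
Qed.

End RotationHA.

(** * Limits of kernel families concentrating at a point *)

Section Truncation.
Variable R : realType.
Implicit Types (x s t a b phi psi l m : R) (k u : R -> R).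

(** A sequence in the open interval from 0 to pi that tends to pi, so that the sequential
    convergence theorems apply. *)
Definition angle (n : nat) : R := pi - n.+2%:R^-1.

Lemma angle_itv n : 0 <= angle n < pi.
Proof.
have p2 : (2 : R) <= pi := pi_ge2 R.
have h1 : 0 < n.+2%:R^-1 :> R by rewrite invr_gt0.
have h2 : n.+2%:R^-1 <= 1 :> R by rewrite invf_le1// ler1n.
by rewrite /angle; move: (_^-1) h1 h2 => e h1 h2; lra.
Qed.

Lemma sin_angle_gt0 n : 0 < sin (angle n).
Proof.
have p2 : (2 : R) <= pi := pi_ge2 R.
have h1 : 0 < n.+2%:R^-1 :> R by rewrite invr_gt0.
have h2 : n.+2%:R^-1 <= 1 :> R by rewrite invf_le1// ler1n.
by apply: sin_gt0_pi; rewrite /angle; move: (_^-1) h1 h2 => e h1 h2; lra.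
Qed.

Lemma angle_cvg : angle n @[n --> \oo] --> pi.
Proof.
rewrite -[X in _ --> X]subr0; apply: cvgB; first exact: cvg_cst.
apply: (@cvgn_ext _ (fun n : nat => (n + 1).+1%:R^-1) _ 0) => //.
  by move=> n; rewrite addn1.
by apply: (@cvgn_addn _ (fun n : nat => n.+1%:R^-1) 0 1); exact: cvg_harmonic.
Qed.

Lemma cvgn_comp (h : R -> R) (u : nat -> R) l : {for l, continuous h} ->
  u n @[n --> \oo] --> l -> h (u n) @[n --> \oo] --> h l.
Proof. by move=> hc ul; exact: (cvg_comp _ _ ul hc). Qed.

Lemma cvg_cos_angle b : cos (b * angle n) @[n --> \oo] --> cos (b * pi).
Proof.
apply: (@cvgn_comp cos _ (b * pi)); first exact: continuous_cos.
by apply: cvgM; [exact: cvg_cst|exact: angle_cvg].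
Qed.

Lemma cvg_sin_angle b : sin (b * angle n) @[n --> \oo] --> sin (b * pi).
Proof.
apply: (@cvgn_comp sin _ (b * pi)); first exact: continuous_sin.
by apply: cvgM; [exact: cvg_cst|exact: angle_cvg].
Qed.

Lemma cos_angle_cvg : cos (angle n) @[n --> \oo] --> (-1 : R).
Proof.
apply: (@cvgn_ext _ (fun n => cos (1 * angle n)) _ (cos (1 * pi))).
- by move=> n; rewrite mul1r.
- by rewrite mul1r cospi.
- exact: cvg_cos_angle.
Qed.

Lemma sin_angle_cvg : sin (angle n) @[n --> \oo] --> (0 : R).
Proof.
apply: (@cvgn_ext _ (fun n => sin (1 * angle n)) _ (sin (1 * pi))).
- by move=> n; rewrite mul1r.
- by rewrite mul1r sinpi.
- exact: cvg_sin_angle.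
Qed.

Lemma atan_div_cvg (u v : nat -> R) l : 0 < l -> u n @[n --> \oo] --> l ->
  (forall n, 0 < v n) -> v n @[n --> \oo] --> 0 ->
  atan (u n / v n) @[n --> \oo] --> pi / 2.
Proof.
move=> l0 ul v0 vc.
have h : ((l / 2) / v n) @[n --> \oo] --> +oo.
  apply: (gtr0_cvgV0 _).1; first by near=> n; rewrite !divr_gt0.
  apply: (@cvgn_ext _ (fun n => v n / (l / 2)) _ (0 / (l / 2))).
  - by move=> n; rewrite /= invf_div.
  - by rewrite mul0r.
  - by apply: cvgM => //; exact: cvg_cst.
have h2 : atan ((l / 2) / v n) @[n --> \oo] --> pi / 2.
  exact: (cvg_comp _ _ h (@cvgy_atan R)).
apply: (squeeze_cvgr _ h2 (cvg_cst (pi / 2))).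
near=> n; rewrite (ltW (atan_ltpi2 _)) andbT; apply: le_atan.
rewrite ler_pM2r ?invr_gt0//.
near: n; apply: (cvgr_ge l) => //.
by rewrite ltr_pdivrMr//; lra.
Unshelve. all: by end_near. Qed.

Definition near_itv x : set R := `[x / 2, 3 / 2 * x].
(** Subtracting u x on a bounded window about x removes the singularity at x without spoiling
    integrability at infinity. The window is symmetric about x, so the principal value of 1 / (t -
    x) over it is 0. *)
Definition diffq u x t := (u t - u x * \1_(near_itv x) t) / (t - x).

Lemma near_itvE x t : \1_(near_itv x) t = (x / 2 <= t <= 3 / 2 * x)%R%:R :> R.
Proof. by rewrite /near_itv indicE; congr (_%:R); rewrite mem_setE in_itv. Qed.

Lemma mpos_near_itv x : mpos (\1_(near_itv x) : R -> R).
Proof. by apply: mpos_indic; exact: measurable_itv. Qed.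

Lemma mpos_diffq u x : mpos u -> mpos (diffq u x).
Proof.
move=> mu; apply: mposM.
  apply: mposB => //; apply: mposM; [exact: mpos_cst|exact: mpos_near_itv].
by apply: mposV; apply: mposB; [exact: mpos_id|exact: mpos_cst].
Qed.

Lemma diffq_split k u x t : 0 < x -> k t * u t =
  ((t - x) * k t) * diffq u x t + u x * (k t * \1_(near_itv x) t).
Proof.
move=> x0; have [->|tx] := eqVneq t x; last by rewrite /diffq; field; rewrite subr_eq0.
by rewrite subrr !mul0r add0r near_itvE (_ : _ && _ = true) ?mulr1 1?mulrC//; lra.
Qed.

Section Family.
Variables (k : R -> R) (u : R -> R) (x : R).
Hypothesis x_gt0 : 0 < x.
Hypothesis mk : mpos k.
Hypothesis k_le : forall t, 0 < t -> `|(t - x) * k t| <= 1.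
Hypothesis ik : integ (fun t => k t * \1_(near_itv x) t).
Hypothesis iu : integ (diffq u x).

Let mtk : mpos (fun t => (t - x) * k t).
Proof. by apply: mposM => //; apply: mposB; [exact: mpos_id|exact: mpos_cst]. Qed.

Let itk : integ (fun t => ((t - x) * k t) * diffq u x t).
Proof.
apply: (@le_integ _ _ (fun t => `|diffq u x t|)); last exact: integ_abs.
  by apply: mposM => //; exact: integ_mpos.
by move=> t t0; rewrite normrM ler_piMl// k_le.
Qed.

Lemma Ipos_diffq : integ (fun t => k t * u t) /\
  Ipos (fun t => k t * u t) = Ipos (fun t => ((t - x) * k t) * diffq u x t) +
    u x * Ipos (fun t => k t * \1_(near_itv x) t).
Proof.
have E t : 0 < t -> ((t - x) * k t) * diffq u x t + u x * (k t * \1_(near_itv x) t) =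
    k t * u t by move=> t0; rewrite [RHS](diffq_split k u _ x_gt0).
split; first by apply: (eq_integ E); apply: integD => //; exact: integZl.
by rewrite -(eq_Ipos E) IposD//; [rewrite IposZl|exact: integZl].
Qed.

Lemma norm_Ipos_diffq : `|Ipos (fun t => k t * u t)| <=
  Ipos (fun t => `|diffq u x t|) + `|u x| * `|Ipos (fun t => k t * \1_(near_itv x) t)|.
Proof.
rewrite (Ipos_diffq).2; apply: (le_trans (ler_normD _ _)); rewrite normrM lerD2r.
apply: ler_norm_Ipos_le => //; first exact: integ_abs.
by move=> t t0; rewrite normrM ler_piMl// k_le.
Qed.

End Family.

(** Only two data of the family survive in the limit: the limit l of (t - x) k off the diagonal and
    the limit m of the mass of k on the window. With l = 1 and m = 0 the limit is a principal value,
    as for [kerH] and for the truncated kernels; with l = 0 and m = pi it is a multiple of u x, as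
    for [kerP]. *)
Lemma kernel_family_cvg (k : nat -> R -> R) u x l m : 0 < x ->
  (forall n, mpos (k n)) ->
  (forall n t, 0 < t -> `|(t - x) * k n t| <= 1) ->
  (forall n, integ (fun t => k n t * \1_(near_itv x) t)) ->
  (forall t, 0 < t -> t != x -> (t - x) * k n t @[n --> \oo] --> l) ->
  Ipos (fun t => k n t * \1_(near_itv x) t) @[n --> \oo] --> m ->
  integ (diffq u x) ->
  Ipos (fun t => k n t * u t) @[n --> \oo] --> l * Ipos (diffq u x) + m * u x.
Proof.
move=> x0 mk kle ik kl km iu.
apply: (@cvgn_ext _ (fun n => Ipos (fun t => ((t - x) * k n t) * diffq u x t) +
  u x * Ipos (fun t => k n t * \1_(near_itv x) t)) _
  (Ipos (fun t => l * diffq u x t) + u x * m)).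
- by move=> n; rewrite (Ipos_diffq x0 (mk n) (kle n) (ik n) iu).2.
- by rewrite IposZl// (mulrC m).
apply: cvgD; last by apply: cvgM => //; exact: cvg_cst.
have H : integ (fun t => l * diffq u x t) /\
   Ipos (fun t => (t - x) * k n t * diffq u x t) @[n --> \oo] -->
   Ipos (fun t => l * diffq u x t).
  apply: (@Ipos_dct _ _ _ (fun t => `|diffq u x t|)); last exact: integ_abs.
  - move=> n; apply: mposM; last exact: integ_mpos.
    by apply: mposM => //; apply: mposB; [exact: mpos_id|exact: mpos_cst].
  (* At t = x nothing is assumed about the kernels, but [diffq] is 0 there by the convention on
     division by 0. *)
  - move=> t t0; have [->|tx] := eqVneq t x.
      by rewrite /diffq subrr invr0 !mulr0; apply: cvgn_ext (cvg_cst 0) => // n; rewrite mulr0.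
    by apply: cvgM; [exact: kl|exact: cvg_cst].
  - by move=> n t t0; rewrite normrM ler_piMl// kle.
by have [] := H.
Qed.

Lemma sqr_sub_le_den phi x t : 0 < x -> 0 < t -> (t - x) ^+ 2 <= den phi x t.
Proof.
move=> x0 t0; have := cos_geN1 phi; have xt := mulr_gt0 x0 t0.
by rewrite /den => c1; nra.
Qed.

Let mul_le1 phi x t (v : R) : 0 <= phi < pi -> 0 < x -> 0 < t ->
  v ^+ 2 <= (den phi x t)^-1 -> `|(t - x) * v| <= 1.
Proof.
move=> hp x0 t0 h; have d0 := den_gt0 hp x0 t0.
rewrite -(expr_le1 (n := 2))// -normrX ger0_norm ?sqr_ge0// exprMn.
apply: (@le_trans _ _ (den phi x t * (den phi x t)^-1)).
  by apply: ler_pM => //; rewrite ?sqr_ge0// sqr_sub_le_den.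
by rewrite divff// gt_eqF.
Qed.

Lemma kerH_trunc_le phi x t : 0 <= phi < pi -> 0 < x -> 0 < t ->
  `|(t - x) * kerH phi x t| <= 1.
Proof.
by move=> hp x0 t0; apply: (mul_le1 hp) => //; rewrite -sqr_kerHP// lerDl sqr_ge0.
Qed.

Lemma kerP_trunc_le phi x t : 0 <= phi < pi -> 0 < x -> 0 < t ->
  `|(t - x) * kerP phi x t| <= 1.
Proof.
by move=> hp x0 t0; apply: (mul_le1 hp) => //; rewrite -sqr_kerHP// lerDr sqr_ge0.
Qed.

Lemma cvg_den x t : den (angle n) x t @[n --> \oo] --> (t - x) ^+ 2.
Proof.
have -> : (t - x) ^+ 2 = t ^+ 2 + 2 * t * x * (-1) + x ^+ 2 by ring.
apply: cvgD; last exact: cvg_cst; apply: cvgD; first exact: cvg_cst.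
by apply: cvgM; [exact: cvg_cst|exact: cos_angle_cvg].
Qed.

Lemma cvg_kerH x t : t != x -> kerH (angle n) x t @[n --> \oo] --> (t - x)^-1.
Proof.
move=> tx; have n0 : t - x != 0 by rewrite subr_eq0.
have -> : (t - x)^-1 = (t + x * (-1)) / (t - x) ^+ 2 by field.
apply: cvgM; last by apply: cvgV; [rewrite expf_neq0|exact: cvg_den].
apply: cvgD; first exact: cvg_cst.
by apply: cvgM; [exact: cvg_cst|exact: cos_angle_cvg].
Qed.

Lemma cvg_kerP x t : t != x -> kerP (angle n) x t @[n --> \oo] --> 0.
Proof.
move=> tx; have n0 : t - x != 0 by rewrite subr_eq0.
have -> : 0 = (x * 0) / (t - x) ^+ 2 :> R by field.
apply: cvgM; last by apply: cvgV; [rewrite expf_neq0|exact: cvg_den].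
by apply: cvgM; [exact: cvg_cst|exact: sin_angle_cvg].
Qed.

Let x2 x : 0 < x -> 0 < x / 2. Proof. by move=> x0; lra. Qed.
Let xlt x : 0 < x -> x / 2 < 3 / 2 * x. Proof. by move=> x0; lra. Qed.

Lemma is_derive_den phi x t : is_derive t 1 (den phi x) (2 * (t + x * cos phi)).
Proof.
rewrite /den; apply: is_derive_eq.
by rewrite !scaler0 !add0r !addr0 /GRing.scale /=; ring.
Qed.

(** An antiderivative is half the logarithm of [den], and the factors x^2 at the two endpoints
    cancel. At cos phi = -1 both arguments of the logarithm equal 1 / 4, so the mass tends to 0. *)
Lemma Ipos_near_kerH phi x : 0 <= phi < pi -> 0 < x ->
  integ (fun t => kerH phi x t * \1_(near_itv x) t) /\
  Ipos (fun t => kerH phi x t * \1_(near_itv x) t) =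
    (ln (13 / 4 + 3 * cos phi) - ln (5 / 4 + cos phi)) / 2.
Proof.
move=> hp x0.
have dd t : is_derive t 1 (den phi x) (2 * (t + x * cos phi)) := is_derive_den _ _ _.
have [||i e] := @itv_FTC R (fun t => ln (den phi x t) / 2) (kerH phi x) _ _ (x2 x0) (xlt x0).
- move=> t /andP[t1 _]; have t0 : 0 < t by apply: lt_le_trans t1; lra.
  have d0 := den_gt0 hp x0 t0.
  have := @is_derive1_comp _ (@ln R) (den phi x) t _ _ (is_derive1_ln d0) (dd t).
  move=> h; apply: is_derive_eq; rewrite /GRing.scale /= /kerH.
  by field; rewrite gt_eqF.
- move=> t /andP[t1 _]; have t0 : 0 < t by apply: lt_le_trans t1; lra.
  have d0 := den_gt0 hp x0 t0.
  apply: derivableM; first by apply: derivableD; [exact: derivable_id|exact: derivable_cst].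
  apply: derivableV; first by rewrite gt_eqF.
  by have [] := dd t.
split=> //; rewrite e -mulrBl; congr (_ / _).
have xx : 0 < x ^+ 2 by exact: exprn_gt0.
have c1 : 0 < 1 + cos phi by have := low_gt0 hp; rewrite /low; lra.
have -> : den phi x (3 / 2 * x) = x ^+ 2 * (13 / 4 + 3 * cos phi) by rewrite /den; field.
have -> : den phi x (x / 2) = x ^+ 2 * (5 / 4 + cos phi) by rewrite /den; field.
by rewrite !lnM ?posrE; [ring|lra..].
Qed.

(** Writing [den] as (t + x cos phi)^2 + (x sin phi)^2 exhibits an arctangent. As phi tends to pi
    the two arguments go to opposite infinities, and the mass tends to pi. *)
Lemma Ipos_near_kerP phi x : 0 <= phi < pi -> 0 < sin phi -> 0 < x ->
  integ (fun t => kerP phi x t * \1_(near_itv x) t) /\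
  Ipos (fun t => kerP phi x t * \1_(near_itv x) t) =
    atan ((3 / 2 + cos phi) / sin phi) - atan ((2^-1 + cos phi) / sin phi).
Proof.
move=> hp s0 x0.
have xs : x * sin phi != 0 by rewrite mulf_neq0// gt_eqF.
have [||i e] := @itv_FTC R (fun t => atan ((t + x * cos phi) / (x * sin phi)))
  (kerP phi x) _ _ (x2 x0) (xlt x0).
- move=> t /andP[t1 _]; have t0 : 0 < t by apply: lt_le_trans t1; lra.
  have d0 := den_gt0 hp x0 t0.
  have h : is_derive t 1 (fun t => (t + x * cos phi) / (x * sin phi)) (x * sin phi)^-1.
    by apply: is_derive_eq; rewrite scaler0 addr0 /GRing.scale /=; ring.
  have := @is_derive1_comp _ (@atan R) _ t _ _ (is_derive1_atan _) h.
  move=> h2; apply: is_derive_eq; rewrite /kerP.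
  have E : den phi x t = (t + x * cos phi) ^+ 2 + (x * sin phi) ^+ 2.
    have := cos2Dsin2 phi; rewrite /den => e; transitivity (t ^+ 2 + 2 * t * x * cos phi +
      x ^+ 2 * (cos phi ^+ 2 + sin phi ^+ 2)); [by rewrite e mulr1|by ring].
  move: d0; rewrite E => d0; move: xs d0; move: (x * sin phi) (t + _) => p q p0 d0.
  rewrite /GRing.scale /=; field.
  by rewrite p0 gt_eqF// addrC.
- move=> t /andP[t1 _]; have t0 : 0 < t by apply: lt_le_trans t1; lra.
  have d0 := den_gt0 hp x0 t0.
  apply: derivableM; first exact: derivable_cst.
  apply: derivableV; first by rewrite gt_eqF.
  by have [] := is_derive_den phi x t.
split=> //; rewrite e; congr (atan _ - atan _); field; by rewrite !gt_eqF.
Qed.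

Lemma cvg_near_kerH x : 0 < x ->
  Ipos (fun t => kerH (angle n) x t * \1_(near_itv x) t) @[n --> \oo] --> 0.
Proof.
move=> x0.
apply: (@cvgn_ext _ (fun n => (ln (13 / 4 + 3 * cos (angle n)) - ln (5 / 4 + cos (angle n))) / 2)
  _ ((ln (13 / 4 + 3 * -1) - ln (5 / 4 + -1)) / 2)).
- by move=> n; rewrite (Ipos_near_kerH (angle_itv n) x0).2.
- have -> : 13 / 4 + 3 * -1 = 5 / 4 + -1 :> R by field.
  by rewrite subrr mul0r.
apply: cvgM; last exact: cvg_cst.
apply: cvgB; (apply: (@cvgn_comp (@ln R)); first by apply: continuous_ln; lra).
  apply: cvgD; first exact: cvg_cst.
  by apply: cvgM; [exact: cvg_cst|exact: cos_angle_cvg].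
by apply: cvgD; [exact: cvg_cst|exact: cos_angle_cvg].
Qed.

Lemma cvg_near_kerP x : 0 < x ->
  Ipos (fun t => kerP (angle n) x t * \1_(near_itv x) t) @[n --> \oo] --> pi.
Proof.
move=> x0.
apply: (@cvgn_ext _ (fun n => atan ((3 / 2 + cos (angle n)) / sin (angle n)) +
   atan (- (2^-1 + cos (angle n)) / sin (angle n))) _ (pi / 2 + pi / 2)).
- move=> n; rewrite (Ipos_near_kerP (angle_itv n) (sin_angle_gt0 n) x0).2.
  by rewrite mulNr atanN.
- by field.
have cc (c : R) : c + cos (angle n) @[n --> \oo] --> c + -1.
  by apply: cvgD; [exact: cvg_cst|exact: cos_angle_cvg].
apply: cvgD.
  by apply: (@atan_div_cvg _ _ (3 / 2 + -1)) => //;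
    [lra|exact: sin_angle_gt0|exact: sin_angle_cvg].
apply: (@atan_div_cvg _ _ (- (2^-1 + -1))) => //;
  [lra|by apply: cvgN|exact: sin_angle_gt0|exact: sin_angle_cvg].
Qed.

End Truncation.

(** * Integral operators with positive dominating kernels *)

Section Operators.
Variable R : realType.
Implicit Types (x s t c r C phi p : R) (f g u : R -> R) (K Kd : R -> R -> R).

Definition op K f x : R := pi^-1 * Ipos (fun t => K x t * f t).

(** What is used of a positive kernel: absolute convergence at every point of the half-line and
    boundedness on the weighted space, [C] bounding the square of the operator norm. Signed kernels
    enter through the pointwise comparison [dominated]. *)
Record dominating p Kd C : Prop := Dominating {
  dom_mpos2 : mpos2 Kd;
  dom_ge0 : forall x t, 0 < x -> 0 < t -> 0 <= Kd x t;
  dom_C_ge0 : 0 <= C;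
  dom_integ : forall f x, L2 p f -> 0 < x -> integ (fun t => Kd x t * `|f t|);
  dom_op : forall f, L2 p f -> L2 p (op Kd (fun t => `|f t|)) /\
    sqnorm p (op Kd (fun t => `|f t|)) <= C * sqnorm p f }.

Definition dominated Kd c K := mpos2 K /\
  forall x t, 0 < x -> 0 < t -> `|K x t| <= c * Kd x t.

Lemma dominated_refl p Kd C : dominating p Kd C -> dominated Kd 1 Kd.
Proof. by move=> h; split=> [|x t x0 t0]; [exact: dom_mpos2 h|rewrite mul1r ger0_norm// (dom_ge0 h)]. Qed.

Let pi0 : 0 < pi :> R := pi_gt0 R.
Let piV0 : 0 <= pi^-1 :> R. Proof. by rewrite invr_ge0 ltW. Qed.

Section Dominated.
Variables (p C c : R) (Kd K : R -> R -> R).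
Hypothesis dKd : dominating p Kd C.
Hypothesis dK : dominated Kd c K.

Lemma dominated_integ_abs f x : L2 p f -> 0 < x -> integ (fun t => `|K x t * f t|) /\
  Ipos (fun t => `|K x t * f t|) <= c * Ipos (fun t => Kd x t * `|f t|).
Proof.
move=> Lf x0; have i := dom_integ dKd Lf x0.
have h t : 0 < t -> `|K x t * f t| <= c * (Kd x t * `|f t|).
  by move=> t0; rewrite normrM mulrA ler_wpM2r// dK.2.
have i1 : integ (fun t => `|K x t * f t|).
  apply: (le_integ (g := fun t => c * (Kd x t * `|f t|))).
  - by apply: mpos_norm; apply: mposM Lf.1; exact: mpos2_mposr dK.1 x0.
  - by move=> t t0; rewrite normr_id h.
  - exact: integZl.
by split=> //; rewrite -IposZl//; apply: le_Ipos => //; exact: integZl.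
Qed.

Lemma dominated_integ f x : L2 p f -> 0 < x -> integ (fun t => K x t * f t).
Proof.
move=> Lf x0; apply: integ_absE; last by have [] := dominated_integ_abs Lf x0.
by apply: mposM Lf.1; exact: mpos2_mposr dK.1 x0.
Qed.

Lemma mpos_op f : mpos f -> mpos (op K f).
Proof.
move=> mf; apply: mposM; first exact: mpos_cst.
by apply: mpos_Ipos; apply: mpos2M; [exact: dK.1|exact: mpos2_snd].
Qed.

Lemma norm_op_le f x : L2 p f -> 0 < x ->
  `|op K f x| <= c * op Kd (fun t => `|f t|) x.
Proof.
move=> Lf x0; rewrite /op normrM (ger0_norm piV0) mulrCA ler_wpM2l//.
apply: le_trans (dominated_integ_abs Lf x0).2.
by apply: ler_norm_Ipos; exact: dominated_integ.
Qed.

Lemma L2_op f : L2 p f -> L2 p (op K f) /\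
  sqnorm p (op K f) <= c ^+ 2 * C * sqnorm p f.
Proof.
move=> Lf; have [L1 h] := dom_op dKd Lf.
have [L3 h3] := le_L2 (mpos_op Lf.1) (fun x => norm_op_le Lf (x := x)) (L2Z c L1).
split=> //; apply: (le_trans h3); rewrite sqnormZ// -mulrA ler_wpM2l//.
exact: sqr_ge0.
Qed.

Lemma opD f g x : L2 p f -> L2 p g -> 0 < x ->
  op K (fun t => f t + g t) x = op K f x + op K g x.
Proof.
move=> Lf Lg x0; rewrite /op -mulrDr -IposD; try exact: dominated_integ.
by congr (_ * _); apply: eq_Ipos => t _; rewrite mulrDr.
Qed.

Lemma opZ r f x : L2 p f -> 0 < x -> op K (fun t => r * f t) x = r * op K f x.
Proof.
move=> Lf x0; rewrite /op mulrCA -(IposZl r (dominated_integ Lf x0)).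
by congr (_ * _); apply: eq_Ipos => t _; rewrite mulrCA.
Qed.

Lemma opB f g x : L2 p f -> L2 p g -> 0 < x ->
  op K (fun t => f t - g t) x = op K f x - op K g x.
Proof.
move=> Lf Lg x0; rewrite /op -mulrBr -IposB; try exact: dominated_integ.
by congr (_ * _); apply: eq_Ipos => t _; rewrite mulrBr.
Qed.

Lemma ae_op f g x : mpos g -> L2 p f -> 0 < x ->
  ae_eq (@lebesgue_measure R) (@Rpos R) f g -> op K f x = op K g x.
Proof.
move=> mg Lf x0 h; rewrite /op; congr (_ * _); apply: ae_Ipos.
- by apply: mposM Lf.1; exact: mpos2_mposr dK.1 x0.
- by apply: mposM mg; exact: mpos2_mposr dK.1 x0.
- by apply: ae_imp h => t h t0; rewrite h.
Qed.

End Dominated.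

(** Fubini's theorem applies because the inner integral of absolute values is at most c pi times
    [op Kd] of |f|, an element of [L2 p], which pairs with the section of [K1] in [L2 (- p)]. *)
Lemma op_op p C c Kd K1 K2 f x : dominating p Kd C -> dominated Kd c K2 ->
  mpos2 K1 -> 0 < x -> L2 (- p) (K1 x) ->
  (forall t, 0 < t -> integ (fun s => K1 x s * K2 s t)) -> L2 p f ->
  integ (fun t => f t * Ipos (fun s => K1 x s * K2 s t)) /\
  Ipos (fun s => K1 x s * op K2 f s) =
    pi^-1 * Ipos (fun t => f t * Ipos (fun s => K1 x s * K2 s t)).
Proof.
move=> dKd dK m1 x0 L1 i12 Lf.
pose F s t := K1 x s * (K2 s t * f t).
have mF : mpos2 F.
  apply: mpos2M; first exact: mpos2_fst L1.1.
  by apply: mpos2M; [exact: dK.1|exact: mpos2_snd Lf.1].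
have iF s : 0 < s -> integ (F s).
  by move=> s0; apply: integZl; exact: dominated_integ dKd dK _ _ Lf s0.
have iI : integ (fun s => Ipos (fun t => `|F s t|)).
  have E s : 0 < s -> Ipos (fun t => `|F s t|) = `|K1 x s| * Ipos (fun t => `|K2 s t * f t|).
    move=> s0; rewrite -IposZl; last by have [] := dominated_integ_abs dKd dK Lf s0.
    by apply: eq_Ipos => t t0; rewrite /F normrM.
  have [L3 _] := dom_op dKd Lf.
  have [i _] := pairing_cs (L2Z (c * pi) L3) (L2_norm L1).
  apply: (le_integ (g := _)) i.
    by apply: mpos_Ipos; exact: mpos2_comp mF.
  move=> s s0; rewrite E// ger0_norm; last by rewrite mulr_ge0 ?normr_ge0// Ipos_ge0.
  rewrite [leRHS]mulrC ler_wpM2l ?normr_ge0//.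
  have [_ h] := dominated_integ_abs dKd dK Lf s0; apply: (le_trans h).
  by rewrite /op -mulrA (mulrA pi) divff ?mul1r// gt_eqF.
have [j e] := fubini mF iF iI.
have E t : 0 < t -> Ipos (F^~ t) = f t * Ipos (fun s => K1 x s * K2 s t).
  by move=> t0; rewrite -IposZl ?i12//; apply: eq_Ipos => s s0; rewrite /F; ring.
split; first exact: eq_integ E j.
rewrite -(eq_Ipos E) -e -IposZl; last first.
  apply: le_integ iI; first exact: mpos_Ipos.
  by move=> s s0; apply: ler_norm_Ipos; exact: iF.
apply: eq_Ipos => s s0; rewrite /op /F mulrCA; congr (_ * _).
by rewrite IposZl//; exact: dominated_integ dKd dK _ _ Lf s0.
Qed.

End Operators.

(** * The Stieltjes constant and homogeneous kernels *)

Section StieltjesConstant.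
Variable R : realType.
Implicit Types (x s t a c : R).

Lemma integ_powR_kerS a b x : 0 < x -> 0 < 1 - a -> 0 < a + b - 1 -> 0 <= b ->
  integ (fun t => (x + t `^ b)^-1 * t `^ (- a)).
Proof.
move=> x0 a1 ab b0.
have h : 0 < 1 - a < b + 0 by apply/andP; split=> //; lra.
have := integ_powR_rational h b0 (lexx 0) x0 ltr01.
move=> /(integZl 2); apply: eq_integ => t t0.
rewrite powRr0 (_ : 1 - a - 1 = - a); last by ring.
have p0 : 0 < x + t `^ b by rewrite addr_gt0 ?powR_gt0.
by field; rewrite gt_eqF.
Qed.

(** As t^(-a) lies between 1 and 1 / t, its distance to 1 is at most |t - 1| / t, which settles the
    window about 1; outside the window |t - 1| is bounded below by a multiple of max 1 t. *)
Let integ_diffq_powR a : 0 < a < 1 -> integ (diffq (fun t => t `^ (- a)) 1).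
Proof.
move=> /andP[a0 a1].
apply: (@integ_powR_le _ _ (- a) (- a - 1) 3); [lra|lra| | |].
- by apply: mpos_diffq; exact: mpos_powR.
- move=> t /andP[t0 t1]; rewrite /diffq near_itvE normrM normfV mul1r.
  have p1 : 1 <= t `^ (- a) by rewrite -(powRr0 t) ger_powR ?t0//; lra.
  have p2 : t `^ (- a) <= t^-1.
    by rewrite -powR_inv1 ?(ltW t0)// ger_powR ?t0//; lra.
  move: p1 p2; rewrite -div1r ler_pdivlMr//; move: (t `^ _) => P p1 p2.
  have [->|tn] := eqVneq t 1; first by rewrite subrr normr0 invr0 mulr0; lra.
  have tl : 0 < 1 - t by rewrite subr_gt0 lt_neqAle tn.
  rewrite [`|t - 1|]distrC (gtr0_norm tl) ler_pdivrMr//.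
  rewrite powR1 mul1r; case: (boolP (_ && _)) => h; rewrite ?mulr1n ?mulr0n.
    by rewrite ger0_norm; nra.
  have ht : t < 2^-1.
    by rewrite ltNge; apply: contra h => h'; apply/andP; split; lra.
  by rewrite subr0 ger0_norm; nra.
- move=> t t1; have t0 : 0 < t := lt_le_trans ltr01 t1.
  rewrite /diffq near_itvE normrM normfV mul1r.
  have p1 : t `^ (- a) <= 1 by rewrite -(powRr0 t) ler_powR//; lra.
  have p2 : t^-1 <= t `^ (- a).
    by rewrite -powR_inv1 ?(ltW t0)// ler_powR//; lra.
  have -> : t `^ (- a - 1) = t `^ (- a) / t.
    by rewrite powRD_gt0// powR_inv1 ?ltW.
  move: p1 p2; rewrite -[t^-1 <= _]/(t^-1 <= t `^ (- a)) -(div1r t) ler_pdivrMr// div1r; move: (t `^ _) => P p1 p2.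
  have P0 : 0 < P by rewrite -(pmulr_lgt0 _ t0) (lt_le_trans ltr01).
  have [->|tn] := eqVneq t 1; first by rewrite subrr normr0 invr0 mulr0 invr1 mulr1; lra.
  have tl : 0 < t - 1 by rewrite subr_gt0 lt_neqAle eq_sym tn.
  rewrite (gtr0_norm tl) ler_pdivrMr// powR1 mul1r.
  have -> : 3 * (P / t) * (t - 1) = 3 * P * (t - 1) / t by ring.
  case: (boolP (_ && _)) => h; rewrite ?mulr1n ?mulr0n ler_pdivlMr//.
    have P23 : 2 / 3 <= P by move/andP: h => [_ h]; nra.
    by rewrite ler0_norm; nra.
  have ht : 3 / 2 < t.
    by rewrite ltNge; apply: contra h => h'; apply/andP; split; lra.
  by rewrite subr0 ger0_norm; nra.
Qed.

(** Euler's integral, from two evaluations of one limit. The integral of [kerP] against t^(-a) at x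
    = 1 is sin (a phi) times the Stieltjes integral by rotation, and tends to pi because P_phi
    approximates the identity. *)
Lemma stieltjes_const a : 0 < a < 1 ->
  sin (a * pi) * Ipos (fun t => kerS 1 t * t `^ (- a)) = pi.
Proof.
move=> ha.
have h1 : Ipos (fun t => kerP (angle R n) 1 t * t `^ (- a)) @[n --> \oo] -->
    0 * Ipos (diffq (fun t => t `^ (- a)) 1) + pi * (1 : R) `^ (- a).
  apply: (kernel_family_cvg ltr01).
  - by move=> n; exact: mpos2_mposr (@mpos2_kerP R _) ltr01.
  - by move=> n t t0; apply: kerP_trunc_le => //; exact: angle_itv.
  - by move=> n; have [] := Ipos_near_kerP (angle_itv R n) (sin_angle_gt0 R n) (@ltr01 R).
  - move=> t t0 t1; rewrite -[X in _ --> X](mulr0 (t - 1)).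
    by apply: cvgM; [exact: cvg_cst|exact: cvg_kerP].
  - exact: cvg_near_kerP.
  - exact: integ_diffq_powR.
have h2 : Ipos (fun t => kerP (angle R n) 1 t * t `^ (- a)) @[n --> \oo] -->
    sin (a * pi) * Ipos (fun t => kerS 1 t * t `^ (- a)).
  apply: (@cvgn_ext _ (fun n => sin (a * angle R n) * Ipos (fun t => kerS 1 t * t `^ (- a))))
    => //.
    by move=> n; have [_ ->] := rotation_kerP_input ha (@ltr01 R) (angle_itv R n).
  by apply: cvgM; [exact: cvg_sin_angle|exact: cvg_cst].
rewrite (cvg_unique _ h2 h1)//.
by rewrite mul0r add0r powR1 mulr1.
Qed.

Lemma homogeneous_input (K : R -> R -> R) a x : mpos2 K -> 0 < x ->
  (forall x t, 0 < x -> 0 < t -> 0 <= K x t) ->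
  (forall c x t, 0 < c -> 0 < x -> 0 < t -> K (c * x) (c * t) = c^-1 * K x t) ->
  integ (fun t => K 1 t * t `^ (- a)) ->
  integ (fun t => K x t * t `^ (- a)) /\
  Ipos (fun t => K x t * t `^ (- a)) = Ipos (fun t => K 1 t * t `^ (- a)) * x `^ (- a).
Proof.
move=> mK x0 K0 hK i.
have E t : 0 < t -> (x^-1 * x `^ (- a)) * (K 1 t * t `^ (- a)) =
    K x (x * t) * (x * t) `^ (- a).
  move=> t0; have -> : K x (x * t) = x^-1 * K 1 t by rewrite -hK// mulr1.
  by rewrite powRM ?ltW//; ring.
have [|||j e] := @Ipos_scale _ x (fun t => K x t * t `^ (- a)) x0.
- by apply: mposM; [exact: mpos2_mposr mK x0|exact: mpos_powR].
- by move=> t t0; rewrite mulr_ge0 ?powR_ge0 ?K0.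
- by apply: (eq_integ E); exact: integZl.
split=> //; rewrite e -(eq_Ipos E) IposZl//; field; by rewrite gt_eqF.
Qed.

(** A kernel homogeneous of degree -1 has Schur integrals that are exact multiples of the test
    powers, so one integral at x = 1 and one at t = 1 suffice; exchanging the variables replaces a
    by 1 - a. The factor pi^-2 comes from the normalisation of [op]. *)
Lemma homogeneous_dominating (K : R -> R -> R) a (C1 C2 : R) : mpos2 K ->
  (forall x t, 0 < x -> 0 < t -> 0 <= K x t) ->
  (forall c x t, 0 < c -> 0 < x -> 0 < t -> K (c * x) (c * t) = c^-1 * K x t) ->
  integ (fun t => K 1 t * t `^ (- a)) -> integ (fun x => K x 1 * x `^ (a - 1)) ->
  Ipos (fun t => K 1 t * t `^ (- a)) <= C1 -> 0 < C1 ->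
  Ipos (fun x => K x 1 * x `^ (a - 1)) <= C2 ->
  (forall x, 0 < x -> L2 (- (2 * a - 1)) (K x)) ->
  dominating (2 * a - 1) K (pi^-1 ^+ 2 * (C1 * C2)).
Proof.
move=> mK K0 hK i1 i2 h1 C1_0 h2 L.
have C2_0 : 0 <= C2.
  by apply: le_trans h2; apply: Ipos_ge0 => x x0; rewrite mulr_ge0 ?powR_ge0 ?K0.
have iK f x : L2 (2 * a - 1) f -> 0 < x -> integ (fun t => K x t * `|f t|).
  move=> Lf x0; have [i _] := pairing_cs (L2_norm Lf) (L x x0).
  by apply: eq_integ i => t t0; rewrite mulrC.
split=> //; first by ge0.
move=> f Lf.
have [|||L1 h] := @schur_test _ K a C1 C2 f mK K0 C1_0 C2_0 _ _ Lf.
- move=> x x0; have [j ->] := homogeneous_input mK x0 K0 hK i1.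
  by split=> //; rewrite ler_wpM2r ?powR_ge0.
- move=> t t0; have e : a - 1 = - (1 - a) by ring.
  rewrite e in i2 h2 *.
  have [||j] := @homogeneous_input (fun t x => K x t) (1 - a) t (mpos2_flip mK) t0 _ _ i2.
  - by move=> *; exact: K0.
  - by move=> *; exact: hK.
  - by move=> ->; split=> //; rewrite ler_wpM2r ?powR_ge0.
- by move=> x; exact: iK.
split; first exact: L2Z.
have -> : sqnorm (2 * a - 1) (op K (fun t => `|f t|)) = pi^-1 ^+ 2 *
    sqnorm (2 * a - 1) (fun x => Ipos (fun t => K x t * `|f t|)) by exact: sqnormZ.
by rewrite -[leRHS]mulrA ler_wpM2l ?sqr_ge0.
Qed.

End StieltjesConstant.

Lemma schur_const (R : realType) (v w : R) : v != 0 -> w != 0 ->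
  w^-1 ^+ 2 * (w / v * (w / v)) = v ^- 2.
Proof. by move=> v0 w0; field; rewrite v0 w0. Qed.

(** * Schur bounds for the three positive kernels *)

Section Instances.
Variables (R : realType) (a : R).
Hypotheses (a_gt0 : 0 < a) (a_lt : a < 1 / 2).
Implicit Types (x s t c phi : R) (f g : R -> R).
Local Notation p := (2 * a - 1).
Local Ltac alra := move: a_gt0 a_lt => ? ?; lra.

Lemma sin_api_gt0 : 0 < sin (a * pi).
Proof.
have p0 := pi_gt0 R; apply: sin_gt0_pi; rewrite mulr_gt0//=.
by rewrite gtr_pMl//; alra.
Qed.

Lemma kerS_ge0 x t : 0 < x -> 0 < t -> 0 <= kerS x t :> R.
Proof. by move=> x0 t0; rewrite invr_ge0 ltW// addr_gt0. Qed.

Lemma kerSC x t : kerS x t = kerS t x :> R. Proof. by rewrite /kerS addrC. Qed.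

Lemma integ_kerS_input b : 0 < b < 1 -> integ (fun t : R => kerS 1 t * t `^ (- b)).
Proof.
move=> /andP[b0 b1]; have := @integ_powR_kerS R b 1 1 ltr01.
rewrite subr_gt0 b1 addrK b0 => /(_ isT isT ler01); apply: eq_integ => t t0.
by rewrite powRr1 ?ltW.
Qed.

Lemma Ipos_kerS_input b : 0 < b < 1 ->
  Ipos (fun t : R => kerS 1 t * t `^ (- b)) = pi / sin (b * pi).
Proof.
move=> hb; have /andP[b0 b1] := hb.
apply: (canRL (mulfK _)); last by rewrite mulrC stieltjes_const.
rewrite gt_eqF//; apply: sin_gt0_pi; have p0 := pi_gt0 R.
by rewrite mulr_gt0//= gtr_pMl.
Qed.

Lemma L2_kerS x : 0 < x -> L2 (- p) (kerS x) /\ L2 p ((@kerS R)^~ x).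
Proof.
move=> x0; have m1 : mpos (kerS x) := mpos2_mposr (@mpos2_kerS R) x0.
have m2 : mpos ((@kerS R)^~ x) := mpos2_mposl (@mpos2_kerS R) x0.
have h1 : 0 < 2 - 2 * a < 1 + 1 by alra.
have h2 : 0 < 2 * a < 1 + 1 by alra.
split; split=> //.
  apply: eq_integ (integ_powR_rational h1 ler01 ler01 x0 x0) => t t0.
  rewrite powRr1 ?(ltW t0)// /kerS exprVn expr2 mulrC; congr (_ * _ `^ _); ring.
apply: eq_integ (integ_powR_rational h2 ler01 ler01 x0 x0) => t t0.
by rewrite powRr1 ?(ltW t0)// /kerS exprVn expr2 mulrC addrC.
Qed.

(** Both Schur integrals equal pi / sin (a pi), because sin (pi - a pi) = sin (a pi). *)
Lemma dominating_kerS : dominating p (@kerS R) (sin (a * pi) ^- 2).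
Proof.
pose C1 := pi / sin (a * pi).
have C1_gt0 : 0 < C1 by rewrite divr_gt0 ?pi_gt0 ?sin_api_gt0.
have -> : sin (a * pi) ^- 2 = pi^-1 ^+ 2 * (C1 * C1).
  by rewrite /C1 schur_const// lt0r_neq0// ?pi_gt0 ?sin_api_gt0.
have b01 : 0 < 1 - a < 1 by alra.
have a01 : 0 < a < 1 by alra.
apply: homogeneous_dominating => //.
- exact: mpos2_kerS.
- exact: kerS_ge0.
- move=> c x t c0 x0 t0; rewrite /kerS -mulrDr invfM//.
- exact: integ_kerS_input.
- apply: eq_integ (integ_kerS_input b01) => t t0.
  by rewrite kerSC opprB.
- by rewrite Ipos_kerS_input.
- rewrite (@eq_Ipos _ _ (fun t => kerS 1 t * t `^ (- (1 - a)))).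
    by rewrite Ipos_kerS_input// mulrBl mul1r sinB sinpi cospi mul0r sub0r mulN1r opprK.
  by move=> t t0; rewrite kerSC opprB.
- by move=> x x0; have [] := L2_kerS x0.
Qed.

Lemma kerA_ge0 x t : 0 < x -> 0 < t -> 0 <= kerA x t :> R.
Proof. by move=> x0 t0; rewrite /kerA; ge0. Qed.

Let sq t : 0 < t -> t `^ 2^-1 = Num.sqrt t.
Proof. by move=> t0; rewrite powR12_sqrt ?ltW. Qed.

Lemma L2_kerA x : 0 < x -> L2 (- p) (kerA x).
Proof.
move=> x0; split; first exact: mpos2_mposr (@mpos2_kerA R) x0.
have h1 : 0 < 1 - 2 * a < 2^-1 + 2^-1 by alra.
have h2 : 0 <= 2^-1 :> R by rewrite invr_ge0.
have sx : 0 < Num.sqrt x by rewrite sqrtr_gt0.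
apply: eq_integ (integ_powR_rational h1 h2 h2 sx sx) => t t0.
have st : 0 < Num.sqrt t by rewrite sqrtr_gt0.
rewrite (sq t0) /kerA (_ : - p = 1 - 2 * a - 1 + 1); last by ring.
rewrite (powRD_gt0 (1 - 2 * a - 1) 1 t0) powRr1 ?(ltW t0)//.
rewrite -[X in _ * (_ * X)](sqr_sqrtr (ltW t0)).
by field; rewrite !gt_eqF// addr_gt0.
Qed.

(** The kernel is of order t^(-1/2) at t = 0, so its Schur integral against t^(-a) converges
    precisely because a < 1 / 2. *)
Lemma dominating_kerA : exists C, dominating p (@kerA R) C.
Proof.
have h2 : 0 <= 2^-1 :> R by rewrite invr_ge0.
have i1 : integ (fun t => kerA 1 t * t `^ (- a)).
  have := @integ_powR_kerS R (a + 2^-1) 2^-1 1 ltr01.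
  have -> : (0 < 1 - (a + 2^-1)) by alra.
  have -> : (0 < a + 2^-1 + 2^-1 - 1) by alra.
  move=> /(_ isT isT h2); apply: eq_integ => t t0.
  have st : 0 < Num.sqrt t by rewrite sqrtr_gt0.
  rewrite opprD powRD_gt0// (powRN _ 2^-1) (sq t0) /kerA sqrtr1.
  by field; rewrite !gt_eqF// addr_gt0.
have i2 : integ (fun t => kerA t 1 * t `^ (a - 1)).
  have := @integ_powR_kerS R (1 - a) 2^-1 1 ltr01.
  have -> : (0 < 1 - (1 - a)) by alra.
  have -> : (0 < 1 - a + 2^-1 - 1) by alra.
  move=> /(_ isT isT h2); apply: eq_integ => t t0.
  by rewrite (sq t0) /kerA sqrtr1 mulr1 addrC opprB.
(* The summand 1 makes the first constant positive, as the Schur test requires. *)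
eexists; apply: (@homogeneous_dominating _ _ a
  (1 + Ipos (fun t => kerA 1 t * t `^ (- a)))
  (Ipos (fun t => kerA t 1 * t `^ (a - 1)))) => //.
- exact: mpos2_kerA.
- exact: kerA_ge0.
- move=> c x t c0 x0 t0; rewrite /kerA !sqrtrM ?ltW// -[in c^-1](sqr_sqrtr (ltW c0)).
  have sc : 0 < Num.sqrt c by rewrite sqrtr_gt0.
  have sx : 0 < Num.sqrt x by rewrite sqrtr_gt0.
  have st : 0 < Num.sqrt t by rewrite sqrtr_gt0.
  by field; rewrite !gt_eqF// -?mulrDr ?mulr_gt0// addr_gt0.
- by rewrite lerDr; exact: ler01.
- apply: ltr_wpDr => //; apply: Ipos_ge0 => t t0.
  by rewrite mulr_ge0 ?powR_ge0// kerA_ge0.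
- by move=> x; exact: L2_kerA.
Qed.

Lemma kerP_ge0 phi x t : 0 <= phi < pi -> 0 < x -> 0 < t -> 0 <= kerP phi x t.
Proof.
move=> hp x0 t0; rewrite /kerP divr_ge0 ?(ltW (den_gt0 hp x0 t0))//.
by rewrite mulr_ge0 ?(ltW x0)// sin_ge0_pi//; move: hp => /andP[-> /ltW].
Qed.

(* By rotation both Schur integrals of [P_phi] are those of the Stieltjes
   transform times a sine, so the bound is uniform in [phi]. *)
Lemma dominating_kerP phi : 0 <= phi < pi ->
  dominating p (kerP phi) (sin (a * pi) ^- 2).
Proof.
pose C1 := pi / sin (a * pi).
have C1_gt0 : 0 < C1 by rewrite divr_gt0 ?pi_gt0 ?sin_api_gt0.
have a01 : 0 < a < 1 by alra.
move=> hp.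
have -> : sin (a * pi) ^- 2 = pi^-1 ^+ 2 * (C1 * C1).
  by rewrite /C1 schur_const// lt0r_neq0// ?pi_gt0 ?sin_api_gt0.
have b01 : 0 < 1 - a < 1 by alra.
have le1 b : 0 < b < 1 -> Ipos (fun t : R => kerS 1 t * t `^ (- b)) = C1 ->
    sin (a * phi) * Ipos (fun t : R => kerS 1 t * t `^ (- b)) <= C1.
  by move=> hb ->; rewrite ler_piMl ?sin_le1// ltW.
apply: homogeneous_dominating => //.
- exact: mpos2_kerP.
- by move=> x t; exact: kerP_ge0.
- move=> c x t c0 x0 t0; rewrite /kerP.
  have -> : den phi (c * x) (c * t) = c ^+ 2 * den phi x t by rewrite /den; ring.
  by field; rewrite !gt_eqF// den_gt0.
- by have [] := rotation_kerP_input a01 (@ltr01 R) hp.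
- by have [] := rotation_kerP_output a01 (@ltr01 R) hp.
- have [_ ->] := rotation_kerP_input a01 (@ltr01 R) hp.
  by apply: le1 => //; rewrite Ipos_kerS_input.
- have [_ ->] := rotation_kerP_output a01 (@ltr01 R) hp.
  rewrite (@eq_Ipos _ _ (fun t => kerS 1 t * t `^ (- (1 - a)))).
    apply: le1 => //.
    by rewrite Ipos_kerS_input// mulrBl mul1r sinB sinpi cospi mul0r sub0r mulN1r opprK.
  by move=> t t0; rewrite kerSC opprB.
- move=> x x0; have [L _] := L2_kerS x0.
  have m : mpos (kerP phi x) := mpos2_mposr (@mpos2_kerP R phi) x0.
  have [] := le_L2 m (fun t => norm_kerP_le hp x0 (t := t)) (L2Z _ L).
  by [].
Qed.

End Instances.

(** * Regularised transforms *)

Section Identities.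
Variables (R : realType) (a : R).
Hypotheses (a_gt0 : 0 < a) (a_lt : a < 1 / 2).
Implicit Types (x s t c phi : R) (f g : R -> R) (K : R -> R -> R).
Local Notation p := (2 * a - 1).

Let dS : dominating p (@kerS R) (sin (a * pi) ^- 2) := dominating_kerS a_gt0 a_lt.

Lemma L2_dual q f : L2 q f -> L2 (- q) (fun x => x `^ q * f x).
Proof.
move=> [mf i]; split; first by apply: mposM => //; exact: mpos_powR.
apply: eq_integ i => x x0.
have e : x `^ q * x `^ (- q) = 1 by rewrite -powRD_gt0// subrr powRr0.
rewrite exprMn; transitivity (f x ^+ 2 * x `^ q * (x `^ q * x `^ (- q))); last by ring.
by rewrite e mulr1.
Qed.

Lemma dominated_kerH phi : 0 <= phi < pi ->
  dominated (@kerS R) (Num.sqrt (low phi))^-1 (kerH phi).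
Proof.
by move=> hp; split; [exact: mpos2_kerH|move=> x t x0 t0; exact: norm_kerH_le].
Qed.

Lemma dominated_kerP phi : 0 <= phi < pi ->
  dominated (@kerS R) (Num.sqrt (low phi))^-1 (kerP phi).
Proof.
by move=> hp; split; [exact: mpos2_kerP|move=> x t x0 t0; exact: norm_kerP_le].
Qed.

Section DominatedByStieltjes.
Variables (K : R -> R -> R) (c : R).
Hypothesis dK : dominated (@kerS R) c K.

Let mKr x : 0 < x -> mpos (K x). Proof. exact: mpos2_mposr dK.1. Qed.
Let mKl t : 0 < t -> mpos (K^~ t). Proof. exact: mpos2_mposl dK.1. Qed.

Lemma dominated_L2r x : 0 < x -> L2 (- p) (K x).
Proof.
move=> x0; have [L _] := L2_kerS a_gt0 a_lt x0.
by have [] := le_L2 (mKr x0) (fun t ht => dK.2 x t x0 ht) (L2Z _ L).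
Qed.

Lemma dominated_L2l t : 0 < t -> L2 p (K^~ t).
Proof.
move=> t0; have [_ L] := L2_kerS a_gt0 a_lt t0.
by have [] := le_L2 (mKl t0) (fun x hx => dK.2 x t hx t0) (L2Z _ L).
Qed.

(* Two applications of Fubini turn the weighted square norm of [op K f] into a
   double integral against the Gram kernel of [K]. *)
Lemma sqnorm_op_gram f : L2 p f ->
  [/\ forall s t, 0 < s -> 0 < t -> integ (fun x => x `^ p * (K x s * K x t)),
      forall t, 0 < t ->
        integ (fun s => f s * Ipos (fun x => x `^ p * (K x s * K x t))),
      integ (fun t => f t *
        Ipos (fun s => f s * Ipos (fun x => x `^ p * (K x s * K x t)))) &
      sqnorm p (op K f) = pi^-1 ^+ 2 * Ipos (fun t => f t *
        Ipos (fun s => f s * Ipos (fun x => x `^ p * (K x s * K x t))))].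
Proof.
move=> Lf; have [Lg _] := L2_op dS dK Lf.
have i1 s t : 0 < s -> 0 < t -> integ (fun x => x `^ p * (K x s * K x t)).
  move=> s0 t0; have [i _] := dotp_cs (dominated_L2l s0) (dominated_L2l t0).
  by apply: eq_integ i => x x0; rewrite mulrC.
pose K1 t x := x `^ p * K x t.
have E1 t : 0 < t -> integ (fun s => f s * Ipos (fun x => x `^ p * (K x s * K x t))) /\
    Ipos (fun x => x `^ p * op K f x * K x t) =
    pi^-1 * Ipos (fun s => f s * Ipos (fun x => x `^ p * (K x s * K x t))).
  move=> t0.
  have mK1 : mpos2 K1.
    by apply: mpos2M; [apply: mpos2_snd; exact: mpos_powR|apply: mpos2_flip; exact: dK.1].
  have ik s : 0 < s -> integ (fun x => K1 t x * K x s).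
    by move=> s0; apply: eq_integ (i1 s t s0 t0) => x x0; rewrite /K1; ring.
  have EE s : 0 < s -> f s * Ipos (fun x => K1 t x * K x s) =
      f s * Ipos (fun x => x `^ p * (K x s * K x t)).
    by move=> s0; congr (_ * _); apply: eq_Ipos => x x0; rewrite /K1; ring.
  have [j e] := op_op dS dK mK1 t0 (L2_dual (dominated_L2l t0)) ik Lf.
  split; first exact: eq_integ EE j.
  rewrite -(eq_Ipos EE) -e; apply: eq_Ipos => x x0; rewrite /K1; ring.
(* A fixed function is presented as a kernel constant in its first variable, so that [op_op] applies
   at the dummy point 1. *)
pose K0 (y x : R) := x `^ p * op K f x.
have mK0 : mpos2 K0 by apply: mpos2_snd; apply: mposM Lg.1; exact: mpos_powR.
have ik0 t : 0 < t -> integ (fun x => K0 1 x * K x t).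
  move=> t0; have [i _] := dotp_cs Lg (dominated_L2l t0).
  by apply: eq_integ i => x x0; rewrite /K0; ring.
have [j e] := op_op dS dK mK0 ltr01 (L2_dual Lg) ik0 Lf.
have EE t : 0 < t -> f t * Ipos (fun s => K0 1 s * K s t) =
    pi^-1 * (f t * Ipos (fun s => f s * Ipos (fun x => x `^ p * (K x s * K x t)))).
  by move=> t0; rewrite (E1 t t0).2; ring.
have i3 : integ (fun t => f t *
    Ipos (fun s => f s * Ipos (fun x => x `^ p * (K x s * K x t)))).
  apply: eq_integ (integZl pi (eq_integ EE j)) => t t0.
  by rewrite mulrA divff ?mul1r ?lt0r_neq0 ?pi_gt0.
split; [exact: i1|by move=> t t0; have [] := E1 t t0|exact: i3|].
rewrite expr2 -mulrA -(IposZl _ i3) -(eq_Ipos EE) -e; apply: eq_Ipos => x x0.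
by rewrite /K0; ring.
Qed.

Lemma op_op_dominated K2 c2 f x : dominated (@kerS R) c2 K2 -> 0 < x -> L2 p f ->
  [/\ forall t, 0 < t -> integ (fun s => K x s * K2 s t),
      integ (fun t => f t * Ipos (fun s => K x s * K2 s t)) &
      op K (op K2 f) x =
        pi^-1 ^+ 2 * Ipos (fun t => f t * Ipos (fun s => K x s * K2 s t))].
Proof.
move=> dK2 x0 Lf.
have i12 t : 0 < t -> integ (fun s => K x s * K2 s t).
  move=> t0; have h2 : 0 < (1 : R) < 1 + 1 by lra.
  have i := integ_powR_rational h2 ler01 ler01 x0 t0.
  apply: (le_integ (g := _)) (integZl (c * c2) i).
    by apply: mposM; [exact: mKr|exact: mpos2_mposl dK2.1 t0].
  move=> s s0; rewrite subrr powRr0 powRr1 ?(ltW s0)// normrM mul1r.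
  rewrite invfM mulrACA (addrC t).
  by apply: ler_pM => //; [exact: dK.2|exact: dK2.2].
have [j e] := op_op dS dK2 dK.1 x0 (dominated_L2r x0) i12 Lf.
by split=> //; rewrite /op e expr2 mulrA.
Qed.

End DominatedByStieltjes.

(** By [rotation_norm] the Gram kernels of H_phi and P_phi differ by cos (2 a phi) times that of S;
    integrating this twice against f gives the identity of the squared norms. *)
Lemma sqnorm_opH_opP phi f : 0 <= phi < pi -> L2 p f ->
  sqnorm p (op (kerH phi) f) =
    sqnorm p (op (kerP phi) f) + cos (2 * a * phi) * sqnorm p (op (@kerS R) f).
Proof.
move=> hp Lf.
have [h1 h2 h3 ->] := sqnorm_op_gram (dominated_kerH hp) Lf.
have [p1 p2 p3 ->] := sqnorm_op_gram (dominated_kerP hp) Lf.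
have [s1 s2 s3 ->] := sqnorm_op_gram (dominated_refl dS) Lf.
have a01 : 0 < a < 1 by move: a_gt0 a_lt => ? ?; lra.
have G s t : 0 < s -> 0 < t -> Ipos (fun x => x `^ p * (kerH phi x s * kerH phi x t)) =
    Ipos (fun x => x `^ p * (kerP phi x s * kerP phi x t)) +
    cos (2 * a * phi) * Ipos (fun x => x `^ p * (kerS x s * kerS x t)).
  move=> s0 t0; rewrite -(rotation_norm a01 s0 t0 hp) -IposD.
  - by apply: eq_Ipos => x x0; ring.
  - exact: p1.
  - apply: eq_integ (integB (h1 s t s0 t0) (p1 s t s0 t0)) => x x0; ring.
have G2 t : 0 < t -> Ipos (fun s => f s * Ipos (fun x => x `^ p * (kerH phi x s * kerH phi x t))) =
    Ipos (fun s => f s * Ipos (fun x => x `^ p * (kerP phi x s * kerP phi x t))) +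
    cos (2 * a * phi) * Ipos (fun s => f s * Ipos (fun x => x `^ p * (kerS x s * kerS x t))).
  move=> t0; rewrite -IposZl ?s2// -IposD ?p2//; last exact: integZl (s2 t t0).
  by apply: eq_Ipos => s s0; rewrite G//; ring.
rewrite mulrCA -mulrDr; congr (_ * _).
rewrite -(IposZl _ s3) -(IposD p3); last exact: integZl.
by apply: eq_Ipos => t t0; rewrite (G2 t t0) mulrDr (mulrCA (f t)).
Qed.

Lemma opH_opH_opP_opP phi f x : 0 <= phi < pi -> L2 p f -> 0 < x ->
  op (kerH phi) (op (kerH phi) f) x + op (kerP phi) (op (kerP phi) f) x =
  op (@kerS R) (op (@kerS R) f) x.
Proof.
move=> hp Lf x0.
have [h1 h2 ->] := op_op_dominated (dominated_kerH hp) (dominated_kerH hp) x0 Lf.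
have [p1 p2 ->] := op_op_dominated (dominated_kerP hp) (dominated_kerP hp) x0 Lf.
have [s1 s2 ->] := op_op_dominated (dominated_refl dS) (dominated_refl dS) x0 Lf.
rewrite -mulrDr -IposD//; congr (_ * _); apply: eq_Ipos => t t0.
by rewrite -mulrDr -(rotation_compose x0 t0 hp) IposD ?h1 ?p1.
Qed.

(** The order of integration is exchanged for phi < pi, where [kerH] is dominated by [kerS]. After
    the rotation, [kerHA_le] gives a majorant independent of phi and dominated convergence is used
    twice, in s and then in t. As cos (pi / 2) = 0, the kernel [kerHA] becomes the product of two
    Stieltjes kernels. *)
Lemma opH_opA_cvg f x : L2 p f -> 0 < x ->
  op (kerH (angle R n)) (op (@kerA R) f) x @[n --> \oo] -->
  op (@kerS R) (op (@kerS R) f) x.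
Proof.
move=> Lf x0; have [CA dA] := dominating_kerA a_gt0 a_lt.
have [s1 s2 ->] := op_op_dominated (dominated_refl dS) (dominated_refl dS) x0 Lf.
have iSA t : 0 < t -> integ (fun s => kerS x s * kerA s t).
  move=> t0.
  have h2 : 0 < (1 : R) < 1 + 2^-1 by lra.
  have h1 : 0 <= 2^-1 :> R by lra.
  have st : 0 < Num.sqrt t by rewrite sqrtr_gt0.
  have i := integ_powR_rational h2 ler01 h1 x0 st.
  apply: eq_integ (integZl (Num.sqrt t)^-1 i) => s s0.
  rewrite subrr powRr0 powRr1 ?(ltW s0)// powR12_sqrt ?(ltW s0)// /kerS /kerA.
  have ss : 0 < Num.sqrt s by rewrite sqrtr_gt0.
  by field; rewrite !gt_eqF// addr_gt0.
have iHA n t : 0 < t -> integ (fun s => kerH (angle R n) x s * kerA s t).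
  move=> t0; have hp := angle_itv R n.
  apply: (le_integ (g := _)) (integZl (Num.sqrt (low (angle R n)))^-1 (iSA t t0)).
    apply: mposM; first exact: mpos2_mposr (@mpos2_kerH _ _) x0.
    exact: mpos2_mposl (@mpos2_kerA _) t0.
  move=> s s0; rewrite normrM mulrA ler_pM ?norm_kerH_le//.
  by rewrite ger0_norm// kerA_ge0.
have Lx n : L2 (- p) (kerH (angle R n) x).
  exact: dominated_L2r (dominated_kerH (angle_itv R n)) _ x0.
have [_ eA] := op_op dA (dominated_refl dA) (@mpos2_kerS R) x0
  (dominated_L2r (dominated_refl dS) x0) iSA (L2_norm Lf).
have [jA _] := op_op dA (dominated_refl dA) (@mpos2_kerS R) x0
  (dominated_L2r (dominated_refl dS) x0) iSA (L2_norm Lf).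
have eH n : op (kerH (angle R n)) (op (@kerA R) f) x = pi^-1 ^+ 2 *
    Ipos (fun t => f t * Ipos (kerHA (angle R n) x t)).
  have [j e] := op_op dA (dominated_refl dA) (@mpos2_kerH R _) x0 (Lx n) (iHA n) Lf.
  rewrite -(eq_Ipos (fun t (t0 : 0 < t) => congr1 (fun y => f t * y)
    (rotation_HA x0 t0 (angle_itv R n)))).
  by rewrite {1}/op e expr2 mulrA.
apply: (cvgn_ext eH erefl); apply: cvgM; first exact: cvg_cst.
have mHA n t : 0 < t -> mpos (kerHA (angle R n) x t).
  have mc (k : R) : mpos (fun=> k) := mpos_cst k.
  have ms := @mpos_sqrt R.
  move=> t0; apply: mposM; first by apply: mposD => //; exact: mposM.
  apply: mposV; apply: mposM => //; apply: mposM; first by apply: mposD => //; exact: mpos_id.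
  apply: mposD => //; apply: mposD; first exact: mposX.
  by apply: mposM => //; apply: mposM => //; exact: mposM.
have H : integ (fun t => f t * Ipos (fun s => kerS x s * kerS s t)) /\
   Ipos (fun t => f t * Ipos (kerHA (angle R n) x t)) @[n --> \oo] -->
   Ipos (fun t => f t * Ipos (fun s => kerS x s * kerS s t)).
  apply: (@Ipos_dct _ _ _ (fun t => 2 * (`|f t| * Ipos (fun s => kerS x s * kerA s t)))).
  - move=> n.
    apply: (@eq_mpos _ (fun t => f t * Ipos (fun s => kerH (angle R n) x s * kerA s t))).
      by move=> t t0; rewrite (rotation_HA x0 t0 (angle_itv R n)).
    apply: mposM; first exact: Lf.1.
    apply: mpos_Ipos; apply: mpos2M; last by apply: mpos2_flip; exact: mpos2_kerA.
    by apply: mpos2_snd; exact: mpos2_mposr (@mpos2_kerH _ _) x0.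
  - move=> t t0; apply: cvgM; first exact: cvg_cst.
    have [] // := @Ipos_dct R (fun n => kerHA (angle R n) x t) (fun s => kerS x s * kerS s t)
      (fun s => 2 * (kerS x s * kerA s t)).
    + by move=> n; exact: mHA.
    + move=> s s0.
      have st : 0 < Num.sqrt t by rewrite sqrtr_gt0.
      have ss : 0 < Num.sqrt s by rewrite sqrtr_gt0.
      have c0 : cos (angle R n / 2) @[n --> \oo] --> (0 : R).
        apply: (@cvgn_ext _ (fun n => cos (2^-1 * angle R n)) _ (cos (2^-1 * pi))).
        - by move=> n; rewrite mulrC.
        - by rewrite mulrC cos_pihalf.
        - exact: cvg_cos_angle.
      have -> : kerS x s * kerS s t = (Num.sqrt t + Num.sqrt s * 0) /
          ((x + s) * (Num.sqrt s ^+ 2 + 2 * Num.sqrt s * Num.sqrt t * 0 + Num.sqrt t ^+ 2)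
            * Num.sqrt t).
        rewrite !sqr_sqrtr ?ltW// /kerS !mulr0 !addr0.
        by field; rewrite !gt_eqF// addr_gt0.
      apply: cvgM.
        by apply: cvgD; [exact: cvg_cst|apply: cvgM => //; exact: cvg_cst].
      apply: cvgV.
        rewrite !mulr0 addr0 !mulf_neq0 ?gt_eqF ?addr_gt0 ?exprn_gt0//.
      apply: cvgM; last exact: cvg_cst.
      apply: cvgM; first exact: cvg_cst.
      apply: cvgD; last exact: cvg_cst.
      apply: cvgD; first exact: cvg_cst.
      by apply: cvgM => //; exact: cvg_cst.
    + by move=> n s s0; apply: kerHA_le => //; exact: angle_itv.
    + by apply: integZl; exact: iSA.
  - move=> n t t0; rewrite normrM mulrCA ler_wpM2l//.
    rewrite -IposZl; last exact: iSA.
    apply: ler_norm_Ipos_le; last by move=> s s0; apply: kerHA_le => //; exact: angle_itv.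
      apply: (le_integ (g := _)) (integZl 2 (iSA t t0)); first exact: mHA.
      by move=> s s0; apply: kerHA_le => //; exact: angle_itv.
    by apply: integZl; exact: iSA.
  - exact: integZl.
by have [] := H.
Qed.

End Identities.

(** * The principal value on Lipschitz functions *)

Section LipschitzCompactSupport.
Variable R : realType.
Implicit Types (x s t a b c e M L : R) (u : R -> R).
Local Notation mu := (@lebesgue_measure R).

Lemma ae_neq c : {ae mu, forall t : R, t != c}.
Proof.
exists [set c]; split; [exact: measurable_set1|exact: lebesgue_measure_set1|].
by move=> t /=; have [->//|tc] := eqVneq t c => /(_ isT).
Qed.

Lemma Ipos_itv a b : 0 < a -> a < b ->
  integ (\1_`[a, b] : R -> R) /\ Ipos (\1_`[a, b] : R -> R) = b - a.
Proof.
move=> a0 ab.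
have [|i e] := @itv_FTC R id (fun=> 1) a b a0 ab.
  by move=> x _; exact: derivable_cst.
have E x : 0 < x -> 1 * \1_`[a, b] x = \1_`[a, b] x :> R by rewrite mul1r.
by split; [exact: eq_integ E i|rewrite -(eq_Ipos E) e].
Qed.

(** A quantitative form of the regularity of test functions: the constants are explicit because the
    transforms need a majorant valid for all x simultaneously. *)
Record lip_supp a b M L u : Prop := LipSupp {
  ls_a_gt0 : 0 < a;
  ls_ab : a < b;
  ls_M_ge0 : 0 <= M;
  ls_L_ge0 : 0 <= L;
  ls_mpos : mpos u;
  ls_supp : forall t, 0 < t -> ~~ (a <= t <= b) -> u t = 0;
  ls_bound : forall t, 0 < t -> `|u t| <= M;
  ls_lip : forall s t, 0 < s -> 0 < t -> `|u s - u t| <= L * `|s - t| }.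

Section Bounds.
Variables (a b M L : R) (u : R -> R).
Hypothesis H : lip_supp a b M L u.

(** If t >= a lies outside the window about x, then a <= 3 |t - x| and x <= 2 |t - x|; hence a (1 +
    x) <= (3 + 2 a) |t - x|. *)
Let th := a / (3 + 2 * a).

(** Outside the window only u t remains, and [th] bounds the denominator below. On the window the
    Lipschitz condition bounds the quotient, and when x > 2 b the whole window lies beyond the
    support. *)
Lemma norm_diffq_le x t : 0 < x -> 0 < t ->
  `|diffq u x t| <= M / (th * (1 + x)) * \1_`[a, b] t +
    L * (x <= 2 * b)%R%:R * \1_(near_itv x) t.
Proof.
move=> x0 t0; have a0 := ls_a_gt0 H; have M0 := ls_M_ge0 H; have L0 := ls_L_ge0 H.
have th0 : 0 < th by rewrite divr_gt0//; lra.
have p1 : 0 <= M / (th * (1 + x)) * \1_`[a, b] t.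
  by rewrite mulr_ge0// divr_ge0// mulr_ge0 ?addr_ge0 ?ltW.
have p2 : 0 <= L * (x <= 2 * b)%R%:R * \1_(near_itv x) t by rewrite !mulr_ge0.
rewrite /diffq; have := near_itvE x t.
case: (boolP (_ && _)) => h ->; rewrite ?mulr1n ?mulr0n ?mulr1 ?mulr0 ?subr0 ?addr0.
- apply: (@le_trans _ _ (L * (x <= 2 * b)%R%:R)); last by rewrite lerDr.
  have [xb|xb] := leP x (2 * b); rewrite ?mulr1 ?mulr0.
    have [->|tx] := eqVneq t x; first by rewrite !subrr mul0r normr0.
    rewrite normrM normfV ler_pdivrMr ?normr_gt0 ?subr_eq0//.
    exact: ls_lip H t x t0 x0.
  have z y : 0 < y -> b < y -> u y = 0.
    by move=> y0 yb; apply: (ls_supp H) => //; rewrite negb_and -!ltNge yb orbT.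
  rewrite (z t)//; last by move: h; lra.
  by rewrite (z x) ?subrr ?mul0r ?normr0//; have := ls_ab H; lra.
- have [tab|tab] := boolP (a <= t <= b); last by rewrite (ls_supp H t0 tab) mul0r normr0.
  have -> : \1_`[a, b] t = 1 :> R.
    by rewrite indicE mem_setE in_itv/= tab.
  rewrite mulr1 normrM normfV; apply: ler_pM; rewrite ?invr_ge0//; first exact: ls_bound H _ t0.
  have d0 : th * (1 + x) <= `|t - x|.
    have [d1 d2] : x <= 2 * `|t - x| /\ a <= 3 * `|t - x|.
      move: h; rewrite negb_and -!ltNge => /orP[h|h].
        by rewrite ltr0_norm; [split|]; lra.
      by rewrite gtr0_norm; [split|]; lra.
    rewrite /th mulrAC ler_pdivrMr; last by lra.
    by move: (`|_|) d1 d2 => d d1 d2; nra.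
  rewrite lef_pV2 ?posrE//; last by rewrite mulr_gt0// addr_gt0.
  by apply: lt_le_trans d0; rewrite mulr_gt0// addr_gt0.
Qed.

Let K := M * (b - a) / th + 2 * b * L * (1 + 2 * b) + M * (1 + b).

Lemma lip_supp_bound_ge0 : 0 <= K.
Proof.
have a0 := ls_a_gt0 H; have ab := ls_ab H; have M0 := ls_M_ge0 H; have L0 := ls_L_ge0 H.
have th0 : 0 < th by rewrite divr_gt0//; lra.
have b0 : 0 <= b by lra.
have ba : 0 <= b - a by lra.
by rewrite /K; ge0; exact: ltW.
Qed.

(** The decay 1 / (1 + x) places the majorant in the weighted space, by [L2_inv1D]. The term |u x|
    is included since it multiplies the mass of the window in [norm_Ipos_diffq]. *)
Lemma integ_diffq x : 0 < x -> integ (diffq u x) /\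
  Ipos (fun t => `|diffq u x t|) + `|u x| <= K / (1 + x).
Proof.
move=> x0; have a0 := ls_a_gt0 H; have ab := ls_ab H.
have M0 := ls_M_ge0 H; have L0 := ls_L_ge0 H.
have th0 : 0 < th by rewrite divr_gt0//; lra.
have x1 : 0 < 1 + x by lra.
have [i1 e1] := Ipos_itv a0 ab.
have [i2 e2] : integ (\1_(near_itv x) : R -> R) /\ Ipos (\1_(near_itv x) : R -> R) =
    3 / 2 * x - x / 2 by apply: Ipos_itv; lra.
have i : integ (diffq u x).
  apply: (@le_integ _ _ (fun t => M / (th * (1 + x)) * \1_`[a, b] t +
    L * (x <= 2 * b)%R%:R * \1_(near_itv x) t)).
  - exact: mpos_diffq (ls_mpos H).
  - by move=> t t0; exact: norm_diffq_le.
  by apply: integD; exact: integZl.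
split=> //.
have h1 : Ipos (fun t => `|diffq u x t|) <=
    M / (th * (1 + x)) * (b - a) + L * (x <= 2 * b)%R%:R * x.
  have -> : M / (th * (1 + x)) * (b - a) + L * (x <= 2 * b)%R%:R * x =
      Ipos (fun t => M / (th * (1 + x)) * \1_`[a, b] t +
        L * (x <= 2 * b)%R%:R * \1_(near_itv x) t).
    rewrite IposD; try exact: integZl.
    by rewrite !IposZl// e1 e2; congr (_ + _ * _); field.
  apply: le_Ipos; first exact: integ_abs.
    by apply: integD; exact: integZl.
  by move=> t t0; exact: norm_diffq_le.
have h2 : L * (x <= 2 * b)%R%:R * x <= 2 * b * L * (1 + 2 * b) / (1 + x).
  rewrite ler_pdivlMr//; have [xb|xb] := leP x (2 * b); last first.
    by rewrite !mulr0 !mul0r; ge0; lra.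
  rewrite mulr1 (_ : _ * (1 + x) = L * (x * (1 + x))); last by ring.
  rewrite (_ : _ * (1 + 2 * b) = L * (2 * b * (1 + 2 * b))); last by ring.
  by rewrite ler_wpM2l//; apply: ler_pM; lra.
have h3 : `|u x| <= M * (1 + b) / (1 + x).
  rewrite ler_pdivlMr//; have [xab|xab] := boolP (a <= x <= b).
    by apply: ler_pM => //; [lra|exact: ls_bound H _ x0|move: xab; lra].
  by rewrite (ls_supp H x0 xab) normr0 mul0r mulr_ge0//; lra.
apply: (le_trans (lerD (le_trans h1 (lerD (lexx _) h2)) h3)).
rewrite /K le_eqVlt; apply/orP; left; apply/eqP; field.
by rewrite /th ?gt_eqF//; lra.
Qed.

Lemma L2_lip_supp p : L2 p u.
Proof.
have a0 := ls_a_gt0 H; have ab := ls_ab H.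
split; first exact: ls_mpos H.
have [i1 _] := Ipos_itv a0 ab.
pose W := a `^ p + b `^ p.
apply: (le_integ (g := fun t => M ^+ 2 * W * \1_`[a, b] t)).
- by apply: mposM; [apply: mposX; exact: ls_mpos H|exact: mpos_powR].
- move=> t t0; have [tab|tab] := boolP (a <= t <= b); last first.
    rewrite (ls_supp H t0 tab) expr0n mul0r normr0 mulr_ge0// mulr_ge0 ?sqr_ge0//.
    by rewrite addr_ge0 ?powR_ge0.
  rewrite indicE mem_setE in_itv/= tab mulr1 ger0_norm ?sqw_ge0//.
  apply: ler_pM; rewrite ?sqr_ge0 ?powR_ge0//.
    by rewrite -real_normK ?num_real// ler_sqr ?nnegrE ?ls_M_ge0 ?(ls_bound H)// (ls_M_ge0 H).
  move/andP: tab => [h1 h2]; rewrite /W; have [p0|p0] := leP 0 p.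
    apply: ler_wpDl; rewrite ?powR_ge0//.
    by apply: ge0_ler_powR => //; rewrite nnegrE; lra.
  apply: ler_wpDr; rewrite ?powR_ge0//.
  have e z : z `^ p = (z `^ (- p))^-1 by rewrite -powRN opprK.
  rewrite !e lef_pV2 ?posrE ?powR_gt0//.
  by apply: ge0_ler_powR => //; rewrite ?nnegrE; lra.
- exact: integZl.
Qed.

End Bounds.
End LipschitzCompactSupport.

(** * Norm convergence, and the truncated integrals *)

Section PrincipalValue.
Variable R : realType.
Implicit Types (x s t a b c e M L : R) (u : R -> R).
Local Notation mu := (@lebesgue_measure R).

(** The principal value written as an absolutely convergent integral; [pv_cvg] identifies it with
    the limit of the truncations. *)
Definition pvH u x : R := pi^-1 * Ipos (diffq u x).

Lemma opH_cvg_pvH a b M L u x : lip_supp a b M L u -> 0 < x ->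
  op (kerH (angle R n)) u x @[n --> \oo] --> pvH u x.
Proof.
move=> H x0; apply: cvgM; first exact: cvg_cst.
have -> : Ipos (diffq u x) = 1 * Ipos (diffq u x) + 0 * u x by ring.
apply: kernel_family_cvg => //.
- by move=> n; exact: mpos2_mposr (@mpos2_kerH _ _) x0.
- by move=> n t t0; apply: kerH_trunc_le => //; exact: angle_itv.
- by move=> n; have [] := Ipos_near_kerH (angle_itv R n) x0.
- move=> t t0 tx; rewrite -(@divff _ (t - x)) ?subr_eq0//.
  by apply: cvgM; [exact: cvg_cst|exact: cvg_kerH].
- exact: cvg_near_kerH.
- by have [] := integ_diffq H x0.
Qed.

Lemma opP_cvg_id a b M L u x : lip_supp a b M L u -> 0 < x ->
  op (kerP (angle R n)) u x @[n --> \oo] --> u x.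
Proof.
move=> H x0.
have -> : u x = pi^-1 * (0 * Ipos (diffq u x) + pi * u x).
  by rewrite mul0r add0r mulrA mulVf ?mul1r// lt0r_neq0// pi_gt0.
apply: cvgM; first exact: cvg_cst.
apply: kernel_family_cvg => //.
- by move=> n; exact: mpos2_mposr (@mpos2_kerP _ _) x0.
- by move=> n t t0; apply: kerP_trunc_le => //; exact: angle_itv.
- by move=> n; have [] := Ipos_near_kerP (angle_itv R n) (sin_angle_gt0 R n) x0.
- move=> t t0 tx; rewrite -(mulr0 (t - x)).
  by apply: cvgM; [exact: cvg_cst|exact: cvg_kerP].
- exact: cvg_near_kerP.
- by have [] := integ_diffq H x0.
Qed.

(** The interval contains 13 / 4 + 3 c and 5 / 4 + c for all c between -1 and 1. The bound follows
    from ln y <= y - 1, applied to y and to its inverse. *)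
Let norm_ln_le (y : R) : 1 / 4 <= y <= 7 -> `|ln y| <= 6.
Proof.
move=> /andP[y1 y2]; have y0 : 0 < y by lra.
rewrite ler_norml; apply/andP; split; last first.
  have := @le_ln1Dx R (y - 1); rewrite (addrC 1) subrK => /(_ _); lra.
have v0 : 0 < y^-1 by rewrite invr_gt0.
have v4 : y^-1 <= 4 by rewrite invf_ple ?posrE//; lra.
have := @le_ln1Dx R (y^-1 - 1); rewrite (addrC 1) subrK lnV ?posrE// => /(_ _).
by move: (y^-1) v0 v4 => v v0 v4; lra.
Qed.

Lemma norm_near_kerH_le n x : 0 < x ->
  `|Ipos (fun t => kerH (angle R n) x t * \1_(near_itv x) t)| <= 6.
Proof.
move=> x0; have hp := angle_itv R n; rewrite (Ipos_near_kerH hp x0).2.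
have c1 : -1 <= cos (angle R n) := cos_geN1 _.
have c2 : cos (angle R n) <= 1 := cos_le1 _.
rewrite normrM [`|2^-1|]ger0_norm// ler_pdivrMr//.
apply: (le_trans (ler_normB _ _)).
have := @norm_ln_le (13 / 4 + 3 * cos (angle R n)).
have := @norm_ln_le (5 / 4 + cos (angle R n)).
by move: (cos _) c1 c2 => c c1 c2 h1 h2; have := h1 _; have := h2 _; lra.
Qed.

Lemma norm_near_kerP_le n x : 0 < x ->
  `|Ipos (fun t => kerP (angle R n) x t * \1_(near_itv x) t)| <= pi.
Proof.
move=> x0; rewrite (Ipos_near_kerP (angle_itv R n) (sin_angle_gt0 R n) x0).2.
apply: (le_trans (ler_normB _ _)); rewrite [leRHS]splitr.
have h y : `|atan y| <= pi / 2 :> R.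
  by rewrite ler_norml !ltW// ?atan_gtNpi2 ?atan_ltpi2.
exact: lerD.
Qed.

Lemma L2_inv1D a : 0 < a -> a < 1 -> L2 (2 * a - 1) (fun x : R => (1 + x)^-1).
Proof.
move=> a0 a1; split; first by apply: mposV; apply: mposD; [exact: mpos_cst|exact: mpos_id].
have h : 0 < 2 * a < 1 + 1 by apply/andP; split; lra.
apply: eq_integ (integ_powR_rational h ler01 ler01 ltr01 ltr01) => x x0.
by rewrite powRr1 ?(ltW x0)// mulrC exprVn expr2.
Qed.

Section Convergence.
Variables (al : R) (a b M L : R) (u : R -> R).
Hypotheses (al_gt0 : 0 < al) (al_lt : al < 1 / 2).
Hypothesis H : lip_supp a b M L u.
Local Notation p := (2 * al - 1).

(** Common to [kerH] and [kerP]: a bound on the window mass uniform in n and x, together with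
    [integ_diffq], dominates the transforms by a multiple of 1 / (1 + x), so that pointwise
    convergence becomes convergence in norm. *)
Let dom (k : nat -> R -> R -> R) (C : R) : 0 <= C ->
  (forall n, mpos2 (k n)) ->
  (forall n x t, 0 < x -> 0 < t -> `|(t - x) * k n x t| <= 1) ->
  (forall n x, 0 < x -> integ (fun t => k n x t * \1_(near_itv x) t) /\
    `|Ipos (fun t => k n x t * \1_(near_itv x) t)| <= C) ->
  forall (v : R -> R),
  (forall x, 0 < x -> op (k n) u x @[n --> \oo] --> v x) ->
  L2 p v /\ sqnorm p (fun x => op (k n) u x - v x) @[n --> \oo] --> 0.
Proof.
move=> C0 mk k1 ik v kv; have K0 := lip_supp_bound_ge0 H.
move: (_ + _ + _) K0 (@integ_diffq _ _ _ _ _ _ H) => K K0 iK.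
have pV : 0 <= pi^-1 :> R by rewrite invr_ge0 pi_ge0.
have al1 : al < 1 by move: al_lt => ?; lra.
apply: (@L2_dct _ _ _ _ (fun x => pi^-1 * (1 + C) * K * (1 + x)^-1)) => //.
- move=> n; apply: mposM; first exact: mpos_cst.
  by apply: mpos_Ipos; apply: mpos2M => //; apply: mpos2_snd; exact: ls_mpos H.
- move=> n x x0; rewrite /op normrM ger0_norm// -!mulrA ler_wpM2l//.
  have [i h] := iK x x0; have [ik1 ik2] := ik n x x0.
  have mkx : mpos (k n x) by exact: mpos2_mposr (mk n) x0.
  apply: (le_trans (norm_Ipos_diffq x0 mkx (k1 n x ^~ x0) ik1 i)).
  apply: (@le_trans _ _ ((1 + C) * (Ipos (fun t => `|diffq u x t|) + `|u x|))).
    have I0 : 0 <= Ipos (fun t => `|diffq u x t|) by apply: Ipos_ge0.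
    have := ler_wpM2l (normr_ge0 (u x)) ik2.
    have := normr_ge0 (u x); have := mulr_ge0 C0 I0.
    move: `|u x| `|Ipos _| (Ipos _) => y z w.
    by rewrite (mulrDl 1) mul1r (mulrDr C) (mulrC C y); lra.
  by rewrite ler_wpM2l// addr_ge0.
- by apply: L2Z; exact: L2_inv1D.
Qed.

Lemma opH_cvg_L2 : L2 p (pvH u) /\
  sqnorm p (fun x => op (kerH (angle R n)) u x - pvH u x) @[n --> \oo] --> 0.
Proof.
apply: (@dom (fun n => kerH (angle R n)) 6) => //.
- by move=> n; exact: mpos2_kerH.
- by move=> n x t x0 t0; apply: kerH_trunc_le => //; exact: angle_itv.
- move=> n x x0; split; last exact: norm_near_kerH_le.
  by have [] := Ipos_near_kerH (angle_itv R n) x0.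
- by move=> x x0; exact: opH_cvg_pvH H x0.
Qed.

Lemma opP_cvg_L2 : sqnorm p (fun x => op (kerP (angle R n)) u x - u x) @[n --> \oo] --> 0.
Proof.
apply: (@dom (fun n => kerP (angle R n)) pi _ _ _ _ u _).2; first exact: pi_ge0.
- by move=> n; exact: mpos2_kerP.
- by move=> n x t x0 t0; apply: kerP_trunc_le => //; exact: angle_itv.
- move=> n x x0; split; last exact: norm_near_kerP_le.
  by have [] := Ipos_near_kerP (angle_itv R n) (sin_angle_gt0 R n) x0.
- by move=> x x0; exact: opP_cvg_id H x0.
Qed.

End Convergence.

Definition far x e : set R := `]-oo, x - e[ `|` `]x + e, +oo[.

Lemma farE x e t : \1_(far x e) t = (e < `|t - x|)%R%:R :> R.
Proof.
rewrite indicE /far in_setU !mem_setE !in_itv/= andbT; congr (_%:R).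
rewrite lter_normr orbC opprB; congr (_ || _); first by rewrite ltrBrDl.
by rewrite !ltrBrDr addrC.
Qed.

Lemma measurable_far x e : measurable (far x e : set (measurableTypeR R)).
Proof. by apply: measurableU; exact: measurable_itv. Qed.

Definition kerPV x e t : R := \1_(far x e) t / (t - x).

Lemma mpos_kerPV x e : mpos (kerPV x e).
Proof.
apply: mposM; first by apply: mpos_indic; exact: measurable_far.
by apply: mposV; apply: mposB; [exact: mpos_id|exact: mpos_cst].
Qed.

Lemma kerPV_trunc_le x e t : `|(t - x) * kerPV x e t| <= 1.
Proof.
rewrite /kerPV; have [->|tx] := eqVneq t x; first by rewrite subrr mul0r normr0.
rewrite mulrCA divff ?subr_eq0// mulr1 farE ger0_norm//.
by case: (_ < _).
Qed.

(** The window with its gap removed is symmetric about x, so the two logarithmic integrals cancel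
    exactly. The truncation excludes x - e and x + e while the intervals of the fundamental theorem
    are closed, whence an equality almost everywhere only. *)
Let near_gap x e : 0 < x -> 0 < e < x / 2 ->
  integ (fun t => kerPV x e t * \1_(near_itv x) t) /\
  Ipos (fun t => kerPV x e t * \1_(near_itv x) t) = 0.
Proof.
move=> x0 /andP[e0 ex].
have [a1 b1] : 0 < x / 2 /\ x / 2 < x - e by split; lra.
have [a2 b2] : 0 < x + e /\ x + e < 3 / 2 * x by split; lra.
have [||i1 e1] := @itv_FTC R (fun t => ln (x - t)) (fun t => (t - x)^-1) _ _ a1 b1.
- move=> t /andP[_ t1]; have d0 : 0 < x - t by lra.
  have h : is_derive t 1 (fun t => x - t) (-1) by apply: is_derive_eq; ring.
  have := @is_derive1_comp _ (@ln R) (fun t => x - t) t _ _ (is_derive1_ln d0) h.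
  move=> h2; apply: is_derive_eq; rewrite /GRing.scale /=.
  by rewrite mulrN1 -invrN opprB.
- move=> t /andP[_ t1]; apply: derivableV; first by rewrite lt_eqF//; lra.
  by apply: derivableB; [exact: derivable_id|exact: derivable_cst].
have [||i2 e2] := @itv_FTC R (fun t => ln (t - x)) (fun t => (t - x)^-1) _ _ a2 b2.
- move=> t /andP[t1 _]; have d0 : 0 < t - x by lra.
  have h : is_derive t 1 (fun t => t - x) 1 by apply: is_derive_eq; ring.
  have := @is_derive1_comp _ (@ln R) (fun t => t - x) t _ _ (is_derive1_ln d0) h.
  by move=> h2; apply: is_derive_eq; rewrite /GRing.scale /= mulr1.
- move=> t /andP[t1 _]; apply: derivableV; first by rewrite gt_eqF//; lra.
  by apply: derivableB; [exact: derivable_id|exact: derivable_cst].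
have m : mpos (fun t => kerPV x e t * \1_(near_itv x) t).
  by apply: mposM; [exact: mpos_kerPV|exact: mpos_near_itv].
have E : ae_eq mu (@Rpos R)
    (fun t => (t - x)^-1 * \1_`[x / 2, x - e] t + (t - x)^-1 * \1_`[x + e, 3 / 2 * x] t)
    (fun t => kerPV x e t * \1_(near_itv x) t).
  apply: ae_imp2 (ae_neq (x - e)) (ae_neq (x + e)) => t t1 t2 t0.
  rewrite /kerPV farE near_itvE !indicE !mem_setE !in_itv/= [RHS]mulrAC -mulrDr mulrC.
  congr (_ * _); rewrite -natrD -natrM; congr (_%:R).
  rewrite lter_normr opprB.
  have [h1|h1] := ltP t (x - e).
    have -> : e < x - t by lra.
    have -> : (t <= x - e) by lra.
    have -> : (x + e <= t) = false by apply/negbTE; rewrite -ltNge; lra.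
    have -> : (t <= 3 / 2 * x) by lra.
    by rewrite orbT !andbT addn0 mul1n.
  have h1' : x - e < t by rewrite lt_neqAle eq_sym t1.
  have -> : (e < x - t) = false by apply/negbTE; rewrite -leNgt; lra.
  have -> : (t <= x - e) = false by apply/negbTE; rewrite -ltNge; lra.
  have -> : (x / 2 <= t) by lra.
  have -> : (x + e <= t) = (e < t - x).
    by rewrite ltrBrDl le_eqVlt eq_sym (negbTE t2).
  by rewrite orbF andbF add0n; case: (_ < _); case: (_ <= _).
split; first by apply: ae_integ E _ => //; exact: integD.
rewrite -(ae_Ipos _ m E); last first.
  by apply: integ_mpos; exact: integD.
rewrite IposD// e1 e2.
have -> : x - (x - e) = e by ring.
have -> : x - x / 2 = x / 2 by field.
have -> : 3 / 2 * x - x = x / 2 by field.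
have -> : x + e - x = e by ring.
by ring.
Qed.

Lemma pv_cvg a b M L u x : lip_supp a b M L u -> 0 < x ->
  pi^-1 * Ipos (fun t => kerPV x e t * u t) @[e --> 0^'+] --> pvH u x.
Proof.
move=> H x0; apply: cvgM; first exact: cvg_cst.
have -> : Ipos (diffq u x) = 1 * Ipos (diffq u x) + 0 * u x by ring.
apply/cvg_at_rightP => e [e0 ec].
(* Integrability is needed for all n, including those with e n >= x / 2 where [near_gap] does not
   apply; it follows from the bound 1 / e n on the kernel. *)
have inear n : integ (fun t => kerPV x (e n) t * \1_(near_itv x) t).
  have [i _] : integ (\1_(near_itv x) : R -> R) /\ Ipos (\1_(near_itv x) : R -> R) =
    3 / 2 * x - x / 2 by apply: Ipos_itv; lra.
  apply: (le_integ (g := _)) (integZl (e n)^-1 i).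
    by apply: mposM; [exact: mpos_kerPV|exact: mpos_near_itv].
  move=> t t0; rewrite normrM [`|\1_ _ _|]ger0_norm// ler_wpM2r//.
  rewrite /kerPV farE normrM normfV; case: ltP => h.
    rewrite normr1 mul1r lef_pV2 ?posrE ?(ltW h)//.
    exact: lt_trans (e0 n) h.
  by rewrite normr0 mul0r invr_ge0 ltW.
apply: (kernel_family_cvg x0) => //.
- by move=> n; exact: mpos_kerPV.
- by move=> n t t0; exact: kerPV_trunc_le.
- move=> t t0 tx.
  apply: (@cvg_trans _ ((fun=> 1) @ \oo)); last exact: cvg_cst.
  apply: near_eq_cvg.
  have d0 : 0 < `|t - x| by rewrite normr_gt0 subr_eq0.
  near=> n; rewrite /kerPV farE (_ : e n < `|t - x|); last first.
    by near: n; exact: (cvgr_lt 0 ec).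
  by rewrite mul1r divff// subr_eq0.
- apply: (@cvg_trans _ ((fun=> 0) @ \oo)); last exact: cvg_cst.
  apply: near_eq_cvg; near=> n.
  rewrite (near_gap x0 _).2//; rewrite e0/=.
  by near: n; apply: (cvgr_lt 0 ec); lra.
- by have [] := integ_diffq H x0.
Unshelve. all: by end_near. Qed.

End PrincipalValue.

(** * Density of the test functions *)

Section Bumps.
Variable R : realType.
Implicit Types (x y a b : R) (p q v : {poly R}) (k n : nat).

Definition posX k y : R := Num.max 0 y ^+ k.

Lemma continuous_posX k : continuous (posX k).
Proof.
move=> y; apply: (@continuous_comp _ _ _ (fun y : R => Num.max 0 y) (fun z => z ^+ k)).
  have c0 : {for y, continuous (fun=> 0 : R)} by exact: cvg_cst.
  exact: (@continuous_max R R (fun=> 0) id y c0 (@cvg_id _ _)).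
exact: exprn_continuous.
Qed.

Lemma posXS k y : posX k.+2 y = posX k.+1 y * y.
Proof.
rewrite /posX; have [y0|y0] := leP 0 y; first by rewrite exprSr.
by rewrite !expr0n mul0r.
Qed.

Lemma is_derive_posX k y : is_derive y 1 (posX k.+2) (k.+2%:R * posX k.+1 y).
Proof.
have [y0|y0|->] := ltgtP y 0.
- apply: (@near_eq_is_derive _ _ _ (fun=> 0)).
    near=> z; rewrite /posX max_l ?expr0n//.
    by apply: ltW; near: z; exact: lt_nbhsl.
  by rewrite /posX max_l ?(ltW y0)// expr0n mulr0; exact: is_derive_cst.
- apply: (@near_eq_is_derive _ _ _ (horner ('X^(k.+2) : {poly R}))).
    near=> z; rewrite /posX max_r ?hornerXn//.
    by apply: ltW; near: z; exact: lt_nbhsr.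
  rewrite /posX max_r ?(ltW y0)//.
  have -> : k.+2%:R * y ^+ k.+1 = ('X^(k.+2))^`().[y].
    by rewrite derivXn hornerMn hornerXn mulr_natl.
  exact: is_derive_poly.
- apply/is_derive1_caratheodory; exists (posX k.+1); split.
  + by move=> z; rewrite subr0 {2}/posX maxxx expr0n subr0 posXS.
  + exact: continuous_posX.
  + by rewrite /posX maxxx expr0n mulr0.
Unshelve. all: by end_near. Qed.

(** The k-th power of the positive part of a polynomial times a polynomial. For k >= 2 the
    derivative has the same form with k lowered by one, so k = 4 allows three derivatives, the last
    one continuous. *)
Definition cutoff v k q x := posX k v.[x] * q.[x].

Lemma is_derive_cutoff v k q x :
  is_derive x 1 (cutoff v k.+2 q)
    (cutoff v k.+1 (k.+2%:R *: (v^`() * q) + v * q^`()) x).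
Proof.
have h1 := @is_derive1_comp _ (posX k.+2) (horner v) x _ _
  (is_derive_posX k v.[x]) (is_derive_poly v x).
have h2 := is_derive_poly q x.
have h := @is_deriveM _ _ (posX k.+2 \o horner v) (horner q) x 1 _ _ h1 h2.
apply: is_derive_eq; rewrite /cutoff /GRing.scale /= posXS.
by rewrite hornerD hornerZ !hornerM; ring.
Qed.

Lemma derive1_cutoff v k q : derive1 (cutoff v k.+2 q) =
  cutoff v k.+1 (k.+2%:R *: (v^`() * q) + v * q^`()).
Proof.
apply/funext => x; rewrite derive1E.
exact: (@derive_val _ _ _ _ _ _ _ (is_derive_cutoff v k q x)).
Qed.

Lemma C3_cutoff v q : C3_on_Rpos (cutoff v 4 q).
Proof.
have D k r x : derivable (cutoff v k.+2 r) x 1 by have [] := is_derive_cutoff v k r x.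
move=> x _; split; first by move=> [|[|[|//]]] _; rewrite ?derive1nS ?derive1n0 ?derive1_cutoff.
rewrite !derive1nS derive1n0 !derive1_cutoff; apply: cvgM.
  apply: (@continuous_comp _ _ _ (horner v) (posX 1)); first exact: continuous_horner.
  exact: continuous_posX.
exact: continuous_horner.
Qed.

Definition test_fun (u : R -> R) : Prop := C3_on_Rpos u /\
  exists K : set R, [/\ compact K, K `<=` @Rpos R & forall x, Rpos x -> ~ K x -> u x = 0].

Section Bump.
Variables a b : R.
Hypotheses (a_gt0 : 0 < a) (ab : a < b).

Let v : {poly R} := ('X - a%:P) * (b%:P - 'X).
Let c := ((b - a) ^+ 8)^-1.

(** Between a and b this is 1 - (1 - c v^4)^n, where c v^4 lies strictly above 0 and at most at 1
    because v <= (b - a)^2; hence it tends to 1. The geometric sum exhibits the factor v^4 that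
    makes the function three times continuously differentiable at a and b. *)
Definition bump n : R -> R := cutoff v 4 (c *: \sum_(i < n) (1 - c *: v ^+ 4) ^+ i).

Let vE x : v.[x] = (x - a) * (b - x).
Proof. by rewrite /v !hornerE. Qed.

Lemma bump_out n x : ~~ (a < x < b) -> bump n x = 0.
Proof.
move=> h; rewrite /bump /cutoff /posX max_l ?expr0n ?mul0r// vE.
move: ab h; rewrite negb_and -!leNgt => ab' /orP[h|h].
  by rewrite mulr_le0_ge0//; lra.
by rewrite mulr_ge0_le0//; lra.
Qed.

Lemma bump_in n x : a < x < b -> bump n x = 1 - (1 - c * v.[x] ^+ 4) ^+ n.
Proof.
move=> /andP[ax xb]; have v0 : 0 < v.[x] by rewrite vE mulr_gt0// subr_gt0.
rewrite /bump /cutoff /posX max_r ?(ltW v0)// hornerZ horner_sum.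
have -> : \sum_(i < n) ((1 - c *: v ^+ 4) ^+ i).[x] = \sum_(i < n) (1 - c * v.[x] ^+ 4) ^+ i.
  by apply: eq_bigr => i _; rewrite horner_exp hornerD hornerN hornerZ hornerC horner_exp.
move: (v.[x] ^+ 4) => w.
have := subrX1 (1 - c * w) n; move: (\sum_(i < n) _) => S h.
have -> : 1 - (1 - c * w) ^+ n = - ((1 - c * w) ^+ n - 1) by ring.
by rewrite h; ring.
Qed.

Let rate x : a < x < b -> 0 <= 1 - c * v.[x] ^+ 4 < 1.
Proof.
move=> /andP[ax xb]; have v0 : 0 < v.[x] by rewrite vE mulr_gt0// subr_gt0.
have ba : 0 < b - a by rewrite subr_gt0.
have c0 : 0 < c by rewrite invr_gt0 exprn_gt0.
apply/andP; split; last by rewrite ltrBlDr ltrDl mulr_gt0// exprn_gt0.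
rewrite subr_ge0 mulrC ler_pdivrMr ?exprn_gt0// mul1r.
rewrite (_ : 8 = 2 * 4)%N// exprM.
apply: lerXn2r; rewrite ?nnegrE ?(ltW v0) ?sqr_ge0// vE expr2.
by apply: ler_pM; lra.
Qed.

Lemma bump_bound n x : `|bump n x| <= \1_`[a, b] x.
Proof.
have [h|h] := boolP (a < x < b); last by rewrite bump_out// normr0.
have -> : \1_`[a, b] x = 1 :> R.
  by rewrite indicE mem_setE in_itv/=; move: h => /andP[h1 h2]; rewrite !ltW.
have /andP[r0 r1] := rate h.
rewrite bump_in//; move: (1 - c * _) r0 r1 => r r0 r1.
have := exprn_ge0 n r0; have := exprn_ile1 n r0 (ltW r1).
by move: (r ^+ n) => z z1 z0; rewrite ger0_norm; lra.
Qed.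

Lemma bump_cvg x : bump n x @[n --> \oo] --> (\1_`]a, b[ x : R).
Proof.
rewrite indicE mem_setE in_itv/=; have [h|h] := boolP (a < x < b); last first.
  by apply: (@cvgn_ext _ (fun=> 0) _ 0) => //; [move=> n; rewrite bump_out|exact: cvg_cst].
apply: (@cvgn_ext _ (fun n => 1 - (1 - c * v.[x] ^+ 4) ^+ n) _ (1 - 0)).
- by move=> n; rewrite bump_in.
- by rewrite subr0.
have /andP[r0 r1] := rate h; apply: cvgB; first exact: cvg_cst.
by apply: cvg_expr; rewrite ger0_norm.
Qed.

Lemma test_fun_bump n : test_fun (bump n).
Proof.
split; first exact: C3_cutoff.
exists `[a, b]%classic; split; first exact: segment_compact.
  by move=> x /=; rewrite RposE in_itv/= => /andP[h _]; exact: lt_le_trans h.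
move=> x _ /=; rewrite in_itv/= => h; apply: bump_out; apply/negP => /andP[h1 h2].
by apply: h; rewrite !ltW.
Qed.

End Bump.

(** The support is compact and avoids 0, so it lies in some interval from a > 0 to b. The derivative
    vanishes outside this interval, and its maximum there is a Lipschitz constant by the mean value
    theorem. *)
Lemma test_fun_lip u : test_fun u -> exists a b M L, lip_supp a b M L u.
Proof.
move=> [C3 [K [cK KR uK]]].
have [a [a0 aK]] : exists a, 0 < a /\ forall x, K x -> a <= x.
  have cl : closed K by apply: compact_closed => //; exact: Rhausdorff.
  have : nbhs (0 : R) (~` K).
    apply: open_nbhs_nbhs; split; first exact: closed_openC.
    by move=> /KR; rewrite RposE ltxx.
  move=> /nbhs_ballP[e /= e0 he]; exists e; split=> // x Kx.
  rewrite leNgt; apply/negP => xe; apply: (he x _ Kx).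
  have := KR _ Kx; rewrite RposE => x0.
  by rewrite /ball/= sub0r normrN gtr0_norm.
have [b [ab bK]] : exists b, a < b /\ forall x, K x -> x <= b.
  have [N [_ hN]] := compact_bounded cK.
  exists (Num.max (a + 1) (N + 1)); split; first by rewrite lt_max; apply/orP; left; lra.
  move=> x Kx; rewrite le_max; apply/orP; right.
  apply: (le_trans (ler_norm _)); apply: hN Kx; lra.
have usupp t : 0 < t -> ~~ (a <= t <= b) -> u t = 0.
  move=> t0 h; apply: uK; first by rewrite RposE.
  by move=> Kt; move/negP: h; apply; rewrite aK ?bK.
have D x : 0 < x -> derivable u x 1.
  by move=> x0; have [|h _] := C3 x; [by rewrite RposE|exact: (h 0%N)].
have D1 x : 0 < x -> derivable (derive1 u) x 1.
  by move=> x0; have [|h _] := C3 x; [by rewrite RposE|exact: (h 1%N)].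
have cu1 : {within `[a, b], continuous (fun x => `|derive1 u x|)}.
  apply: continuous_in_subspaceT => x; rewrite inE /= in_itv/= => /andP[ax _].
  apply: (@continuous_comp _ _ _ (derive1 u) (fun y : R => `|y|)); last exact: norm_continuous.
  by apply: derivable_continuous; apply: D1; exact: lt_le_trans ax.
have [c _ cmax] := EVT_max (ltW ab) cu1.
pose L := `|derive1 u c|.
have L0 : 0 <= L := normr_ge0 _.
have dL x : 0 < x -> `|derive1 u x| <= L.
  move=> x0; have [h|h] := boolP (a <= x <= b); first by apply: cmax; rewrite in_itv/= h.
  suff -> : derive1 u x = 0 by rewrite normr0.
  rewrite derive1E -(derive_cst (0 : R) x 1); apply: near_eq_derive.
  move: h; rewrite negb_and -!ltNge => /orP[h|h]; near=> y; apply: usupp.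
  - by near: y; exact: lt_nbhsr.
  - rewrite negb_and -!ltNge; apply/orP; left.
    by near: y; exact: lt_nbhsl.
  - by near: y; exact: lt_nbhsr.
  - rewrite negb_and -!ltNge; apply/orP; right.
    by near: y; exact: lt_nbhsr.
have lip s t : 0 < s -> s < t -> `|u t - u s| <= L * (t - s).
  move=> s0 st.
  have [|| z zst ->] := @MVT _ u (derive1 u) s t st.
  - move=> x; rewrite in_itv/= => /andP[sx _]; have x0 := lt_trans s0 sx.
    by apply: DeriveDef; [exact: D|rewrite derive1E].
  - apply: continuous_in_subspaceT => x; rewrite inE /= in_itv/= => /andP[sx _].
    by apply: derivable_continuous; apply: D; exact: lt_le_trans sx.
  rewrite normrM [`|t - s|]gtr0_norm ?subr_gt0// ler_wpM2r ?subr_ge0 ?(ltW st)//.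
  by apply: dL; move: zst; rewrite in_itv/= => /andP[h _]; exact: lt_trans h.
(* As u vanishes at b + 1, the Lipschitz bound gives |u t| <= L (b + 1 - t) on the support. *)
exists a, b, (L * (b + 1)), L; split=> //.
- by rewrite mulr_ge0//; lra.
- by apply: mpos_derivable => x; exact: D.
- move=> t t0; have [h|h] := boolP (a <= t <= b); last first.
    by rewrite usupp// normr0 mulr_ge0//; lra.
  have hb : t < b + 1 by lra.
  have b0 : u (b + 1) = 0.
    by apply: usupp; [lra|rewrite negb_and -!ltNge; apply/orP; right; lra].
  have := lip _ _ t0 hb; rewrite b0 sub0r normrN => h1; apply: (le_trans h1).
  by rewrite ler_wpM2l//; lra.
- move=> s t s0 t0; have [st|ts|->] := ltgtP s t.
  + by rewrite distrC (distrC s) [`|t - s|]gtr0_norm ?subr_gt0// lip.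
  + by rewrite [`|s - t|]gtr0_norm ?subr_gt0// lip.
  + by rewrite !subrr normr0 mulr0.
Unshelve. all: by end_near. Qed.

End Bumps.

(** * Density as an induction principle *)

Section Density.
Variables (R : realType) (p : R) (P : (R -> R) -> Prop).
Implicit Types (x t c a b : R) (f g : R -> R) (A : set R).
Local Notation mT := (measurableTypeR R).
Hypothesis P_test : forall f, test_fun f -> P f.
Hypothesis P_lin : forall c f g, L2 p f -> L2 p g -> P f -> P g ->
  P (fun x => c * f x + g x).
Hypothesis P_lim : forall (fn : nat -> R -> R) f, (forall n, L2 p (fn n)) ->
  (forall n, P (fn n)) -> L2 p f ->
  sqnorm p (fun x => fn n x - f x) @[n --> \oo] --> 0 -> P f.

Let Q f := L2 p f /\ P f.

Let Q_lin c f g : Q f -> Q g -> Q (fun x => c * f x + g x).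
Proof.
move=> [L1 P1] [L3 P3]; split; last exact: P_lin.
by apply: L2D => //; exact: L2Z.
Qed.

Let Q_dct (fn : nat -> R -> R) f g : (forall n, Q (fn n)) -> L2 p g ->
  (forall n x, 0 < x -> `|fn n x| <= g x) ->
  (forall x, 0 < x -> fn n x @[n --> \oo] --> f x) -> Q f.
Proof.
move=> Qn Lg h1 h2.
have [L1 h] := L2_dct (fun n => (Qn n).1.1) h2 h1 Lg.
split=> //; apply: (P_lim (fun n => (Qn n).1) (fun n => (Qn n).2) L1 h).
Qed.

(** Invariance of [P] under equality on the half-line is obtained from its closure under limits,
    applied to a constant sequence. *)
Let Q_ext f g : (forall x, 0 < x -> f x = g x) -> Q f -> Q g.
Proof.
move=> e Qf; apply: (@Q_dct (fun=> f) g (fun x => `|f x|)) => //.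
  exact: L2_norm Qf.1.
by move=> x x0; rewrite e//; exact: cvg_cst.
Qed.

Let L2_itv a b : 0 < a -> a < b -> L2 p (\1_`[a, b] : R -> R).
Proof.
move=> a0 ab; split; first by apply: mpos_indic; exact: measurable_itv.
have [i _] := Ipos_itv a0 ab.
apply: (le_integ (g := fun t => (a `^ p + b `^ p) * \1_`[a, b] t)).
- apply: mposM; last exact: mpos_powR.
  by apply: mposX; apply: mpos_indic; exact: measurable_itv.
- move=> t t0; rewrite ger0_norm ?sqw_ge0// indicE mem_setE in_itv/=.
  have [/andP[h1 h2]|h] := boolP (a <= t <= b); last by rewrite !mulr0 expr0n mul0r.
  rewrite expr1n mul1r mulr1; have [p0|p0] := leP 0 p.
    apply: ler_wpDl; rewrite ?powR_ge0//.
    by apply: ge0_ler_powR => //; rewrite nnegrE; lra.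
  apply: ler_wpDr; rewrite ?powR_ge0//.
  have e z : z `^ p = (z `^ (- p))^-1 by rewrite -powRN opprK.
  rewrite !e lef_pV2 ?posrE ?powR_gt0//.
  by apply: ge0_ler_powR => //; rewrite ?nnegrE; lra.
- exact: integZl.
Qed.

Let Q_itv a b : 0 < a -> a < b -> Q (\1_`]a, b[ : R -> R).
Proof.
move=> a0 ab; apply: (@Q_dct (bump a b) _ (\1_`[a, b])).
- move=> n; have T := test_fun_bump a0 ab n.
  by split; [have [? [? [? [? H]]]] := test_fun_lip T; exact: L2_lip_supp H _|exact: P_test].
- exact: L2_itv.
- by move=> n x _; exact: bump_bound.
- by move=> x _; exact: bump_cvg.
Qed.

Let J m : set R := `]m.+2%:R^-1, m.+2%:R[.
Let Jlt m : 0 < m.+2%:R^-1 :> R /\ m.+2%:R^-1 < m.+2%:R :> R.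
Proof.
split; first by rewrite invr_gt0.
by rewrite (@lt_trans _ _ 1)// ?invf_lt1// ltr1n.
Qed.

Let QJ m : Q (\1_(J m) : R -> R).
Proof. by have [h1 h2] := Jlt m; exact: Q_itv. Qed.

Let Q0 : Q (fun=> 0).
Proof.
by apply: Q_ext (Q_lin (-1) (QJ 0) (QJ 0)) => x _; rewrite mulN1r addNr.
Qed.

Let G : set (set R) := [set A | exists x, A = `]x, +oo[%classic].

(** Dynkin's theorem: the open rays are stable under intersection and generate the Borel sets, while
    the sets whose truncated indicator satisfies [Q] form a lambda-system. Truncation to [J m],
    bounded and away from 0, keeps all indicators in the weighted space. *)
Let Q_set A m : measurable (A : set mT) -> Q (fun x => \1_A x * \1_(J m) x).
Proof.
rewrite (RGenOInfty.measurableE R) => mA.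
pose H : set (set R) := [set A | measurable (A : set mT) /\ Q (fun x => \1_A x * \1_(J m) x)].
suff : H A by move=> [].
have GI : setI_closed G.
  move=> _ _ [x ->] [y ->]; exists (Num.max x y).
  by apply/seteqP; split=> z /=; rewrite !in_itv/= !andbT gt_max => /andP.
have HG : G `<=` H.
  move=> _ [x ->]; split; first exact: measurable_itv.
  have [h1 h2] := Jlt m; have [xm|xm] := ltP x m.+2%:R; last first.
    apply: Q_ext Q0 => t _; rewrite !indicE !mem_setE !in_itv/= andbT -natrM mulnb.
    by case: (boolP (_ && _)) => // /and3P[h3 _ h4]; lra.
  have hm : 0 < Num.max x m.+2%:R^-1 by rewrite lt_max h1 orbT.
  apply: Q_ext (Q_itv (b := m.+2%:R) hm _) => [t _|]; last by rewrite gt_max xm h2.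
  rewrite !indicE !mem_setE !in_itv/= andbT -natrM mulnb gt_max.
  by rewrite andbA.
have lH : lambda_system setT H.
  split => //.
  - by split=> //; apply: Q_ext (QJ m) => x _; rewrite indicT mul1r.
  - move=> B C CB [mB QB] [mC QC]; split; first exact: measurableD.
    apply: Q_ext (Q_lin (-1) QC QB) => x _.
    rewrite mulN1r -mulNr -mulrDl; congr (_ * _).
    rewrite !indicE in_setD; case: (boolP (x \in C)) => xC.
      by rewrite (mem_set (CB _ (set_mem xC))) addNr.
    by rewrite andbT oppr0 add0r.
  - move=> F ndF HF; split; first by apply: bigcup_measurable => k _; have [] := HF k.
    apply: (@Q_dct (fun n x => \1_(F n) x * \1_(J m) x) _ (\1_(J m))).
    + by move=> n; have [] := HF n.
    + exact: (QJ m).1.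
    + by move=> n x _; rewrite ger0_norm ?mulr_ge0// ler_piMl.
    + move=> x _; apply: cvgM; last exact: cvg_cst.
      apply: (@cvg_trans _ ((fun=> \1_(\bigcup_n F n) x : R) @ \oo)); last exact: cvg_cst.
      apply: near_eq_cvg.
      have h := @cvg_indic_exhaust R (\bigcup_n F n) F x (fun n => subsetPset _ _ (ndF n n.+1 (leqnSn n))) erefl.
      by near=> n; apply/esym; near: n; exact: h.
by apply: (lambda_system_subset GI lH HG) mA => X _; exact: subsetT.
Unshelve. all: by end_near. Qed.

Let Q_sum (n : nat) (F : nat -> R -> R) : (forall i, (i < n)%N -> Q (F i)) ->
  Q (fun x => \sum_(i < n) F i x).
Proof.
elim: n => [|n IH] h; first by apply: Q_ext Q0 => x _; rewrite big_ord0.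
have h1 : Q (fun x => \sum_(i < n) F i x) by apply: IH => i ni; apply: h; exact: ltnW.
apply: Q_ext (Q_lin 1 h1 (h n (ltnSn n))) => x _.
by rewrite big_ord_recr/= mul1r.
Qed.

Import HBNNSimple.

Let Q_nnsfun (h : {nnsfun mT >-> R}) m : Q (fun x => h x * \1_(J m) x).
Proof.
pose s := finmap.enum_fset (fset_set (h @` setT)).
have Qi i : Q (fun x => s`_i * \1_(h @^-1` [set s`_i]) x * \1_(J m) x).
  have mi : measurable (h @^-1` [set s`_i]) by exact: measurable_sfunP.
  apply: Q_ext (Q_lin s`_i (Q_set m mi) Q0) => x _.
  by rewrite addr0 mulrA.
apply: Q_ext (Q_sum (n := size s) (fun i _ => Qi i)) => x _.
by rewrite -mulr_suml (fimfunEord h x).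
Qed.

Let Q_ge0 f : L2 p f -> (forall x, 0 < x -> 0 <= f x) -> Q f.
Proof.
move=> Lf f0.
have mf : measurable_fun (@Rpos R : set mT) (EFin \o f) by apply/measurable_EFinP; exact: Lf.1.
have f0' x : Rpos x -> (0 <= (EFin \o f) x)%E by rewrite RposE => x0; rewrite lee_fin f0.
pose h := nnsfun_approx (@measurable_Rpos R) mf.
have hc x : 0 < x -> h n x @[n --> \oo] --> f x.
  move=> x0; have xR : Rpos x by rewrite RposE.
  exact: (fine_cvg (cvg_nnsfun_approx (@measurable_Rpos R) mf f0' xR)).
apply: (@Q_dct (fun n x => h n x * \1_(J n) x) _ f) => //.
- move=> n x x0; rewrite ger0_norm ?mulr_ge0//.
  apply: (@le_trans _ _ (h n x)); first by rewrite ler_piMr.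
  rewrite -(cvg_lim (@Rhausdorff R) (hc x x0)).
  apply: (@nondecreasing_cvgn_le R (fun n => h n x)); last by apply/cvg_ex; exists (f x); exact: hc.
  by move=> k l kl; have /lefP := nd_nnsfun_approx (@measurable_Rpos R) mf kl; exact.
- move=> x x0; rewrite -[X in _ --> X]mulr1; apply: cvgM; first exact: hc.
  apply: (@cvg_trans _ ((fun=> 1 : R) @ \oo)); last exact: cvg_cst.
  apply: near_eq_cvg; near=> n.
  rewrite indicE mem_setE in_itv/= (_ : _ && _ = true)//.
  have n2 : n%:R < n.+2%:R :> R by rewrite ltr_nat.
  have h1 : x^-1 < n%:R by near: n; exact: nbhs_infty_gtr.
  have h2 : x < n%:R by near: n; exact: nbhs_infty_gtr.
  rewrite (lt_trans h2 n2) andbT invf_plt ?posrE//.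
  exact: lt_trans h1 n2.
Unshelve. all: by end_near. Qed.

(** Stated for a property [P] closed under linear combinations and norm limits, so that it yields
    existence and uniqueness statements alike. Bumps give indicators of intervals, and these give
    Borel sets, simple functions and nonnegative functions; f is the difference of its positive and
    negative parts. *)
Theorem test_fun_dense f : L2 p f -> P f.
Proof.
move=> Lf; have La := L2_norm Lf.
have Qp : Q (fun x => 2^-1 * (`|f x| + f x)).
  apply: Q_ge0; first by apply: L2Z; exact: L2D.
  by move=> x _; rewrite mulr_ge0// -lerBlDr sub0r -normrN ler_norm.
have Qn : Q (fun x => 2^-1 * (`|f x| - f x)).
  apply: Q_ge0; first by apply: L2Z; exact: L2B.
  by move=> x _; rewrite mulr_ge0// subr_ge0 ler_norm.
suff : Q f by case.
by apply: Q_ext (Q_lin (-1) Qn Qp) => x _; field.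
Qed.

End Density.

(** * The transform as a limit of regularised transforms *)

Section HilbertLimit.
Variables (R : realType) (a : R).
Hypotheses (a_gt0 : 0 < a) (a_lt : a < 1 / 2).
Implicit Types (x c : R) (f g h u : R -> R).
Local Notation mu := (@lebesgue_measure R).
Local Notation p := (2 * a - 1).
Local Notation Hn n := (op (kerH (angle R n))).
Local Notation Pn n := (op (kerP (angle R n))).
Local Notation S := (op (@kerS R)).
Local Notation A := (op (@kerA R)).
Local Notation C0 := (sin (a * pi) ^- 2).

Let dS : dominating p (@kerS R) C0 := dominating_kerS a_gt0 a_lt.
Let dS1 : dominated (@kerS R) 1 (@kerS R) := dominated_refl dS.
Let dP n : dominating p (kerP (angle R n)) C0 :=
  dominating_kerP a_gt0 a_lt (angle_itv R n).
Let dP1 n : dominated (kerP (angle R n)) 1 (kerP (angle R n)) := dominated_refl (dP n).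
Let dH n := dominated_kerH (angle_itv R n).

Lemma L2_opS f : L2 p f -> L2 p (S f) /\ sqnorm p (S f) <= C0 * sqnorm p f.
Proof. by move=> Lf; have := L2_op dS dS1 Lf; rewrite expr1n mul1r. Qed.

Lemma L2_opP n f : L2 p f -> L2 p (Pn n f) /\ sqnorm p (Pn n f) <= C0 * sqnorm p f.
Proof. by move=> Lf; have := L2_op (dP n) (dP1 n) Lf; rewrite expr1n mul1r. Qed.

(** The bound is uniform in n since it comes from the norm identity with the cosine replaced by 1,
    not from the comparison with [kerS], whose factor depends on the angle. *)
Lemma L2_opH n f : L2 p f -> L2 p (Hn n f) /\ sqnorm p (Hn n f) <= 2 * C0 * sqnorm p f.
Proof.
move=> Lf; split; first by have [] := L2_op dS (dH n) Lf.
rewrite (sqnorm_opH_opP a_gt0 a_lt (angle_itv R n) Lf).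
have [_ h1] := L2_opP n Lf; have [_ h2] := L2_opS Lf.
have h3 : cos (2 * a * angle R n) * sqnorm p (S f) <= sqnorm p (S f).
  by rewrite ler_piMl ?sqnorm_ge0 ?cos_le1.
have -> : 2 * C0 * sqnorm p f = C0 * sqnorm p f + C0 * sqnorm p f by ring.
by apply: lerD; [exact: h1|exact: le_trans h3 h2].
Qed.

Lemma L2_opA f : L2 p f -> L2 p (A f).
Proof.
move=> Lf; have [CA dA] := dominating_kerA a_gt0 a_lt.
by have [] := L2_op dA (dominated_refl dA) Lf.
Qed.

Let cvg0Z (u : nat -> R) c : u n @[n --> \oo] --> 0 -> c * u n @[n --> \oo] --> 0.
Proof. by move=> h; rewrite -(mulr0 c); apply: cvgM => //; exact: cvg_cst. Qed.

Let cvg0_le (u v : nat -> R) : (forall n, 0 <= u n) -> (forall n, u n <= v n) ->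
  v n @[n --> \oo] --> 0 -> u n @[n --> \oo] --> 0.
Proof.
move=> u0 uv v0; apply: (squeeze_cvgr (f := fun=> 0) (h := v)) => //; last exact: cvg_cst.
by near=> n; rewrite u0 uv.
Unshelve. all: by end_near. Qed.

Let cvg0_comb (u v w : nat -> R) c d : (forall n, 0 <= u n) ->
  (forall n, u n <= c * v n + d * w n) ->
  v n @[n --> \oo] --> 0 -> w n @[n --> \oo] --> 0 -> u n @[n --> \oo] --> 0.
Proof.
move=> u0 h hv hw; apply: cvg0_le u0 h _.
by rewrite -[X in _ --> X](addr0 0); apply: cvgD; exact: cvg0Z.
Qed.

(* The convergence of [Pn n f] holds for every [f]; it is carried along so that a
   single density argument establishes both. *)
Definition hlim f g := [/\ L2 p g, sqnorm p (fun x => Hn n f x - g x) @[n --> \oo] --> 0 &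
  sqnorm p (fun x => Pn n f x - f x) @[n --> \oo] --> 0].

Let opHD n c f g x : L2 p f -> L2 p g -> 0 < x ->
  Hn n (fun t => c * f t + g t) x = c * Hn n f x + Hn n g x.
Proof.
move=> Lf Lg x0; rewrite (opD dS (dH n) (L2Z c Lf) Lg x0).
by rewrite (opZ dS (dH n) _ Lf x0).
Qed.

Let opPD n c f g x : L2 p f -> L2 p g -> 0 < x ->
  Pn n (fun t => c * f t + g t) x = c * Pn n f x + Pn n g x.
Proof.
move=> Lf Lg x0; rewrite (opD (dP n) (dP1 n) (L2Z c Lf) Lg x0).
by rewrite (opZ (dP n) (dP1 n) _ Lf x0).
Qed.

Lemma hlim_lin c f g u v : L2 p f -> L2 p g -> hlim f u -> hlim g v ->
  hlim (fun x => c * f x + g x) (fun x => c * u x + v x).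
Proof.
move=> Lf Lg [Lu h1 h2] [Lv h3 h4].
have key (T : nat -> (R -> R) -> R -> R) (w z : R -> R) : L2 p w -> L2 p z ->
    (forall n f, L2 p f -> L2 p (T n f)) ->
    (forall n x, 0 < x -> T n (fun t => c * f t + g t) x = c * T n f x + T n g x) ->
    sqnorm p (fun x => T n f x - w x) @[n --> \oo] --> 0 ->
    sqnorm p (fun x => T n g x - z x) @[n --> \oo] --> 0 ->
    sqnorm p (fun x => T n (fun t => c * f t + g t) x - (c * w x + z x)) @[n --> \oo] --> 0.
  move=> Lw Lz LT TD hw hz; apply: cvg0_comb hw hz => [n|n]; first exact: sqnorm_ge0.
  rewrite (@eq_sqnorm _ p _ (fun x => c * (T n f x - w x) + (T n g x - z x))); last first.
    by move=> x x0; rewrite TD//; ring.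
  have L1 := L2B (LT n f Lf) Lw; have L3 := L2B (LT n g Lg) Lz.
  apply: (le_trans (sqnormD_le (L2Z c L1) L3)); rewrite sqnormZ// mulrA.
  exact: lexx.
split; first by apply: L2D => //; exact: L2Z.
- apply: (key (fun n => Hn n)) => // [n r Lr|n x x0]; first by have [] := L2_opH n Lr.
  exact: opHD.
- apply: (key (fun n => Pn n)) => // [n r Lr|n x x0]; first by have [] := L2_opP n Lr.
  exact: opPD.
Qed.

Lemma hlim_le f g : L2 p f -> hlim f g -> sqnorm p g <= 2 * C0 * sqnorm p f.
Proof.
move=> Lf [Lg h _]; have hc := sqnorm_cvg (fun n => (L2_opH n Lf).1) Lg h.
rewrite -(cvg_lim (@Rhausdorff R) hc); apply: limr_le; first by apply/cvg_ex; eexists; exact: hc.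
by near=> n; have [] := L2_opH n Lf.
Unshelve. all: by end_near. Qed.

Lemma hlim_unique f g g' : L2 p f -> hlim f g -> hlim f g' -> ae_eq mu (@Rpos R) g g'.
Proof.
move=> Lf [Lg h _] [Lg' h' _]; apply: (sqnorm_eq0B Lg Lg').
apply/eqP; rewrite eq_le sqnorm_ge0 andbT.
have : (2 * sqnorm p (fun x => Hn n f x - g x) + 2 * sqnorm p (fun x => Hn n f x - g' x))
    @[n --> \oo] --> (0 : R).
  by rewrite -[X in _ --> X](addr0 0); apply: cvgD; exact: cvg0Z.
move=> hc; rewrite -(cvg_lim (@Rhausdorff R) hc).
apply: limr_ge; first by apply/cvg_ex; eexists; exact: hc.
near=> n; have [Ln _] := L2_opH n Lf.
by have := sqnormB3_le Lg Ln Lg'; rewrite (sqnormBC p g (Hn n f)).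
Unshelve. all: by end_near. Qed.

(** Interchange of limits: the approximation of fn n by v k n is uniform in n, so k is fixed before
    n grows. *)
Let approx_cvg (fn : nat -> R -> R) (v : nat -> nat -> R -> R) (w : nat -> R -> R)
    (g : R -> R) (d : nat -> R) :
  (forall n, L2 p (fn n)) -> (forall k n, L2 p (v k n)) -> (forall k, L2 p (w k)) -> L2 p g ->
  (forall k n, sqnorm p (fun x => fn n x - v k n x) <= d k) ->
  d k @[k --> \oo] --> 0 ->
  (forall k, sqnorm p (fun x => v k n x - w k x) @[n --> \oo] --> 0) ->
  sqnorm p (fun x => w k x - g x) @[k --> \oo] --> 0 ->
  sqnorm p (fun x => fn n x - g x) @[n --> \oo] --> 0.
Proof.
move=> Lu Lv Lw Lg h1 dc h2 h3; apply/cvgrPdist_lt => e e0.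
(* Two uses of the squared triangle inequality cost 2 + 4 + 4 = 10 sixteenths of e. *)
have e16 : 0 < e / 16 by rewrite divr_gt0.
have [k [dk wk]] : exists k, d k < e / 16 /\ sqnorm p (fun x => w k x - g x) < e / 16.
  have : \forall k \near \oo, d k < e / 16 /\ sqnorm p (fun x => w k x - g x) < e / 16.
    by near=> k; split; near: k; [exact: (cvgr_lt 0 dc)|exact: (cvgr_lt 0 h3)].
  by move=> [N _ h]; exists N; exact: (h N (leqnn N)).
near=> n; rewrite sub0r normrN ger0_norm ?sqnorm_ge0//.
have hn : sqnorm p (fun x => v k n x - w k x) < e / 16.
  by near: n; exact: (cvgr_lt 0 (h2 k)).
have b1 := sqnormB3_le (Lu n) (Lv k n) Lg.
have b2 := sqnormB3_le (Lv k n) (Lw k) Lg.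
by have := h1 k n; lra.
Unshelve. all: by end_near. Qed.

(** By linearity and [hlim_le] the limits for the approximants form a Cauchy sequence. Its limit g
    serves for f, because the operators are bounded uniformly in n. *)
Lemma hlim_closed (fn : nat -> R -> R) f : (forall n, L2 p (fn n)) ->
  (forall n, exists g, hlim (fn n) g) -> L2 p f ->
  sqnorm p (fun x => fn n x - f x) @[n --> \oo] --> 0 -> exists g, hlim f g.
Proof.
move=> Ln hn Lf fnf.
pose gn n := sval (cid (hn n)).
have hg n : hlim (fn n) (gn n) := svalP (cid (hn n)).
have Lgn n : L2 p (gn n) by have [] := hg n.
have C0_ge0 : 0 <= C0 by rewrite invr_ge0 sqr_ge0.
have dist m n : sqnorm p (fun x => gn m x - gn n x) <=
    2 * C0 * sqnorm p (fun x => fn m x - fn n x).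
  have H := hlim_lin (-1) (Ln n) (Ln m) (hg n) (hg m).
  have e (u v : R -> R) x : -1 * u x + v x = v x - u x by ring.
  have := hlim_le (L2B (Ln m) (Ln n)) (g := fun x => gn m x - gn n x).
  by apply; move: H; under eq_fun do rewrite e; under [X in hlim _ X]eq_fun do rewrite e.
have [||g Lg gg] := @L2_complete R p gn.
- exact: Lgn.
(* The factor 8 is 2 from [dist] times 4 from the squared triangle inequality; the summand 1 makes
   the denominator positive. *)
- move=> e e0; have e1 : 0 < e / (8 * C0 + 1).
    by rewrite divr_gt0// ltr_wpDl// mulr_ge0.
  have [N _ hN] : \forall n \near \oo, sqnorm p (fun x => fn n x - f x) < e / (8 * C0 + 1).
    exact: (cvgr_lt 0 fnf).
  exists N => m n Nm Nn; apply: (le_trans (dist m n)).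
  have b := sqnormB3_le (Ln m) Lf (Ln n); rewrite (sqnormBC p f (fn n)) in b.
  have hm := hN m Nm; have hn' := hN n Nn; rewrite /= in hm hn'.
  apply: (@le_trans _ _ (2 * C0 * (4 * (e / (8 * C0 + 1))))).
    by rewrite ler_wpM2l ?mulr_ge0//; lra.
  rewrite !mulrA ler_pdivrMr ?ltr_wpDl ?mulr_ge0//.
  by nra.
exists g; split=> //.
- apply: (@approx_cvg (fun n => Hn n f) (fun k n => Hn n (fn k)) gn g
    (fun k => 2 * C0 * sqnorm p (fun x => fn k x - f x))) => //.
  + by move=> n; have [] := L2_opH n Lf.
  + by move=> k n; have [] := L2_opH n (Ln k).
  + move=> k n; rewrite sqnormBC.
    rewrite (@eq_sqnorm _ p _ (Hn n (fun x => fn k x - f x))); last first.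
      by move=> x x0; rewrite (opB dS (dH n) (Ln k) Lf x0).
    by have [] := L2_opH n (L2B (Ln k) Lf).
  + exact: cvg0Z.
  + by move=> k; have [] := hg k.
- apply: (@approx_cvg (fun n => Pn n f) (fun k n => Pn n (fn k)) fn f
    (fun k => C0 * sqnorm p (fun x => fn k x - f x))) => //.
  + by move=> n; have [] := L2_opP n Lf.
  + by move=> k n; have [] := L2_opP n (Ln k).
  + move=> k n; rewrite sqnormBC.
    rewrite (@eq_sqnorm _ p _ (Pn n (fun x => fn k x - f x))); last first.
      by move=> x x0; rewrite (opB (dP n) (dP1 n) (Ln k) Lf x0).
    by have [] := L2_opP n (L2B (Ln k) Lf).
  + exact: cvg0Z.
  + by move=> k; have [] := hg k.
Qed.

Lemma hlim_test u : test_fun u -> hlim u (pvH u).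
Proof.
move=> /test_fun_lip [b [b' [M [L H]]]].
have [h1 h2] := opH_cvg_L2 a_gt0 a_lt H.
by split=> //; exact: opP_cvg_L2 a_gt0 a_lt H.
Qed.

Lemma L2_test u : test_fun u -> L2 p u.
Proof. by move=> /test_fun_lip [b [b' [M [L H]]]]; exact: L2_lip_supp H _. Qed.

Lemma hlim_exists f : L2 p f -> exists g, hlim f g.
Proof.
move: f; apply: test_fun_dense.
- by move=> u /hlim_test; exists (pvH u).
- by move=> c f g Lf Lg [u hu] [v hv]; exists (fun x => c * u x + v x); exact: hlim_lin.
- by move=> fn f Ln hn Lf h; exact: hlim_closed h.
Qed.

Lemma hlim_sqnorm f g : L2 p f -> hlim f g ->
  sqnorm p g = sqnorm p f + cos (2 * a * pi) * sqnorm p (S f).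
Proof.
move=> Lf [Lg hH hP].
have h1 := sqnorm_cvg (fun n => (L2_opH n Lf).1) Lg hH.
have h2 := sqnorm_cvg (fun n => (L2_opP n Lf).1) Lf hP.
apply: (cvg_unique _ h1 _); first exact: Rhausdorff.
apply: (cvgn_ext (fun n => sqnorm_opH_opP a_gt0 a_lt (angle_itv R n) Lf) erefl).
by apply: cvgD => //; apply: cvgM; [exact: cvg_cos_angle|exact: cvg_cst].
Qed.

(** Composition passes to the limit because H_n (H_n f) - h = H_n (H_n f - g) + (H_n g - h) with the
    H_n uniformly bounded, and likewise for P_n. *)
Lemma hlim_hlim f g h : L2 p f -> hlim f g -> hlim g h ->
  ae_eq mu (@Rpos R) (fun x => h x + f x) (S (S f)).
Proof.
move=> Lf [Lg fH fP] [Lh gH gP].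
have [LS _] := L2_opS Lf; have [LSS _] := L2_opS LS.
have Lhf := L2D Lh Lf.
apply: (sqnorm_eq0B Lhf LSS); rewrite sqnormBC.
have kH : sqnorm p (fun x => Hn n (Hn n f) x - h x) @[n --> \oo] --> 0.
  apply: (@cvg0_comb _ _ _ (2 * (2 * C0)) 2 _ _ fH gH) => [n|n]; first exact: sqnorm_ge0.
  have [L1 _] := L2_opH n Lf; have [L3 _] := L2_opH n L1; have [L4 _] := L2_opH n Lg.
  apply: (le_trans (sqnormB3_le L3 L4 Lh)); rewrite lerD2r.
  rewrite (@eq_sqnorm _ p _ (Hn n (fun x => Hn n f x - g x))); last first.
    by move=> x x0; rewrite (opB dS (dH n) L1 Lg x0).
  have [_ b] := L2_opH n (L2B L1 Lg); apply: (le_trans (ler_wpM2l _ b)) => //.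
  by rewrite [leLHS]mulrA; exact: lexx.
have kP : sqnorm p (fun x => Pn n (Pn n f) x - f x) @[n --> \oo] --> 0.
  apply: (@cvg0_comb _ _ _ (2 * C0) 2 _ _ fP fP) => [n|n]; first exact: sqnorm_ge0.
  have [L1 _] := L2_opP n Lf; have [L3 _] := L2_opP n L1.
  apply: (le_trans (sqnormB3_le L3 L1 Lf)); rewrite lerD2r.
  rewrite (@eq_sqnorm _ p _ (Pn n (fun x => Pn n f x - f x))); last first.
    by move=> x x0; rewrite (opB (dP n) (dP1 n) L1 Lf x0).
  have [_ b] := L2_opP n (L2B L1 Lf); apply: (le_trans (ler_wpM2l _ b)) => //.
  by rewrite [leLHS]mulrA; exact: lexx.
(* The identity for the composed operators holds at every n, so a distance that does not depend on n
   is bounded by quantities tending to 0. *)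
have c0 : (fun=> sqnorm p (fun x => S (S f) x - (h x + f x))) @ \oo --> (0 : R).
  apply: (@cvg0_comb _ _ _ 2 2 _ _ kH kP) => [n|n]; first exact: sqnorm_ge0.
  have [L1 _] := L2_opH n Lf; have [L3 _] := L2_opH n L1.
  have [L4 _] := L2_opP n Lf; have [L5 _] := L2_opP n L4.
  rewrite (@eq_sqnorm _ p _ (fun x => (Hn n (Hn n f) x - h x) + (Pn n (Pn n f) x - f x))).
    by apply: sqnormD_le; exact: L2B.
  move=> x x0; rewrite -(opH_opH_opP_opP a_gt0 a_lt (angle_itv R n) Lf x0).
  by rewrite opprD addrACA.
apply: (cvg_unique (@Rhausdorff R) _ c0); exact: cvg_cst.
Qed.

(** The sequence H_n (A f) converges to g in norm and to S (S f) at every point of the half-line;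
    [L2_lim_unique] identifies the two limits. *)
Lemma hlim_opA f g : L2 p f -> hlim (A f) g -> ae_eq mu (@Rpos R) g (S (S f)).
Proof.
move=> Lf [Lg hH _]; have LA := L2_opA Lf.
have [LS _] := L2_opS Lf; have [LSS _] := L2_opS LS.
have h := L2_lim_unique LSS.1 (fun n => (L2_opH n LA).1) Lg _ hH.
have : ae_eq mu (@Rpos R) (S (S f)) g.
  have hpt (x : R) : Rpos x -> Hn n (A f) x @[n --> \oo] --> S (S f) x.
    by rewrite RposE => x0; exact: (opH_opA_cvg a_gt0 a_lt Lf x0).
  by apply: h; apply: ae_imp (ae_neq 0) => x _; exact: hpt.
by move=> E; apply: ae_imp E => x h1 x0; rewrite h1.
Qed.

Lemma sqnorm_opS_le f : L2 p f ->
  sqnorm p (S f) * sin (a * pi) ^+ 2 <= sqnorm p f.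
Proof.
move=> Lf; have [_ h] := L2_opS Lf.
have s0 : 0 < sin (a * pi) ^+ 2 by rewrite exprn_gt0// sin_api_gt0.
by rewrite -ler_pdivlMr// [leRHS]mulrC.
Qed.

(* [cos (2 a pi) = cos^2 - sin^2] and the Stieltjes bound turn the norm identity
   into two-sided estimates with constants 1 and cot^2. *)
Lemma hlim_bounds f g : L2 p f -> hlim f g ->
  (a <= 1 / 4 -> sqnorm p f <= sqnorm p g /\
    sqnorm p g <= cot (pi * a) ^+ 2 * sqnorm p f) /\
  (1 / 4 <= a -> cot (pi * a) ^+ 2 * sqnorm p f <= sqnorm p g /\
    sqnorm p g <= sqnorm p f).
Proof.
move=> Lf hg; rewrite (hlim_sqnorm Lf hg).
have hS := sqnorm_opS_le Lf; have S0 := sqnorm_ge0 p (S f); have f0 := sqnorm_ge0 p f.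
have e : cos (2 * a * pi) = cos (a * pi) ^+ 2 - sin (a * pi) ^+ 2.
  by rewrite -mulrA mulr_natl mulr2n cosD -!expr2.
have s0 := sin_api_gt0 a_gt0 a_lt; have s2 : 0 < sin (a * pi) ^+ 2 by rewrite exprn_gt0.
have pi0 := pi_gt0 R.
have c0 : 0 <= cos (a * pi).
  by apply: cos_ge0_pihalf; apply/andP; split; move: a_gt0 a_lt => ? ?; nra.
have sc := cos2Dsin2 (a * pi).
(* This is cot^2 = 1 + cos (2 a pi) / sin^2, in the shape of the norm identity with the Stieltjes
   bound inserted. *)
have -> : cot (pi * a) ^+ 2 * sqnorm p f =
    sqnorm p f + cos (2 * a * pi) * (sqnorm p f / sin (a * pi) ^+ 2).
  rewrite /cot (mulrC pi) e; field; exact: lt0r_neq0.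
have h : sqnorm p (S f) <= sqnorm p f / sin (a * pi) ^+ 2 by rewrite ler_pdivlMr.
split=> ha.
  have c2 : 0 <= cos (2 * a * pi).
    by apply: cos_ge0_pihalf; apply/andP; split; move: a_gt0 => ?; nra.
  split; first by rewrite lerDl mulr_ge0.
  by rewrite lerD2l ler_wpM2l.
have c2 : cos (2 * a * pi) <= 0.
  have -> : cos (2 * a * pi) = - cos (pi - 2 * a * pi).
    by rewrite cosB cospi sinpi mul0r addr0 mulN1r opprK.
  rewrite oppr_le0; apply: cos_ge0_pihalf; apply/andP.
  by split; move: a_lt => ?; nra.
split; first by rewrite lerD2l ler_wnM2l.
by rewrite gerDl mulr_le0_ge0.
Qed.

Lemma hlim_eq0 f g : L2 p f -> hlim f g -> ae_eq mu (@Rpos R) g (fun=> 0) ->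
  ae_eq mu (@Rpos R) f (fun=> 0).
Proof.
move=> Lf hg g0; have [b1 b2] := hlim_bounds Lf hg.
have ng : sqnorm p g = 0.
  have [Lg _ _] := hg.
  have [_ ->] := ae_L2 (mpos_cst 0) g0 Lg.
  rewrite /sqnorm -[RHS](Ipos0 R); apply: eq_Ipos => x x0.
  by rewrite expr0n mul0r.
apply: (sqnorm_eq0 Lf); apply/eqP; rewrite eq_le sqnorm_ge0 andbT.
have [ha|ha] := leP a (1 / 4); first by have [h _] := b1 ha; rewrite -ng.
have [h _] := b2 (ltW ha).
have ct : 0 < cot (pi * a) ^+ 2.
  rewrite exprn_gt0// divr_gt0// ?[pi * a]mulrC ?sin_api_gt0//.
  by have pi0 := pi_gt0 R; apply: cos_gt0_pihalf; apply/andP; split; move: a_gt0 a_lt => ? ?; nra.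
by rewrite -(pmulr_rle0 _ ct) -ng.
Qed.

End HilbertLimit.

(** * The logarithmic kernel *)

Section LogKernel.
Variable R : realType.
Implicit Types (x y t s q c : R).

(** The logarithm of y^(1/4) is at most y^(1/4). With this exponent the squared logarithm is bounded
    by a multiple of sqrt y, so it has an integrable singularity at 1 / y = 0. *)
Lemma ln_le4 y : 0 < y -> ln y <= 4 * y `^ (1 / 4).
Proof.
move=> y0; have e : ln (y `^ (1 / 4)) = 1 / 4 * ln y by rewrite ln_powR.
have := ln_sublinear (powR_gt0 (1 / 4) y0); rewrite e => h; lra.
Qed.

Lemma ln_le2 y : 0 < y -> ln y <= 2 * y `^ 2^-1.
Proof.
move=> y0; have e : ln (y `^ 2^-1) = 2^-1 * ln y by rewrite ln_powR.
have := ln_sublinear (powR_gt0 2^-1 y0); rewrite e => h; lra.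
Qed.

Lemma mpos_ln_kernel x : mpos (fun t => ln `|1 - x / t|).
Proof.
apply: (@mpos_comp _ (@ln R)); first exact: measurable_ln.
apply: mpos_norm; apply: mposB; first exact: mpos_cst.
by apply: mposM; [exact: mpos_cst|apply: mposV; exact: mpos_id].
Qed.

Lemma mpos_ln1D_kernel x : mpos (fun t => ln (1 + x / t)).
Proof.
apply: (@mpos_comp _ (@ln R)); first exact: measurable_ln.
apply: mposD; first exact: mpos_cst.
by apply: mposM; [exact: mpos_cst|apply: mposV; exact: mpos_id].
Qed.

Let sq_le (u v : R) : 0 <= u <= v -> u ^+ 2 <= v ^+ 2.
Proof. by move=> /andP[u0 uv]; rewrite ler_sqr ?nnegrE// (le_trans u0). Qed.

Lemma L2_scale q (f : R -> R) x : 0 < x -> mpos (fun t => f (t / x)) -> L2 q f ->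
  L2 q (fun t => f (t / x)).
Proof.
move=> x0 mf [_ i]; split=> //.
have E t : 0 < t -> x `^ q * (f t ^+ 2 * t `^ q) = f (x * t / x) ^+ 2 * (x * t) `^ q.
  move=> t0; rewrite powRM ?ltW// (_ : x * t / x = t); first by ring.
  by field; rewrite gt_eqF.
have [] // := @Ipos_scale R x (fun t => f (t / x) ^+ 2 * t `^ q) x0.
- by apply: mposM; [exact: mposX|exact: mpos_powR].
- by move=> t t0; rewrite (mulr_ge0 (sqr_ge0 _) (powR_ge0 _ _)).
- by apply: eq_integ E _; exact: integZl.
Qed.

Lemma L2_ln1D q x : 0 < q < 1 -> 0 < x -> L2 q (fun t => ln (1 + x / t)).
Proof.
move=> /andP[q0 q1] x0.
have L1 : L2 q (fun t => ln (1 + t^-1)).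
  have m1 : mpos (fun t => ln (1 + t^-1)).
    apply: eq_mpos (mpos_ln1D_kernel 1) => t t0; by rewrite mul1r.
  (* For t <= 1 the squared logarithm is at most 4 (1 + 1 / t) <= 8 / t, and for t >= 1 at most 1 /
     t^2; the conditions q > 0 and q < 1 are those of integrability at the two ends. *)
  split=> //; apply: (@integ_powR_le _ _ (q - 1) (q - 2) 8); [lra|lra| | |].
  - by apply: mposM; [exact: mposX|exact: mpos_powR].
  - move=> t /andP[t0 t1]; rewrite ger0_norm ?(mulr_ge0 (sqr_ge0 _) (powR_ge0 _ _))//.
    have v1 : 1 <= t^-1 by rewrite invf_ge1.
    have -> : t `^ (q - 1) = t^-1 * t `^ q.
      by rewrite mulrC -(powR_inv1 (ltW t0)) -powRD_gt0.
    rewrite mulrA ler_wpM2r ?powR_ge0//.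
    have y0 : 0 < 1 + t^-1 by lra.
    have h : 0 <= ln (1 + t^-1) <= 2 * (1 + t^-1) `^ 2^-1.
      by rewrite ln_le2// andbT ln_ge0//; lra.
    apply: (le_trans (sq_le h)); rewrite exprMn powR12_sqrt ?(ltW y0)// sqr_sqrtr ?(ltW y0)//.
    by lra.
  - move=> t t1; rewrite ger0_norm ?(mulr_ge0 (sqr_ge0 _) (powR_ge0 _ _))//; have t0 := lt_le_trans ltr01 t1.
    have v0 : 0 < t^-1 by rewrite invr_gt0.
    have -> : t `^ (q - 2) = t^-1 ^+ 2 * t `^ q.
      rewrite (_ : q - 2 = q + -1 + -1); last by ring.
      by rewrite !(powRD_gt0 _ _ t0) (powR_inv1 (ltW t0)); ring.
    rewrite mulrA ler_wpM2r ?powR_ge0//.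
    have h : 0 <= ln (1 + t^-1) <= t^-1.
      by rewrite le_ln1Dx ?andbT ?ln_ge0//; lra.
    by apply: (le_trans (sq_le h)); have := sqr_ge0 t^-1; lra.
have m := mpos_ln1D_kernel x.
apply: eq_L2 (L2_scale x0 _ L1) => [t _|]; first by rewrite invf_div.
by apply: eq_mpos m => t _; rewrite invf_div.
Qed.

Let integ_near1 : integ (fun t => `|t - 1| `^ (- (1 / 2)) * \1_`[1 / 2, 1[ t) /\
  integ (fun t : R => `|t - 1| `^ (- (1 / 2)) * \1_`]1, 3 / 2] t).
Proof.
have hpos n : 0 < n.+3%:R^-1 :> R by rewrite invr_gt0.
have hle n : n.+3%:R^-1 <= 3^-1 :> R by rewrite lef_pV2 ?posrE// ler_nat.
have hni n : n.+4%:R^-1 <= n.+3%:R^-1 :> R by rewrite lef_pV2 ?posrE// ler_nat.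
have hc : n.+3%:R^-1 @[n --> \oo] --> (0 : R).
  apply: (@cvgn_ext _ (fun n : nat => (n + 2).+1%:R^-1) _ 0) => //.
    by move=> n; rewrite addn2.
  by apply: (@cvgn_addn _ (fun n : nat => n.+1%:R^-1) 0 2); exact: cvg_harmonic.
have arch y : 0 < y -> exists n, n.+3%:R^-1 <= y :> R.
  move=> y0; have [N _ h] : \forall n \near \oo, n.+3%:R^-1 < y by exact: (cvgr_lt 0 hc).
  by exists N; apply: ltW; exact: (h N (leqnn N)).
have cp (y : R) : 0 < y -> derivable (fun y => y `^ (- (1 / 2))) y 1.
  by move=> y0; have [] := @is_derive1_powR R (- (1 / 2)) y y0.
have sq0 : n.+3%:R^-1 `^ (1 / 2) @[n --> \oo] --> (0 : R).
  apply: (@cvgn_ext _ (fun n : nat => (n + 2).+1%:R^-1 `^ (1 / 2)) _ 0) => //.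
    by move=> n; rewrite addn2.
  apply: (@cvgn_addn _ (fun n : nat => n.+1%:R^-1 `^ (1 / 2)) 0 2).
  by apply: powR_cvg0_harmonic; lra.
(* Starting at 1 / 3 keeps the intervals from 1 / 2 to 1 - e n and from 1 + e n to 3 / 2
   nondegenerate. *)
pose e n : R := n.+3%:R^-1.
have dpow (h : R -> R) (c t : R) : is_derive t 1 h c -> 0 < h t -> is_derive t 1
    (fun t => 2 * c * h t `^ (1 / 2)) (c ^+ 2 * h t `^ (- (1 / 2))).
  move=> dh h0; have := is_derive1_powR (1 / 2) h0; rewrite (_ : 1 / 2 - 1 = - (1 / 2)); last by field.
  move=> d1; have := @is_derive1_comp _ (fun y => y `^ (1 / 2)) h t _ _ d1 dh.
  by move=> d2; apply: is_derive_eq; rewrite ?scaler0 ?addr0 ?add0r /GRing.scale /=; field.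
have d1 (t : R) : is_derive t 1 (fun t => 1 - t) (-1) by apply: is_derive_eq; ring.
have d2 (t : R) : is_derive t 1 (fun t => t - 1) 1 by apply: is_derive_eq; ring.
split.
- have [|||||||||i _] := @FTC_exhaust_ge0 R `[1 / 2, 1[%classic (fun=> 1 / 2) (fun n => 1 - e n)
    (fun t => 2 * -1 * (1 - t) `^ (1 / 2)) (fun t => (-1) ^+ 2 * (1 - t) `^ (- (1 / 2)))
    (2 * -1 * (1 - 1 / 2) `^ (1 / 2)) (2 * -1 * 0).
  + by move=> n; have := hle n; rewrite -/(e n) => ?; apply/andP; split; lra.
  + by [].
  + by move=> n; have := hni n; rewrite -/(e n) -/(e n.+1) => ?; lra.
  + apply/seteqP; split=> [t|t [n _]] /=; rewrite !in_itv/=.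
      move=> /andP[t1 t2]; have t3 : 0 < 1 - t by lra.
      have [n] := arch _ t3; rewrite -/(e n) => en.
      by exists n => //=; rewrite in_itv/= t1/=; lra.
    by move=> /andP[-> h] /=; have := hpos n; rewrite -/(e n) => ?; lra.
  + by move=> t /=; rewrite in_itv/= => /andP[_ t1]; apply: dpow; rewrite ?subr_gt0.
  + move=> t /=; rewrite in_itv/= => /andP[_ t1]; apply: derivableM => //.
    have t3 : 0 < 1 - t by rewrite subr_gt0.
    have h3 := is_derive1_powR (- (1 / 2)) t3.
    by have [] := @is_derive1_comp _ (fun y => y `^ (- (1 / 2))) (fun t => 1 - t) t _ _ h3 (d1 t).
  + exact: cvg_cst.
  + apply: cvgM; first exact: cvg_cst.
    by apply: cvgn_ext sq0 => // n; rewrite opprB addrC subrK.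
  + by move=> t _; rewrite mulr_ge0 ?powR_ge0 ?sqr_ge0.
  apply: eq_integ i => t t0; rewrite indicE mem_setE in_itv/=.
  have [/andP[_ t1]|h] := boolP (1 / 2 <= t < 1); last by rewrite !mulr0.
  have -> : `|t - 1| = 1 - t by rewrite distrC gtr0_norm// subr_gt0.
  by congr (_ * _); ring.
- have [|||||||||i _] := @FTC_exhaust_ge0 R `]1, 3 / 2]%classic (fun n => 1 + e n) (fun=> 3 / 2)
    (fun t => 2 * 1 * (t - 1) `^ (1 / 2)) (fun t => 1 ^+ 2 * (t - 1) `^ (- (1 / 2)))
    (2 * 1 * 0) (2 * 1 * (3 / 2 - 1) `^ (1 / 2)).
  + by move=> n; have := hle n; have := hpos n; rewrite -/(e n) => ? ?; apply/andP; split; lra.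
  + by move=> n; have := hni n; rewrite -/(e n) -/(e n.+1) => ?; lra.
  + by [].
  + apply/seteqP; split=> [t|t [n _]] /=; rewrite !in_itv/=.
      move=> /andP[t1 t2]; have t3 : 0 < t - 1 by lra.
      have [n] := arch _ t3; rewrite -/(e n) => en.
      by exists n => //=; rewrite in_itv/= t2 andbT; lra.
    by move=> /andP[h ->]; rewrite andbT; have := hpos n; rewrite -/(e n) => ?; lra.
  + by move=> t /=; rewrite in_itv/= => /andP[t1 _]; apply: dpow; rewrite ?subr_gt0.
  + move=> t /=; rewrite in_itv/= => /andP[t1 _]; apply: derivableM => //.
    have t3 : 0 < t - 1 by rewrite subr_gt0.
    have h3 := is_derive1_powR (- (1 / 2)) t3.
    by have [] := @is_derive1_comp _ (fun y => y `^ (- (1 / 2))) (fun t => t - 1) t _ _ h3 (d2 t).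
  + apply: cvgM; first exact: cvg_cst.
    by apply: cvgn_ext sq0 => // n; rewrite addrC addKr.
  + exact: cvg_cst.
  + by move=> t _; rewrite mulr_ge0 ?powR_ge0 ?sqr_ge0.
  apply: eq_integ i => t t0; rewrite indicE mem_setE in_itv/=.
  have [/andP[t1 _]|h] := boolP (1 < t <= 3 / 2); last by rewrite !mulr0.
  by rewrite gtr0_norm ?subr_gt0// expr1n mul1r.
Qed.

Let norm_ln_le4 (u : R) : 0 < u <= 1 -> ln u ^+ 2 <= 16 * u `^ (- (1 / 2)).
Proof.
move=> /andP[u0 u1]; have v0 : 0 < u^-1 by rewrite invr_gt0.
have h : 0 <= - ln u <= 4 * u^-1 `^ (1 / 4).
  by rewrite -lnV ?posrE// ln_le4// andbT ln_ge0// invf_ge1.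
rewrite -sqrrN; apply: (le_trans (sq_le h)); rewrite exprMn.
rewrite (_ : 4 ^+ 2 = 16); last by ring.
rewrite ler_wpM2l// -powR_inv1 ?(ltW u0)// -powRrM expr2 -powRD_gt0//.
by rewrite (_ : -1 * (1 / 4) + -1 * (1 / 4) = - (1 / 2))//; field.
Qed.

(** By scaling x = 1. The squared logarithm is at most a multiple of |t - 1|^(-1/2) on the window,
    of t^(-1/2) near 0 and of t^(-2) near infinity, where q < 1 makes t^(q - 2) integrable. *)
Lemma L2_ln_kernel q x : 0 < q < 1 -> 0 < x -> L2 q (fun t => ln `|1 - x / t|).
Proof.
move=> /andP[q0 q1] x0.
pose l t := ln `|1 - t^-1| : R.
have m1 : mpos l by apply: eq_mpos (mpos_ln_kernel 1) => t t0; rewrite mul1r.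
have lE t : 0 < t -> l t = ln (`|t - 1| / t).
  move=> t0; rewrite /l (_ : 1 - t^-1 = (t - 1) / t); last by field; rewrite gt_eqF.
  by rewrite normrM normfV (gtr0_norm t0).
pose N : set R := `[1 / 2, 3 / 2]%classic.
pose f t := l t ^+ 2 * t `^ q.
have mf : mpos f by apply: mposM; [exact: mposX|exact: mpos_powR].
have mN : mpos (\1_N : R -> R) by apply: mpos_indic; exact: measurable_itv.
have NE t : \1_N t = (1 / 2 <= t <= 3 / 2)%R%:R :> R by rewrite indicE mem_setE in_itv.
have f0 t : 0 <= f t := sqw_ge0 _ _ _.
have L1 : L2 q l.
  split=> //; rewrite -/f.
  have i1 : integ (fun t => f t * \1_N t).
    have [j1 j2] := integ_near1.
    (* The constant is 16 * 2 * 2: on the window both t^q and t^(1/2) are at most 2. *)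
    apply: (le_integ (g := _)) (integZl 64 (integD j1 j2)); first exact: mposM.
    move=> t t0; rewrite NE; have [/andP[t1 t2]|h] := boolP (1 / 2 <= t <= 3 / 2); last first.
      rewrite mulr0 normr0 mulr_ge0// addr_ge0// mulr_ge0 ?powR_ge0//.
    rewrite mulr1 ger0_norm//; have [->|tn] := eqVneq t 1.
      rewrite /f /l invr1 subrr normr0 ln0// expr0n mul0r.
      by rewrite mulr_ge0// addr_ge0// mulr_ge0 ?powR_ge0.
    have -> : \1_`[1 / 2, 1[ t = (t < 1)%R%:R :> R by rewrite indicE mem_setE in_itv/= t1.
    have -> : \1_`]1, 3 / 2] t = (1 < t)%R%:R :> R by rewrite indicE mem_setE in_itv/= t2 andbT.
    rewrite -mulrDr (_ : (t < 1)%R%:R + (1 < t)%R%:R = 1 :> R); last first.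
      by case: ltgtP tn => // _ _; rewrite ?addr0 ?add0r.
    have d0 : 0 < `|t - 1| by rewrite normr_gt0 subr_eq0.
    have d1 : `|t - 1| <= 1 / 2 by rewrite ler_norml; lra.
    have u1 : 0 < `|t - 1| / t <= 1.
      by rewrite divr_gt0//= ler_pdivrMr//; lra.
    rewrite mulr1 /f lE// (_ : 64 = 16 * 4); last by ring.
    apply: (@le_trans _ _ (16 * (`|t - 1| / t) `^ (- (1 / 2)) * 2)).
      apply: ler_pM; rewrite ?sqr_ge0 ?powR_ge0 ?norm_ln_le4//.
      apply: (@le_trans _ _ ((3 / 2) `^ q)).
        by apply: ge0_ler_powR; rewrite ?nnegrE//; lra.
      apply: (@le_trans _ _ (3 / 2)); last lra.
      by apply: ler1_powR; lra.
    rewrite powRM ?invr_ge0 ?(ltW d0) ?(ltW t0)//.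
    have h : t^-1 `^ (- (1 / 2)) <= 2.
      rewrite -(powR_inv1 (ltW t0)) -powRrM mulN1r opprK.
      apply: (@le_trans _ _ ((3 / 2) `^ (1 / 2))).
        by apply: ge0_ler_powR; rewrite ?nnegrE//; lra.
      apply: (@le_trans _ _ (3 / 2)); last lra.
      by apply: ler1_powR; lra.
    have := ler_wpM2l (powR_ge0 `|t - 1| (- (1 / 2))) h; lra.
  have i2 : integ (fun t => f t * (1 - \1_N t)).
    (* Near 0, [ln_le4] gives 16 t^(-1/2); for t > 3 / 2 the logarithm is at most 3 / t in absolute
       value, which gives 9 t^(q - 2). *)
    apply: (@integ_powR_le _ _ (- (1 / 2)) (q - 2) 16); [lra|lra| | |].
    - by apply: mposM => //; apply: mposB => //; exact: mpos_cst.
    - move=> t /andP[t0 t1]; rewrite NE.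
      have [h|h] := boolP (1 / 2 <= t <= 3 / 2).
        by rewrite subrr mulr0 normr0 mulr_ge0 ?powR_ge0.
      have t2 : t < 1 / 2 by rewrite ltNge; apply: contra h => h; apply/andP; split; lra.
      rewrite subr0 mulr1 ger0_norm// /f lE// ltr0_norm; last by lra.
      have v0 : 0 < t^-1 by rewrite invr_gt0.
      have tv : t * t^-1 = 1 by rewrite divff ?gt_eqF.
      have v1 : 1 <= - (t - 1) / t <= t^-1.
        rewrite ler_pdivlMr// mul1r; apply/andP; split; first lra.
        by rewrite opprB mulrBl mul1r tv; lra.
      have h1 : 0 <= ln (- (t - 1) / t) <= 4 * t^-1 `^ (1 / 4).
        have /andP[v2 v3] := v1.
        rewrite ln_ge0//= (le_trans _ (ln_le4 v0))// ler_ln ?posrE//.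
        exact: lt_le_trans v2.
      apply: (@le_trans _ _ ((4 * t^-1 `^ (1 / 4)) ^+ 2 * 1)).
        apply: ler_pM; rewrite ?sqr_ge0 ?powR_ge0 ?sq_le//.
        by rewrite -(powRr0 t) ger_powR ?t0// ltW.
      rewrite mulr1 exprMn (_ : 4 ^+ 2 = 16); last by ring.
      rewrite ler_wpM2l// -powR_inv1 ?(ltW t0)// -powRrM expr2 -powRD_gt0//.
      by rewrite (_ : -1 * (1 / 4) + -1 * (1 / 4) = - (1 / 2))//; field.
    - move=> t t1; have t0 := lt_le_trans ltr01 t1; rewrite NE.
      have [h|h] := boolP (1 / 2 <= t <= 3 / 2).
        by rewrite subrr mulr0 normr0 mulr_ge0 ?powR_ge0.
      have t2 : 3 / 2 < t by rewrite ltNge; apply: contra h => h; apply/andP; split; lra.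
      rewrite subr0 mulr1 ger0_norm// /f lE// gtr0_norm; last by lra.
      have v0 : 0 < t^-1 by rewrite invr_gt0.
      have -> : t `^ (q - 2) = t^-1 ^+ 2 * t `^ q.
        rewrite (_ : q - 2 = q + -1 + -1); last by ring.
        by rewrite !(powRD_gt0 _ _ t0) (powR_inv1 (ltW t0)); ring.
      rewrite mulrA ler_wpM2r ?powR_ge0//.
      have w0 : 0 < (t - 1) / t by rewrite divr_gt0//; lra.
      have h1 : 0 <= - ln ((t - 1) / t) <= 3 * t^-1.
        rewrite -lnV ?posrE// invf_div.
        have e : t / (t - 1) = 1 + (t - 1)^-1 by field; rewrite gt_eqF//; lra.
        have k0 : 0 < (t - 1)^-1 by rewrite invr_gt0; lra.
        rewrite e ln_ge0 ?lerDl ?(ltW k0)//=.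
        apply: (le_trans (le_ln1Dx _)); first by lra.
        by rewrite -[3 * _]/(3 / t) ler_pdivlMr// mulrC ler_pdivrMr//; lra.
      rewrite -sqrrN; apply: (le_trans (sq_le h1)); rewrite exprMn.
      by have := sqr_ge0 t^-1; lra.
  by apply: eq_integ (integD i1 i2) => t t0; ring.
apply: eq_L2 (L2_scale x0 _ L1) => [t _|]; first by rewrite /l invf_div.
by apply: eq_mpos (mpos_ln_kernel x) => t _; rewrite /l invf_div.
Qed.

End LogKernel.

(** * Inversion and the logarithmic potential *)

Section Inversion.
Variables (R : realType) (a : R).
Hypotheses (a_gt0 : 0 < a) (a_lt : a < 1 / 2).
Implicit Types (x s t c phi : R) (f g h u : R -> R).
Local Notation mu := (@lebesgue_measure R).
Local Notation p := (2 * a - 1).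
Local Notation Hn n := (op (kerH (angle R n))).
Local Notation Pn n := (op (kerP (angle R n))).
Local Notation S := (op (@kerS R)).
Local Notation A := (op (@kerA R)).
Local Notation hlim := (hlim a).

Lemma hlim_right_inverse f g k : L2 p f -> hlim f g ->
  hlim (fun x => A f x - g x) k -> ae_eq mu (@Rpos R) k f.
Proof.
move=> Lf hg hk; have LA := L2_opA a_gt0 a_lt Lf; have [Lg _ _] := hg.
have [u hu] := hlim_exists a_gt0 a_lt LA.
have [v hv] := hlim_exists a_gt0 a_lt Lg.
have H := hlim_lin a_gt0 a_lt (-1) Lg LA hv hu.
have e (w z : R -> R) x : -1 * w x + z x = z x - w x by ring.
have h1 : ae_eq mu (@Rpos R) k (fun x => u x - v x).
  apply: (hlim_unique a_gt0 a_lt (L2B LA Lg) hk).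
  by move: H; under eq_fun do rewrite e; under [X in hlim _ X]eq_fun do rewrite e.
have h2 := hlim_opA a_gt0 a_lt Lf hu.
have h3 := hlim_hlim a_gt0 a_lt Lf hg hv.
have h4 : ae_eq mu (@Rpos R) k (fun x => S (S f) x - v x).
  by apply: ae_imp2 h1 h2 => x h1 h2 x0; rewrite h1// h2.
by apply: ae_imp2 h4 h3 => x h4 h3 x0; rewrite h4// -h3// addrC addKr.
Qed.

(** With g = H f, the right inverse gives H ((A - H) g) = g = H f, and injectivity cancels H. *)
Lemma hlim_left_inverse f g h : L2 p f -> hlim f g -> hlim g h ->
  ae_eq mu (@Rpos R) f (fun x => A g x - h x).
Proof.
move=> Lf hg hh; have [Lg _ _] := hg; have [Lh _ _] := hh.
have LA := L2_opA a_gt0 a_lt Lg; have Lw := L2B LA Lh.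
have [k hk] := hlim_exists a_gt0 a_lt Lw.
have kg := hlim_right_inverse Lg hh hk.
have H := hlim_lin a_gt0 a_lt (-1) Lw Lf hk hg.
have z : ae_eq mu (@Rpos R) (fun x => -1 * k x + g x) (fun=> 0).
  by apply: ae_imp kg => x e x0; rewrite e// mulN1r addNr.
have := hlim_eq0 a_gt0 a_lt (L2D (L2Z (-1) Lw) Lf) H z.
apply: ae_imp => x e x0; have := e x0.
by move=> /eqP; rewrite mulN1r addrC subr_eq0 => /eqP.
Qed.

Lemma hlim_ae f f' g : L2 p f -> mpos f' -> ae_eq mu (@Rpos R) f f' -> hlim f g -> hlim f' g.
Proof.
move=> Lf mf' ff' [Lg h1 h2].
have eH n x : 0 < x -> Hn n f x = Hn n f' x.
  by move=> x0; exact: (ae_op (dominated_kerH (angle_itv R n)) mf' Lf x0).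
have eP n x : 0 < x -> Pn n f x = Pn n f' x.
  by move=> x0; exact: (ae_op (dominated_kerP (angle_itv R n)) mf' Lf x0).
have [Lf' _] := ae_L2 mf' ff' Lf.
split; first exact: Lg.
  apply: (cvgn_ext _ erefl h1) => n; apply: eq_sqnorm => x x0; by rewrite eH.
apply: (cvgn_ext _ erefl h2) => n.
have LP := (L2_opP a_gt0 a_lt n Lf).1.
have LP' := (L2_opP a_gt0 a_lt n Lf').1.
have m : mpos (fun x => Pn n f' x - f' x) by apply: mposB => //; exact: LP'.1.
have e : ae_eq mu (@Rpos R) (fun x => Pn n f x - f x) (fun x => Pn n f' x - f' x).
  have st (x : R) : (Rpos x -> f x = f' x) -> Rpos x -> Pn n f x - f x = Pn n f' x - f' x.
    by move=> e; rewrite RposE => x0; rewrite eP// e ?RposE.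
  exact: ae_imp st ff'.
by have [_ ->] := ae_L2 m e (L2B LP Lf).
Qed.

Lemma L2_itv0 x : 0 < x -> L2 (- p) (\1_`]0, x] : R -> R).
Proof.
move=> x_gt0; have q0 : 0 < - p by move: a_gt0 a_lt => ? ?; lra.
have m : mpos (\1_`]0, x] : R -> R) by apply: mpos_indic; exact: measurable_itv.
split=> //.
have i : integ (\1_`]0, x] : R -> R).
  have h0 : -1 < (0 : R) by lra.
  have i0 := integ_powR_near0 h0.
  have [] // := @Ipos_scale R x (\1_`]0, x]) x_gt0 m _ _.
  apply: eq_integ i0 => t t0; rewrite powRr0 mul1r !indicE !mem_setE !in_itv/=.
  by rewrite t0 pmulr_rgt0// t0 -{2}[x]mulr1 ler_pM2l.
apply: (le_integ (g := _)) (integZl (x `^ (- p)) i).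
  by apply: mposM; [exact: mposX|exact: mpos_powR].
move=> s s0; rewrite ger0_norm ?(mulr_ge0 (sqr_ge0 _) (powR_ge0 _ _))//.
rewrite indicE mem_setE in_itv/= s0/=.
have [sx|sx] := leP s x; last by rewrite expr0n mul0r mulr0.
by rewrite expr1n mul1r mulr1; apply: ge0_ler_powR; rewrite ?nnegrE ?(ltW q0) ?(ltW s0) ?(ltW x_gt0).
Qed.

(** * The pairing with the indicator of an initial interval *)

Section LogPotential.
Variables (f g : R -> R) (x : R).
Hypotheses (Lf : L2 p f) (fg : hlim f g) (x_gt0 : 0 < x).

Let q := 1 - 2 * a.
Let qE : - p = q. Proof. by rewrite /q; ring. Qed.
Let q01 : 0 < q < 1.
Proof. by rewrite /q; move: a_gt0 a_lt => ? ?; apply/andP; split; lra. Qed.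

Let ind s : R := \1_`]0, x] s.

Let Lind : L2 (- p) ind := L2_itv0 x_gt0.

Let dS := dominating_kerS a_gt0 a_lt.

Let G (K : R -> R -> R) t := Ipos (fun s => ind s * K s t).

Let pairK K c : dominated (@kerS R) c K ->
  (forall t, 0 < t -> integ (fun s => ind s * K s t)) /\
  (integ (fun t => f t * G K t) /\
   Ipos (fun s => ind s * op K f s) = pi^-1 * Ipos (fun t => f t * G K t)).
Proof.
move=> dK.
have i12 t : 0 < t -> integ (fun s => ind s * K s t).
  move=> t0; have [i _] := pairing_cs (dominated_L2l a_gt0 a_lt dK t0) Lind.
  by apply: eq_integ i => s s0; rewrite mulrC.
split=> //; apply: (@op_op R p _ c _ (fun _ => ind) K f 1 dS dK _ ltr01 Lind i12 Lf).
exact: mpos2_snd Lind.1.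
Qed.

(** Half the logarithmic derivative of [den] in the output variable s. The kernel [kerH] alone does
    not have this form; the combination cos phi H_phi + sin phi P_phi does. It tends to - H, which
    is the origin of the minus sign in the logarithmic formula. *)
Let qker phi t s := (t * cos phi + s) / den phi s t.

Let cos_kerH phi s t : 0 <= phi < pi -> 0 < s -> 0 < t ->
  qker phi t s = cos phi * kerH phi s t + sin phi * kerP phi s t.
Proof.
move=> hp s0 t0; rewrite /qker /kerH /kerP.
have d0 := den_gt0 hp s0 t0; have e := cos2Dsin2 phi.
transitivity ((t * cos phi + s * (cos phi ^+ 2 + sin phi ^+ 2)) / den phi s t).
  by rewrite e mulr1.
by field; rewrite gt_eqF.
Qed.

(** The logarithm of |1 + (x / t) e^(i phi)|. *)
Let lnr phi t := (ln (den phi x t) - ln (t ^+ 2)) / 2.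

Let log_kernel phi t : 0 <= phi < pi -> 0 < t ->
  cos phi * G (kerH phi) t + sin phi * G (kerP phi) t = lnr phi t.
Proof.
move=> hp t0.
have [iH _] := pairK (dominated_kerH hp); have [iP _] := pairK (dominated_kerP hp).
rewrite /G -!IposZl; [|exact: iP|exact: iH].
rewrite -IposD; [|by apply: integZl; exact: iH|by apply: integZl; exact: iP].
have E s : 0 < s -> qker phi t s * \1_`]0, x] s =
    cos phi * (ind s * kerH phi s t) + sin phi * (ind s * kerP phi s t).
  by move=> s0; rewrite cos_kerH//; rewrite /ind; ring.
rewrite -(eq_Ipos E).
have iq : integ (fun s => qker phi t s * \1_`]0, x] s).
  apply: (@eq_integ _ (fun s => cos phi * (ind s * kerH phi s t) +
    sin phi * (ind s * kerP phi s t))); first by move=> s s0; rewrite E.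
  by apply: integD; apply: integZl; [exact: iH|exact: iP].
have t20 : 0 < t ^+ 2 by exact: exprn_gt0.
have dd s : is_derive s 1 (fun s => den phi s t) (2 * (t * cos phi + s)).
  have := is_derive_den phi t s => d.
  rewrite (_ : (fun s => den phi s t) = den phi t); last first.
    by apply/funext => y; rewrite denC.
  by apply: is_derive_eq; ring.
have hx n : 0 < x / n.+2%:R by rewrite divr_gt0.
have h1 n : 0 < x / n.+2%:R < x.
  by rewrite hx/= gtr_pMr// invf_lt1// ltr1n.
have h2 n : x / n.+3%:R <= x / n.+2%:R by rewrite ler_pM2l// lef_pV2 ?posrE// ler_nat.
have h3 : `]0, x]%classic = \bigcup_n `[x / n.+2%:R, x]%classic.
  apply/seteqP; split=> [s|s [n _]] /=; rewrite !in_itv/=.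
    move=> /andP[s0 sx].
    have [N _ h] : \forall n \near \oo, x / s < n%:R by exact: nbhs_infty_gtr.
    exists N => //=; rewrite in_itv/= sx andbT ler_pdivrMr// mulrC -ler_pdivrMr//.
    by apply: (le_trans (ltW (h N (leqnn N)))); rewrite ler_nat -addn2 leq_addr.
  by move=> /andP[h ->]; rewrite andbT; exact: lt_le_trans h.
have h4 s : `]0, x]%classic s -> is_derive s 1 (fun s => ln (den phi s t) / 2) (qker phi t s).
  rewrite /= in_itv/= => /andP[s0 _]; have d0 := den_gt0 hp s0 t0.
  have := @is_derive1_comp _ (@ln R) (fun s => den phi s t) s _ _ (is_derive1_ln d0) (dd s).
  move=> h; apply: is_derive_eq; rewrite /GRing.scale /= /qker.
  by field; rewrite gt_eqF.
have h5 s : `]0, x]%classic s -> derivable (qker phi t) s 1.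
  rewrite /= in_itv/= => /andP[s0 _]; have d0 := den_gt0 hp s0 t0.
  apply: derivableM; first by apply: derivableD; [exact: derivable_cst|exact: derivable_id].
  apply: derivableV; first by rewrite gt_eqF.
  by have [] := dd s.
have h6 : ln (den phi (x / n.+2%:R) t) / 2 @[n --> \oo] --> ln (t ^+ 2) / 2.
  apply: cvgM; last exact: cvg_cst; apply: (@cvgn_comp _ (@ln R)).
    exact: continuous_ln.
  have e0 : t ^+ 2 = t ^+ 2 + 2 * t * 0 * cos phi + 0 ^+ 2 by ring.
  have x0 : x / n.+2%:R @[n --> \oo] --> (0 : R).
    rewrite -[X in _ --> X](mulr0 x); apply: cvgM; first exact: cvg_cst.
    apply: (@cvgn_ext _ (fun n : nat => (n + 1).+1%:R^-1) _ 0) => //.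
      by move=> n; rewrite addn1.
    by apply: (@cvgn_addn _ (fun n : nat => n.+1%:R^-1) 0 1); exact: cvg_harmonic.
  rewrite [X in _ --> X]e0; apply: cvgD; last first.
    by apply: cvgM; exact: x0.
  apply: cvgD; first exact: cvg_cst.
  apply: cvgM; last exact: cvg_cst.
  by apply: cvgM; [exact: cvg_cst|exact: x0].
have h7 : (fun=> ln (den phi x t) / 2) @ \oo --> ln (den phi x t) / 2 by exact: cvg_cst.
rewrite (@FTC_exhaust_dct R `]0, x]%classic (fun n => x / n.+2%:R) (fun=> x)
  (fun s => ln (den phi s t) / 2) (qker phi t) _ _ h1 h2 (fun _ => lexx x) h3 h4 h5 h6 h7 iq).
by rewrite /lnr mulrBl.
Qed.

Let logk t := ln `|1 - x / t|.
(** The modulus |1 + (x / t) e^(i phi)| lies between |1 - x / t| and 1 + x / t for every phi, so the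
    two extreme logarithms dominate [lnr]. *)
Let dom t := `|logk t| + ln (1 + x / t).

Let Ldom : L2 (- p) dom.
Proof.
rewrite qE; apply: L2D; last exact: L2_ln1D q01 x_gt0.
by apply: L2_norm; exact: L2_ln_kernel q01 x_gt0.
Qed.

Let lnr_den phi t : 0 <= phi < pi -> 0 < t -> lnr phi t = ln (den phi x t / t ^+ 2) / 2.
Proof.
move=> hp t0; rewrite /lnr; congr (_ / _).
have d0 := den_gt0 hp x_gt0 t0; have t20 : 0 < t ^+ 2 by exact: exprn_gt0.
by rewrite lnM ?posrE ?invr_gt0// lnV ?posrE.
Qed.

Let lnX2 (y : R) : 0 < y -> ln (y ^+ 2) / 2 = ln y.
Proof. by move=> y0; rewrite expr2 lnM ?posrE//; field. Qed.

Let lnr_bound phi t : 0 <= phi < pi -> 0 < t -> t != x -> `|lnr phi t| <= dom t.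
Proof.
move=> hp t0 tx; rewrite lnr_den//.
have d0 := den_gt0 hp x_gt0 t0; have t20 : 0 < t ^+ 2 by exact: exprn_gt0.
have y1 : 0 < `|1 - x / t|.
  rewrite (_ : 1 - x / t = (t - x) / t); last by field; rewrite gt_eqF.
  by rewrite normr_gt0 mulf_neq0 ?subr_eq0// invr_eq0 gt_eqF.
have y2 : 0 < 1 + x / t by rewrite addr_gt0// divr_gt0.
have b1 : `|1 - x / t| ^+ 2 <= den phi x t / t ^+ 2.
  rewrite real_normK ?num_real// ler_pdivlMr// -exprMn mulrBl mul1r divfK ?gt_eqF//.
  exact: sqr_sub_le_den.
have b2 : den phi x t / t ^+ 2 <= (1 + x / t) ^+ 2.
  rewrite ler_pdivrMr// -exprMn mulrDl mul1r divfK ?gt_eqF//.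
  have := cos_le1 phi; have xt := mulr_gt0 x_gt0 t0.
  by rewrite /den; move: (cos _) => c c1; nra.
have dt0 : 0 < den phi x t / t ^+ 2 by rewrite divr_gt0.
have l1 : ln `|1 - x / t| <= ln (den phi x t / t ^+ 2) / 2.
  by rewrite -lnX2// ler_pM2r// ler_ln ?posrE ?exprn_gt0.
have l2 : ln (den phi x t / t ^+ 2) / 2 <= ln (1 + x / t).
  by rewrite -(lnX2 y2) ler_pM2r// ler_ln ?posrE ?exprn_gt0.
have l3 : 0 <= ln (1 + x / t) by rewrite ln_ge0// lerDl divr_ge0// ltW.
rewrite /dom /logk; move: (ln `|_|) l1 => u l1.
have u1 := ler_norm u; have u2 : - u <= `|u| by rewrite -normrN ler_norm.
by rewrite ler_norml; apply/andP; split; lra.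
Qed.

Let lnr_cvg t : 0 < t -> t != x -> lnr (angle R n) t @[n --> \oo] --> logk t.
Proof.
move=> t0 tx; have t20 : 0 < t ^+ 2 by exact: exprn_gt0.
have y1 : 0 < `|1 - x / t|.
  rewrite (_ : 1 - x / t = (t - x) / t); last by field; rewrite gt_eqF.
  by rewrite normr_gt0 mulf_neq0 ?subr_eq0// invr_eq0 gt_eqF.
apply: (@cvgn_ext _ (fun n => ln (den (angle R n) x t / t ^+ 2) / 2) _
  (ln ((t - x) ^+ 2 / t ^+ 2) / 2)).
- by move=> n; rewrite lnr_den//; exact: angle_itv.
- rewrite /logk -(lnX2 y1) real_normK ?num_real//; congr (ln _ / _).
  by field; rewrite gt_eqF.
apply: cvgM; last exact: cvg_cst; apply: (@cvgn_comp _ (@ln R)).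
  apply: continuous_ln; rewrite divr_gt0// exprn_even_gt0//= subr_eq0//.
by apply: cvgM; [exact: cvg_den|exact: cvg_cst].
Qed.

(** Two limits of the integrals of f against [lnr] are compared: norm convergence of H_n f and P_n
    f, paired with the indicator, gives the right side, and dominated convergence gives the left
    side. *)
Lemma log_formula : integ (fun t => logk t * f t) /\
  Ipos (fun t => logk t * f t) = - pi * Ipos (fun s => g s * \1_`]0, x] s).
Proof.
have mlog : mpos logk := mpos_ln_kernel x.
have Llog : L2 (- p) logk by rewrite qE; exact: L2_ln_kernel q01 x_gt0.
have i : integ (fun t => logk t * f t).
  by have [i _] := pairing_cs Lf Llog; apply: eq_integ i => t t0; rewrite mulrC.
split=> //; have [Lg gH gP] := fg.
have cH : Ipos (fun s => ind s * Hn n f s) @[n --> \oo] --> Ipos (fun s => g s * ind s).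
  apply: cvgn_ext (pairing_cvg (fun n => (L2_opH a_gt0 a_lt n Lf).1) Lg Lind gH) => // n.
  by apply: eq_Ipos => s s0; rewrite mulrC.
have cP : Ipos (fun s => ind s * Pn n f s) @[n --> \oo] --> Ipos (fun s => f s * ind s).
  apply: cvgn_ext (pairing_cvg (fun n => (L2_opP a_gt0 a_lt n Lf).1) Lf Lind gP) => // n.
  by apply: eq_Ipos => s s0; rewrite mulrC.
have E n : Ipos (fun t => f t * lnr (angle R n) t) =
    cos (angle R n) * (pi * Ipos (fun s => ind s * Hn n f s)) +
    sin (angle R n) * (pi * Ipos (fun s => ind s * Pn n f s)).
  have hp := angle_itv R n.
  have [_ [iH eH]] := pairK (dominated_kerH hp); have [_ [iP eP]] := pairK (dominated_kerP hp).
  have p0 : pi != 0 :> R by rewrite lt0r_neq0 ?pi_gt0.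
  rewrite eH eP !(mulVKf p0) -(IposZl _ iH) -(IposZl _ iP) -IposD; [|exact: integZl iH|exact: integZl iP].
  by apply: eq_Ipos => t t0; rewrite -(log_kernel hp t0) mulrDr !(mulrCA (f t)).
have c1 : Ipos (fun t => f t * lnr (angle R n) t) @[n --> \oo] -->
    - pi * Ipos (fun s => g s * ind s).
  apply: (cvgn_ext E (l' := - pi * Ipos (fun s => g s * ind s)) _ _); last first.
    apply: cvgD; apply: cvgM.
    - exact: cos_angle_cvg.
    - by apply: cvgM cH; exact: cvg_cst.
    - exact: sin_angle_cvg.
    - by apply: cvgM cP; exact: cvg_cst.
  by rewrite mul0r addr0; ring.
(* At t = x the regularised logarithms diverge, whereas [logk x] is ln 0 with default value 0;
   annihilating f at this single point makes the integrands converge everywhere. *)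
pose f0 t := if t == x then 0 else f t.
have ff0 : ae_eq mu (@Rpos R) f f0.
  by apply: ae_imp (ae_neq x) => t tx t0; rewrite /f0 (negbTE tx).
have mf0 : mpos f0.
  apply: (@eq_mpos _ (fun t => f t * (1 - \1_[set x] t))).
    move=> t t0; rewrite /f0 indicE; have [->|tx] := eqVneq t x.
      by rewrite mem_set//= subrr mulr0.
    by rewrite memNset ?subr0 ?mulr1//=; apply/eqP.
  apply: mposM Lf.1 _; apply: mposB; first exact: mpos_cst.
  by apply: mpos_indic; exact: measurable_set1.
have mlnr n : mpos (lnr (angle R n)).
  apply: mposM; last exact: mpos_cst; apply: mposB; apply: (@mpos_comp _ (@ln R)) => //.
    exact: mpos2_mposr (@mpos2_den R _) x_gt0.
  by apply: mposX; exact: mpos_id.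
have c2 : Ipos (fun t => f t * lnr (angle R n) t) @[n --> \oo] --> Ipos (fun t => logk t * f t).
  have [Lf0 _] := ae_L2 mf0 ff0 Lf.
  have D : integ (fun t => f0 t * logk t) /\
     Ipos (fun t => f0 t * lnr (angle R n) t) @[n --> \oo] --> Ipos (fun t => f0 t * logk t).
    apply: (@Ipos_dct _ _ _ (fun t => `|f0 t| * dom t)).
    - by move=> n; exact: mposM.
    - move=> t t0; have [->|tx] := eqVneq t x.
        apply: (@cvgn_ext _ (fun=> 0) _ 0); last exact: cvg_cst.
          by move=> n; rewrite /f0 eqxx mul0r.
        by rewrite /f0 eqxx mul0r.
      by apply: cvgM; [exact: cvg_cst|exact: lnr_cvg].
    - move=> n t t0; rewrite normrM; have [->|tx] := eqVneq t x.
        by rewrite /f0 eqxx normr0 !mul0r.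
      by rewrite ler_wpM2l// lnr_bound// angle_itv.
    - by have [] := pairing_cs (L2_norm Lf0) Ldom.
  apply: cvgn_ext D.2.
    move=> n; apply: ae_Ipos; try by apply: mposM => //; exact: Lf.1.
    by apply: ae_imp ff0 => t e t0; rewrite e.
  apply: ae_Ipos; [exact: mposM|by apply: mposM => //; exact: Lf.1|].
  by apply: ae_imp ff0 => t e t0; rewrite e// mulrC.
by rewrite (cvg_unique _ c2 c1).
Qed.

End LogPotential.

(** By [log_formula] the potential is - pi times the integral of g from 0 to x, to which Lebesgue's
    differentiation theorem applies. The identity holds for positive arguments only, hence the
    comparison of the two functions near x. *)
Lemma log_potential_derive f g : L2 p f -> hlim f g ->
  {ae mu, forall x : R, 0 < x ->
    is_derive x 1 (fun x => Ipos (fun t => ln `|1 - x / t| * f t)) (- pi * g x)}.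
Proof.
move=> Lf fg; have [Lg _ _] := fg.
pose g0 : R -> R := g \_ (@Rpos R).
have ig y : 0 < y -> integ (fun s => g s * \1_`]0, y] s).
  by move=> y0; have [i _] := pairing_cs Lg (L2_itv0 y0).
have sub y : `]0, y]%classic `<=` @Rpos R.
  by move=> s /=; rewrite in_itv/= RposE => /andP[].
have ind1 y s : s \in (`]0, y]%classic : set R) -> \1_`]0, y] s = 1 :> R.
  by rewrite indicE => ->.
have ig0 y : mu.-integrable `]0, y] (EFin \o g0).
  have [y0|y0] := leP y 0.
    by rewrite set_itv_ge ?bnd_simp -?leNgt//; exact: integrable_set0.
  apply: eq_integrable (integrableS (@measurable_Rpos R) _ (sub y) (ig y y0)) => //.
  move=> s sy /=; rewrite ind1// mulr1 /g0 patchE mem_set//.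
  by apply: sub; exact: set_mem sy.
(* Integrability up to 0 holds because the indicator of a bounded initial interval belongs to the
   dual space [L2 (- p)]. *)
have locg : locally_integrable [set: R] g0.
  split; [|exact: openT|move=> K _ cK].
    exact: ((@measurable_restrictT _ _ _ _ (@Rpos R) g (@measurable_Rpos R)).1 Lg.1).
  have [N0 [_ hN]] := compact_bounded cK.
  pose N := Num.max N0 0 + 1.
  have N_gt0 : 0 < N by rewrite /N ltr_wpDl// le_max lexx orbT.
  have KN s : K s -> s <= N.
    move=> Ks; apply: (le_trans (ler_norm s)); apply: hN Ks.
    by rewrite /N ltr_pwDr// le_max lexx.
  have /integrable_mkcond : mu.-integrable (@Rpos R) (EFin \o (fun s => g s * \1_`]0, N] s)).
    exact: ig.
  move=> /(_ (@measurable_Rpos R)) I1.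
  have mK : measurable (K : set (measurableTypeR R)) by exact: compact_measurable.
  have /integrableP[_] := integrableS measurableT mK (@subsetT _ K) I1.
  apply: le_lt_trans; rewrite le_eqVlt; apply/orP; left; apply/eqP.
  apply: eq_integral => s /set_mem Ks; rewrite /g0 !patchE.
  case: ifPn => [sR|_]; last by rewrite normr0 abse0.
  rewrite /= ind1 ?mulr1// mem_setE in_itv/= KN// andbT.
  by move: sR; rewrite in_Rpos.
have := FTC1 (a := BRight 0) ig0 locg.
apply: ae_imp => x H x0.
have [|D1 D2] := H; first by first [exact: x0 | rewrite lte_fin | rewrite bnd_simp].
have E y : 0 < y -> Ipos (fun t => ln `|1 - y / t| * f t) =
    - pi * \int[mu]_(t in `]0, y]) g0 t.
  move=> y0; rewrite (log_formula Lf fg y0).2; congr (_ * _).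
  rewrite /Ipos /Rintegral integral_mkcond [in RHS]integral_mkcond.
  congr fine; apply: eq_integral => s _; rewrite !patchE.
  have -> : (s \in `]0, y]%classic) = (0 < s <= y) by rewrite mem_setE in_itv.
  rewrite in_Rpos; have [s0|//] := ltP 0 s.
  rewrite indicE mem_setE in_itv/= s0/= /g0 patchE in_Rpos s0.
  by case: ifPn => _; rewrite ?mulr1 ?mulr0.
pose F (y : R) : R := - pi * \int[mu]_(t in `]0, y]) g0 t.
apply: (@near_eq_is_derive _ _ _ F).
  near=> y; rewrite E//; near: y; exact: lt_nbhsr.
pose F0 (y : R) : R := \int[mu]_(t in `]0, y]) g0 t.
have d : is_derive x 1 F0 (g x).
  apply: DeriveDef; first exact: D1.
  by rewrite -derive1E D2 /g0 patchE in_Rpos x0.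
exact: (@is_deriveZ _ _ _ F0 (- pi) x 1 _ d).
Unshelve. all: by end_near. Qed.

End Inversion.

(** * Operators on complex-valued functions *)

Section RealOperators.
Variables (R : realType) (p : R).
Implicit Types (x c M : R) (f g u v : R -> R) (T : (R -> R) -> R -> R).
Local Notation mu := (@lebesgue_measure R).
Local Notation ae_eqR := (ae_eq mu (@Rpos R)).

(* The real-valued counterpart of [bounded_linear_operator]. *)
Definition real_operator T : Prop :=
  [/\ forall f, L2 p f -> L2 p (T f),
      forall f g, L2 p f -> L2 p g -> ae_eqR f g -> ae_eqR (T f) (T g),
      forall c f g, L2 p f -> L2 p g ->
        ae_eqR (T (fun x => c * f x + g x)) (fun x => c * T f x + T g x) &
      exists M, 0 <= M /\ forall f, L2 p f -> sqnorm p (T f) <= M * sqnorm p f].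

Lemma ae_eqR_trans f g u : ae_eqR f g -> ae_eqR g u -> ae_eqR f u.
Proof. by apply: ae_imp2 => x h1 h2 x0; rewrite h1// h2. Qed.

Lemma ae_eqR_sym f g : ae_eqR f g -> ae_eqR g f.
Proof. by apply: ae_imp => x h x0; rewrite h. Qed.

Lemma ae_eqR_lin c f g f' g' : ae_eqR f f' -> ae_eqR g g' ->
  ae_eqR (fun x => c * f x + g x) (fun x => c * f' x + g' x).
Proof. by apply: ae_imp2 => x h1 h2 x0; rewrite h1// h2. Qed.

Lemma ae_eqR_refl f : ae_eqR f f.
Proof. by apply: ae_imp (ae_neq 0). Qed.

Lemma ae_eqR_pos f g : (forall x, 0 < x -> f x = g x) -> ae_eqR f g.
Proof.
move=> fg; have st x : x != 0 -> Rpos x -> f x = g x by move=> _; rewrite RposE; exact: fg.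
exact: ae_imp st (ae_neq 0).
Qed.

Lemma real_operator_lipschitz T : real_operator T -> exists M, 0 <= M /\
  forall f g, L2 p f -> L2 p g ->
  sqnorm p (fun x => T f x - T g x) <= M * sqnorm p (fun x => f x - g x).
Proof.
move=> [LT aeT linT [M [M0 hM]]]; exists M; split=> // f g Lf Lg.
have e : ae_eqR (T (fun x => -1 * g x + f x)) (fun x => T f x - T g x).
  by apply: ae_imp (linT (-1) g f Lg Lf) => x h x0; rewrite h// mulN1r addrC.
have Ld : L2 p (fun x => -1 * g x + f x) by apply: L2D Lf; exact: L2Z.
have [_ <-] := ae_L2 (L2B (LT f Lf) (LT g Lg)).1 e (LT _ Ld).
rewrite (@eq_sqnorm _ p (fun x => f x - g x) (fun x => -1 * g x + f x)); first exact: hM.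
by move=> x _; rewrite mulN1r addrC.
Qed.

Lemma real_operator_unique T T' : real_operator T -> real_operator T' ->
  (forall u, test_fun u -> L2 p u) ->
  (forall u, test_fun u -> ae_eqR (T u) (T' u)) ->
  forall f, L2 p f -> ae_eqR (T f) (T' f).
Proof.
move=> hT hT' Lt Tt; have [LT aeT linT _] := hT; have [LT' aeT' linT' _] := hT'.
apply: (test_fun_dense (p := p)) => //.
  move=> c f g Lf Lg Pf Pg; apply: ae_eqR_trans (linT c f g Lf Lg) _.
  apply: ae_eqR_trans (ae_eqR_lin c Pf Pg) _.
  by apply: ae_eqR_sym; exact: linT'.
move=> fn f Ln Pn Lf fnf.
have [M [M0 hM]] := real_operator_lipschitz hT.
have [M' [M'0 hM']] := real_operator_lipschitz hT'.
apply: (sqnorm_eq0B (LT f Lf) (LT' f Lf)).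
apply/eqP; rewrite eq_le sqnorm_ge0 andbT.
have key n : sqnorm p (fun x => T f x - T' f x) <=
    (2 * M + 2 * M') * sqnorm p (fun x => fn n x - f x).
  apply: (le_trans (sqnormB3_le (LT f Lf) (LT _ (Ln n)) (LT' f Lf))).
  have E : ae_eqR (fun x => T (fn n) x - T' f x) (fun x => T' (fn n) x - T' f x).
    by apply: ae_imp (Pn n) => x h x0; rewrite h.
  have [_ ->] := ae_L2 (L2B (LT' _ (Ln n)) (LT' f Lf)).1 E (L2B (LT _ (Ln n)) (LT' f Lf)).
  have h1 := hM f (fn n) Lf (Ln n); rewrite (sqnormBC p f) in h1.
  have h2 := hM' (fn n) f (Ln n) Lf.
  by rewrite [leRHS]mulrDl -!mulrA; apply: lerD; rewrite ler_pM2l.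
have hc : (2 * M + 2 * M') * sqnorm p (fun x => fn n x - f x) @[n --> \oo] --> (0 : R).
  by rewrite -[X in _ --> X](mulr0 (2 * M + 2 * M')); apply: cvgM; [exact: cvg_cst|exact: fnf].
rewrite -(cvg_lim (@Rhausdorff R) hc); apply: limr_ge; first by apply/cvg_ex; eexists; exact: hc.
by near=> n; exact: key.
Unshelve. all: by end_near. Qed.

(** The operator with which the imaginary part of an extension, restricted to real functions, is
    compared. *)
Lemma real_operator_cst0 : real_operator (fun _ _ => 0).
Proof.
split.
- by move=> *; exact: L20.
- by move=> *; exact: ae_eqR_refl.
- by move=> c *; apply: ae_eqR_pos => x _; rewrite mulr0 addr0.
- exists 0; split=> // f Lf; rewrite mul0r.
  by rewrite (@eq_sqnorm _ p _ (fun x => 0 * f x))// ?sqnormZ// ?expr0n ?mul0r// => x _; rewrite mul0r.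
Qed.

Lemma real_operatorB T T' : real_operator T -> real_operator T' ->
  real_operator (fun f x => T f x - T' f x).
Proof.
move=> [LT aeT linT [M [M0 hM]]] [LT' aeT' linT' [M' [M'0 hM']]]; split.
- by move=> f Lf; apply: L2B; [exact: LT|exact: LT'].
- move=> f g Lf Lg fg; apply: ae_imp2 (aeT f g Lf Lg fg) (aeT' f g Lf Lg fg) => x h1 h2 x0.
  by rewrite h1// h2.
- move=> c f g Lf Lg; apply: ae_imp2 (linT c f g Lf Lg) (linT' c f g Lf Lg) => x h1 h2 x0.
  by rewrite h1// h2//; ring.
- exists (2 * M + 2 * M'); split; first by rewrite addr_ge0// mulr_ge0.
  move=> f Lf; apply: (le_trans (sqnormB_le (LT f Lf) (LT' f Lf))).
  by rewrite [leRHS]mulrDl -!mulrA; apply: lerD; rewrite ler_pM2l//; [exact: hM|exact: hM'].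
Qed.

Lemma real_operator_op (K : R -> R -> R) C : dominating p K C -> real_operator (op K).
Proof.
move=> dK; have d1 := dominated_refl dK; split.
- by move=> f Lf; have [] := L2_op dK d1 Lf.
- move=> f g Lf Lg fg; apply: ae_eqR_pos => x x0.
  exact: (ae_op d1 Lg.1 Lf x0 fg).
- move=> c f g Lf Lg; apply: ae_eqR_pos => x x0.
  by rewrite (opD dK d1 (L2Z c Lf) Lg x0) (opZ dK d1 c Lf x0).
- exists (Num.max 0 (1 ^+ 2 * C)); split; first by rewrite le_max lexx.
  move=> f Lf; have [_ h] := L2_op dK d1 Lf; apply: (le_trans h).
  by rewrite ler_wpM2r ?sqnorm_ge0// le_max lexx orbT.
Qed.

End RealOperators.

(** * Passage between real and complex operators *)

Section ComplexOperators.
Variables (R : realType) (alpha : R).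
Implicit Types (x c M : R) (u v : R -> R) (f g h : R -> R[i]).
Local Notation mu := (@lebesgue_measure R).
Local Notation p := (2 * alpha - 1).
Local Notation ae_eqR := (ae_eq mu (@Rpos R)).

Definition csqnorm f := sqnorm p (ReF f) + sqnorm p (ImF f).

Lemma csqnorm_ge0 f : 0 <= csqnorm f.
Proof. by rewrite addr_ge0// sqnorm_ge0. Qed.

Lemma weighted_normc2 f x : (normc (f x) ^+ 2 * x `^ p) =
  ReF f x ^+ 2 * x `^ p + ImF f x ^+ 2 * x `^ p.
Proof. by rewrite normc2 mulrDl. Qed.

Lemma L2wP f : L2w alpha f <-> L2 p (ReF f) /\ L2 p (ImF f).
Proof.
have ge z : 0 <= normc (f z) ^+ 2 * z `^ p by rewrite mulr_ge0 ?sqr_ge0 ?powR_ge0.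
have m2 u : mpos u -> mpos (fun x => u x ^+ 2 * x `^ p).
  by move=> mu'; apply: mposM; [exact: mposX|exact: mpos_powR].
split=> [[[mR mI] n]|[[mR iR] [mI iI]]].
- have m : mpos (fun x => normc (f x) ^+ 2 * x `^ p).
    apply: (eq_mpos (f := fun x => ReF f x ^+ 2 * x `^ p + ImF f x ^+ 2 * x `^ p)).
      by move=> x _; rewrite weighted_normc2.
    by apply: mposD; exact: m2.
  have i : integ (fun x => normc (f x) ^+ 2 * x `^ p).
    apply/integ_ge0P => //; move: n; rewrite /wnorm.
    case: (\int[mu]_(x in _) _)%E => [r _||//]; first exact: ltry.
    by rewrite poweRyr// invr_eq0 pnatr_eq0.
  split; split=> //; apply: le_integ i; try exact: m2.
  + by move=> x x0; rewrite ger0_norm ?sqw_ge0// weighted_normc2 lerDl sqw_ge0.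
  + by move=> x x0; rewrite ger0_norm ?sqw_ge0// weighted_normc2 lerDr sqw_ge0.
- split; first by split.
  rewrite /wnorm -EFin_Ipos ?poweR_EFin ?ltry//.
  by apply: eq_integ (integD iR iI) => x _; rewrite weighted_normc2.
Qed.

Lemma wnormE f : L2w alpha f -> wnorm alpha f = (Num.sqrt (csqnorm f))%:E.
Proof.
move=> /L2wP [[mR iR] [mI iI]].
have i := integD iR iI.
rewrite /wnorm -EFin_Ipos; last by apply: eq_integ i => x _; rewrite weighted_normc2.
rewrite poweR_EFin powR12_sqrt; last first.
  by apply: Ipos_ge0 => x _; rewrite mulr_ge0 ?sqr_ge0 ?powR_ge0.
congr (Num.sqrt _)%:E; rewrite /csqnorm /sqnorm -IposD//.
by apply: eq_Ipos => x _; rewrite weighted_normc2.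
Qed.

Lemma wnorm_le f g c : 0 <= c -> L2w alpha f -> L2w alpha g ->
  csqnorm f <= c ^+ 2 * csqnorm g -> (wnorm alpha f <= c%:E * wnorm alpha g)%E.
Proof.
move=> c0 Lf Lg h; rewrite !wnormE// -EFinM lee_fin.
rewrite -[c]ger0_norm// -sqrtr_sqr -sqrtrM ?sqr_ge0//.
by rewrite ler_wsqrtr.
Qed.

Lemma csqnorm_le f g c : L2w alpha f -> L2w alpha g ->
  (wnorm alpha f <= c%:E * wnorm alpha g)%E -> csqnorm f <= c ^+ 2 * csqnorm g.
Proof.
move=> Lf Lg; rewrite !wnormE// -EFinM lee_fin => h.
rewrite -[leLHS]sqr_sqrtr ?csqnorm_ge0// -[X in _ * X]sqr_sqrtr ?csqnorm_ge0//.
by rewrite -exprMn lerXn2r// nnegrE ?sqrtr_ge0// (le_trans _ h)// sqrtr_ge0.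
Qed.

Lemma ae_eq_complex f g : ae_eqR (ReF f) (ReF g) -> ae_eqR (ImF f) (ImF g) -> ae_eqR f g.
Proof.
by apply: ae_imp2 => x h1 h2 x0; apply: complex_eq; [exact: h1|exact: h2].
Qed.

Lemma ae_eq_Re f g : ae_eqR f g -> ae_eqR (ReF f) (ReF g).
Proof. by apply: ae_imp => x h x0; rewrite /ReF h. Qed.

Lemma ae_eq_Im f g : ae_eqR f g -> ae_eqR (ImF f) (ImF g).
Proof. by apply: ae_imp => x h x0; rewrite /ImF h. Qed.

Definition complexify (T : (R -> R) -> R -> R) f : R -> R[i] :=
  fun x => T (ReF f) x +i* T (ImF f) x.

Lemma ReF_complexify T f : ReF (complexify T f) = T (ReF f).
Proof. by []. Qed.

Lemma ImF_complexify T f : ImF (complexify T f) = T (ImF f).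
Proof. by []. Qed.

Lemma Re_lin (c : R[i]) f g : ReF (fun x => c * f x + g x) =
  (fun x => complex.Re c * ReF f x + (- complex.Im c * ImF f x + ReF g x)).
Proof. by apply/funext => x; rewrite /ReF /ImF cReD cReM; ring. Qed.

Lemma Im_lin (c : R[i]) f g : ImF (fun x => c * f x + g x) =
  (fun x => complex.Re c * ImF f x + (complex.Im c * ReF f x + ImF g x)).
Proof. by apply/funext => x; rewrite /ReF /ImF cImD cImM; ring. Qed.

Lemma real_operator_lin2 T c c' u v w : real_operator p T ->
  L2 p u -> L2 p v -> L2 p w ->
  ae_eqR (T (fun x => c * u x + (c' * v x + w x)))
         (fun x => c * T u x + (c' * T v x + T w x)).
Proof.
move=> [_ _ lin _] Lu Lv Lw.
have Lvw : L2 p (fun x => c' * v x + w x) by apply: L2D Lw; exact: L2Z.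
apply: ae_eqR_trans (lin c u _ Lu Lvw) _.
by apply: ae_eqR_lin; [exact: ae_eqR_refl|exact: lin].
Qed.

Lemma bounded_complexify T : real_operator p T -> bounded_linear_operator alpha (complexify T).
Proof.
move=> hT; have [LT aeT linT [M [M0 hM]]] := hT.
have L2T f : L2w alpha f -> L2w alpha (complexify T f).
  by move=> /L2wP [L1 L3]; apply/L2wP; split; exact: LT.
split=> //.
- move=> f g /L2wP [f1 f2] /L2wP [g1 g2] fg; apply: ae_eq_complex.
    exact: aeT (ae_eq_Re fg).
  exact: aeT (ae_eq_Im fg).
- move=> c f g /L2wP [f1 f2] /L2wP [g1 g2]; apply: ae_eq_complex.
    by rewrite [X in ae_eq _ _ _ X]Re_lin !ReF_complexify Re_lin; exact: real_operator_lin2.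
  by rewrite [X in ae_eq _ _ _ X]Im_lin !ImF_complexify Im_lin; exact: real_operator_lin2.
- exists (Num.sqrt M) => f Lf; have /L2wP [f1 f2] := Lf.
  apply: wnorm_le => //; first exact: L2T.
  by rewrite sqr_sqrtr// mulrDr; apply: lerD; exact: hM.
Qed.

Let i_re u : R -> R[i] := fun x => (u x)%:C.

Let L2w_real u : L2 p u -> L2w alpha (i_re u).
Proof. by move=> Lu; apply/L2wP; split=> //; exact: L20. Qed.

Let real_lin c u v : i_re (fun x => c * u x + v x) = (fun x => c%:C * i_re u x + i_re v x).
Proof. by apply/funext => x; rewrite /i_re rmorphD rmorphM. Qed.

(** An arbitrary extension is not known in advance to preserve real functions. Each component of its
    restriction to them is a real operator, to which [real_operator_unique] applies. *)
Lemma real_operator_complex (H : (R -> R[i]) -> R -> R[i]) : bounded_linear_operator alpha H ->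
  real_operator p (fun u => ReF (H (fun x => (u x)%:C))) /\
  real_operator p (fun u => ImF (H (fun x => (u x)%:C))).
Proof.
move=> [LH aeH linH [M hM]].
have LR u : L2 p u -> L2 p (ReF (H (i_re u))) /\ L2 p (ImF (H (i_re u))).
  by move=> Lu; apply/L2wP; apply: LH; exact: L2w_real.
have ae u v : L2 p u -> L2 p v -> ae_eqR u v -> ae_eqR (H (i_re u)) (H (i_re v)).
  move=> Lu Lv uv; apply: aeH; try exact: L2w_real.
  by apply: ae_imp uv => x h x0; rewrite /i_re h.
have lin c u v : L2 p u -> L2 p v ->
    ae_eqR (H (i_re (fun x => c * u x + v x))) (fun x => c%:C * H (i_re u) x + H (i_re v) x).
  by move=> Lu Lv; rewrite real_lin; apply: linH; exact: L2w_real.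
have bd u : L2 p u -> sqnorm p (ReF (H (i_re u))) + sqnorm p (ImF (H (i_re u))) <=
    M ^+ 2 * sqnorm p u.
  move=> Lu; have Lc := L2w_real Lu.
  have := csqnorm_le (LH _ Lc) Lc (hM _ Lc).
  rewrite {2}/csqnorm (_ : sqnorm p (ImF (i_re u)) = 0) ?addr0//.
  rewrite /sqnorm -[RHS](Ipos0 R); apply: eq_Ipos => x x0.
  by rewrite /ImF /= expr0n mul0r.
split; split.
- by move=> u /LR [].
- by move=> u v Lu Lv uv; apply: ae_eq_Re; exact: ae.
- move=> c u v Lu Lv; have := ae_eq_Re (lin c u v Lu Lv).
  by rewrite Re_lin; apply: ae_imp => x h x0; rewrite h//= oppr0 mul0r add0r.
- exists (M ^+ 2); split; first exact: sqr_ge0.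
  by move=> u Lu; apply: le_trans (bd u Lu); rewrite lerDl sqnorm_ge0.
- by move=> u /LR [].
- by move=> u v Lu Lv uv; apply: ae_eq_Im; exact: ae.
- move=> c u v Lu Lv; have := ae_eq_Im (lin c u v Lu Lv).
  by rewrite Im_lin; apply: ae_imp => x h x0; rewrite h//= mul0r add0r.
- exists (M ^+ 2); split; first exact: sqr_ge0.
  by move=> u Lu; apply: le_trans (bd u Lu); rewrite lerDr sqnorm_ge0.
Qed.

End ComplexOperators.

(** * The half-Hilbert transform *)

Section HalfHilbert.
Variables (R : realType) (a : R).
Hypotheses (a_gt0 : 0 < a) (a_lt : a < 1 / 2).
Implicit Types (x t c e : R) (u v w : R -> R) (f g h : R -> R[i]) (H : (R -> R[i]) -> R -> R[i]).
Local Notation mu := (@lebesgue_measure R).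
Local Notation p := (2 * a - 1).
Local Notation A := (op (@kerA R)).
Local Notation ae_eqR := (ae_eq mu (@Rpos R)).
Local Notation hlim := (hlim a).

(** A chosen representative of the limit, determined up to almost-everywhere equality by
    [hlim_unique]; the default is the zero function. *)
Definition hilb u : R -> R := xget (fun=> 0) [set v | hlim u v].

Lemma hilbP u : L2 p u -> hlim u (hilb u).
Proof. by move=> /(hlim_exists a_gt0 a_lt); exact: xgetPex. Qed.

Lemma hlim_ae_r u v v' : L2 p u -> mpos v' -> ae_eqR v v' -> hlim u v -> hlim u v'.
Proof.
move=> Lu mv' vv' [Lv h1 h2]; have [Lv' _] := ae_L2 mv' vv' Lv.
split; [exact: Lv'| |exact: h2].
apply: (cvgn_ext _ erefl h1) => n.
have LH := (L2_opH a_gt0 a_lt n Lu).1.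
have e : ae_eqR (fun x => op (kerH (angle R n)) u x - v' x) (fun x => op (kerH (angle R n)) u x - v x).
  by apply: ae_imp vv' => x e x0; rewrite e.
by have [_ ->] := ae_L2 (L2B LH Lv).1 e (L2B LH Lv').
Qed.

Lemma real_operator_hilb : real_operator p hilb.
Proof.
split.
- by move=> u /hilbP [].
- move=> u v Lu Lv uv; have h := hlim_ae a_gt0 a_lt Lu Lv.1 uv (hilbP Lu).
  exact: (hlim_unique a_gt0 a_lt Lv h (hilbP Lv)).
- move=> c u v Lu Lv; have Luv := L2D (L2Z c Lu) Lv.
  apply: (hlim_unique a_gt0 a_lt Luv (hilbP Luv)).
  exact: (hlim_lin a_gt0 a_lt c Lu Lv (hilbP Lu) (hilbP Lv)).
- exists (2 * sin (a * pi) ^- 2); split; first by rewrite mulr_ge0// invr_ge0 sqr_ge0.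
  by move=> u Lu; exact: (hlim_le a_gt0 a_lt Lu (hilbP Lu)).
Qed.

Lemma real_operator_inverse : real_operator p (fun u x => A u x - hilb u x).
Proof.
have [C dA] := dominating_kerA a_gt0 a_lt.
by apply: real_operatorB; [exact: real_operator_op dA|exact: real_operator_hilb].
Qed.

Lemma Rintegral_truncated u x e (D := @Rpos R `&` [set t | e < `|t - x|]) :
  \int[mu]_(t in D) (u t / (t - x)) = Ipos (fun t => kerPV x e t * u t).
Proof.
rewrite /D Rintegral_mkcondr; apply: eq_Ipos => t t0.
rewrite /kerPV farE patchE; case: ifPn => h.
  by rewrite (_ : e < `|t - x|) ?mul1r 1?mulrC//; exact: set_mem h.
rewrite (_ : e < `|t - x| = false) ?mul0r//; apply/negbTE/negP => h'.
by move/negP: h; apply; exact: mem_set.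
Qed.

Lemma Re_div_real (z : R[i]) (r : R) : complex.Re (z / r%:C) = complex.Re z / r.
Proof. by rewrite -fmorphV mulrC Re_realM mulrC. Qed.

Lemma Im_div_real (z : R[i]) (r : R) : complex.Im (z / r%:C) = complex.Im z / r.
Proof. by rewrite -fmorphV mulrC Im_realM mulrC. Qed.

Lemma Re_hilbert_trunc f x e :
  complex.Re (hilbert_trunc f x e) = pi^-1 * Ipos (fun t => kerPV x e t * ReF f t).
Proof.
rewrite /hilbert_trunc Re_realM /= -Rintegral_truncated; congr (_ * _).
by apply: eq_Rintegral => t _; rewrite /ReF Re_div_real.
Qed.

Lemma Im_hilbert_trunc f x e :
  complex.Im (hilbert_trunc f x e) = pi^-1 * Ipos (fun t => kerPV x e t * ImF f t).
Proof.
rewrite /hilbert_trunc Im_realM /= -Rintegral_truncated; congr (_ * _).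
by apply: eq_Rintegral => t _; rewrite /ImF Im_div_real.
Qed.

Lemma Cc3_test f : Cc3 f -> test_fun (ReF f) /\ test_fun (ImF f).
Proof.
move=> [fR fI [K [cK KR f0]]]; split; split=> //; exists K; split=> // x x0 Kx;
  by rewrite /ReF /ImF f0.
Qed.

Lemma C3_on_Rpos0 : C3_on_Rpos (fun=> 0 : R).
Proof.
have d k : derive1n k (fun=> 0 : R) = fun=> 0.
  by elim: k => // k IH; rewrite derive1nS IH; apply/funext => x; rewrite derive1_cst.
move=> x _; split=> [k _|]; first by rewrite d; exact: derivable_cst.
by rewrite d; exact: cvg_cst.
Qed.

Lemma test_Cc3 u : test_fun u -> Cc3 (fun x => (u x)%:C).
Proof.
move=> [C3 [K [cK KR u0]]]; split; [exact: C3|exact: C3_on_Rpos0|].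
by exists K; split=> // x x0 Kx; rewrite u0.
Qed.

Lemma is_pv_pvH f x : Cc3 f -> Rpos x -> is_pv_hilbert f x (pvH (ReF f) x +i* pvH (ImF f) x).
Proof.
move=> /Cc3_test [/test_fun_lip [b [b' [M [L HR]]]] /test_fun_lip [d [d' [N [L' HI]]]]].
rewrite RposE => x0; split.
  by under eq_fun do rewrite Re_hilbert_trunc; exact: pv_cvg HR x0.
by under eq_fun do rewrite Im_hilbert_trunc; exact: pv_cvg HI x0.
Qed.

Lemma half_hilbert_extension_exists : half_hilbert_extension a (complexify hilb).
Proof.
split; first exact: bounded_complexify real_operator_hilb.
move=> f Cf; exists (fun x => pvH (ReF f) x +i* pvH (ImF f) x).
  by move=> x; exact: is_pv_pvH.
have [tR tI] := Cc3_test Cf.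
have E u : test_fun u -> ae_eqR (hilb u) (pvH u).
  move=> tu; have Lu := L2_test a tu.
  by apply: (hlim_unique a_gt0 a_lt Lu (hilbP Lu)); exact: hlim_test.
by apply: ae_eq_complex; exact: E.
Qed.

Section Extension.
Variable H : (R -> R[i]) -> R -> R[i].
Hypothesis HH : half_hilbert_extension a H.

Let LH f : L2w a f -> L2w a (H f). Proof. by have [[h _ _ _] _] := HH; exact: h. Qed.

(** The principal value of an extension is prescribed at every point, and limits are unique, so it
    is [pvH u] with zero imaginary part; [hlim_test] identifies [pvH u] with the norm limit. *)
Lemma extension_test u : test_fun u ->
  ae_eqR (ReF (H (fun x => (u x)%:C))) (hilb u) /\
  ae_eqR (ImF (H (fun x => (u x)%:C))) (fun=> 0).
Proof.
move=> tu; have Cu := test_Cc3 tu; have Lu := L2_test a tu.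
have [_ /(_ _ Cu) [g pv gH]] := HH.
have E x : Rpos x -> g x = (pvH u x)%:C.
  move=> x0; have [h1 h2] := pv x x0; have [h3 h4] := is_pv_pvH Cu x0.
  apply: complex_eq; first exact: cvg_unique h1 h3.
  rewrite (cvg_unique _ h2 h4)//= /pvH (_ : Ipos _ = 0) ?mulr0//.
  rewrite -[RHS](Ipos0 R); apply: eq_Ipos => t t0.
  by rewrite /diffq /ImF/= mul0r subr0 mul0r.
have hp := hlim_unique a_gt0 a_lt Lu (hilbP Lu) (hlim_test a_gt0 a_lt tu).
split.
- apply: ae_eqR_trans (ae_eq_Re gH) _; apply: ae_eqR_trans (ae_eqR_sym hp).
  by apply: ae_eqR_pos => x x0; rewrite /ReF E ?RposE.
- apply: ae_eqR_trans (ae_eq_Im gH) _.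
  by apply: ae_eqR_pos => x x0; rewrite /ImF E ?RposE.
Qed.

Lemma extension_real u : L2 p u ->
  ae_eqR (ReF (H (fun x => (u x)%:C))) (hilb u) /\
  ae_eqR (ImF (H (fun x => (u x)%:C))) (fun=> 0).
Proof.
move=> Lu; have [hR hI] := real_operator_complex HH.1; split.
- apply: (real_operator_unique hR real_operator_hilb) => // v tv; first exact: L2_test.
  by have [] := extension_test tv.
- apply: (real_operator_unique hI (real_operator_cst0 p)) => // v tv; first exact: L2_test.
  by have [] := extension_test tv.
Qed.

(** Complex linearity applied to f = i Im f + Re f reduces the claim to real functions, where the
    extension is [hilb] with zero imaginary part. *)
Lemma extensionE f : L2w a f ->
  ae_eqR (ReF (H f)) (hilb (ReF f)) /\ ae_eqR (ImF (H f)) (hilb (ImF f)).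
Proof.
move=> /L2wP [fR fI]; have [[_ _ lin _] _] := HH.
have real u : L2 p u -> L2w a (fun x => (u x)%:C).
  by move=> Lu; apply/L2wP; split=> //; exact: L20.
have /= := lin 'i _ _ (real _ fI) (real _ fR).
rewrite (_ : (fun x => 'i * (ImF f x)%:C + (ReF f x)%:C) = f); last first.
  by apply/funext => x; apply: complex_eq; rewrite ?cReD ?cImD ?cReM ?cImM /=; ring.
have [r1 r2] := extension_real fR; have [i1 i2] := extension_real fI.
move=> E; split.
- apply: ae_eqR_trans (ae_eq_Re E) _; rewrite Re_lin/=.
  by apply: ae_imp2 r1 i2 => x h1 h2 x0; rewrite h1// h2//; ring.
- apply: ae_eqR_trans (ae_eq_Im E) _; rewrite Im_lin/=.
  by apply: ae_imp2 r2 i1 => x h1 h2 x0; rewrite h1// h2//; ring.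
Qed.

Lemma extension_hlim f : L2w a f ->
  hlim (ReF f) (ReF (H f)) /\ hlim (ImF f) (ImF (H f)).
Proof.
move=> Lf; have /L2wP [fR fI] := Lf; have [eR eI] := extensionE Lf.
have /L2wP [gR gI] := LH Lf.
split.
- exact: (hlim_ae_r fR gR.1 (ae_eqR_sym eR) (hilbP fR)).
- exact: (hlim_ae_r fI gI.1 (ae_eqR_sym eI) (hilbP fI)).
Qed.

(** The inverse A - H is built from [hilb], not from the given extension, so that its boundedness is
    that of a real operator; the inversion identities are then read on each component. *)
Lemma extension_invertible : invertible_operator a H.
Proof.
exists (complexify (fun u x => A u x - hilb u x)).
  exact: bounded_complexify real_operator_inverse.
move=> f Lf; have /L2wP [fR fI] := Lf.
have [hR hI] := extension_hlim Lf; have /L2wP [gR gI] := LH Lf.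
split; apply: ae_eq_complex.
- by apply: ae_eqR_sym; exact: (hlim_left_inverse a_gt0 a_lt fR hR (hilbP gR)).
- by apply: ae_eqR_sym; exact: (hlim_left_inverse a_gt0 a_lt fI hI (hilbP gI)).
- set g := complexify _ f; have Lg : L2w a g.
    by have [h _ _ _] := bounded_complexify real_operator_inverse; exact: h.
  have [kR _] := extension_hlim Lg.
  exact: (hlim_right_inverse a_gt0 a_lt fR (hilbP fR) kR).
- set g := complexify _ f; have Lg : L2w a g.
    by have [h _ _ _] := bounded_complexify real_operator_inverse; exact: h.
  have [_ kI] := extension_hlim Lg.
  exact: (hlim_right_inverse a_gt0 a_lt fI (hilbP fI) kI).
Qed.

Lemma extension_log_integrable f x : L2w a f -> 0 < x ->
  cintegrable (@Rpos R) (fun t => (ln `|1 - x / t|)%:C * f t).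
Proof.
move=> Lf x0; have [hR hI] := extension_hlim Lf; have /L2wP [fR fI] := Lf.
have [iR _] := log_formula a_gt0 a_lt fR hR x0.
have [iI _] := log_formula a_gt0 a_lt fI hI x0.
split.
- by apply: eq_integ iR => t _; rewrite /ReF Re_realM.
- by apply: eq_integ iI => t _; rewrite /ImF Im_realM.
Qed.

Lemma extension_log_derive f : L2w a f ->
  {ae mu, forall x : R, 0 < x -> cderivable (log_potential f) x /\
     H f x = - (pi^-1)%:C * cderive1 (log_potential f) x}.
Proof.
move=> Lf; have [hR hI] := extension_hlim Lf; have /L2wP [fR fI] := Lf.
have eR : ReF (log_potential f) = fun x => Ipos (fun t => ln `|1 - x / t| * ReF f t).
  by apply/funext => x; apply: eq_Ipos => t _; rewrite /ReF Re_realM.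
have eI : ImF (log_potential f) = fun x => Ipos (fun t => ln `|1 - x / t| * ImF f t).
  by apply/funext => x; apply: eq_Ipos => t _; rewrite /ImF Im_realM.
have dR := log_potential_derive a_gt0 a_lt fR hR.
have dI := log_potential_derive a_gt0 a_lt fI hI.
have p0 : pi != 0 :> R by rewrite lt0r_neq0 ?pi_gt0.
apply: ae_imp2 dR dI => x h1 h2 x0; have [dR vR] := h1 x0; have [dI vI] := h2 x0.
split; first by split; [rewrite eR; exact: dR|rewrite eI; exact: dI].
have e (q y : R) : q != 0 -> y = - (q^-1 * (- q * y)) by move=> q0; rewrite mulNr mulrN opprK mulKf.
rewrite mulNr; apply: complex_eq.
  rewrite cReN Re_realM (_ : complex.Re (cderive1 _ _) = - pi * ReF (H f) x); first exact: (e pi).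
  by rewrite /= eR derive1E vR.
rewrite cImN Im_realM (_ : complex.Im (cderive1 _ _) = - pi * ImF (H f) x); first exact: (e pi).
by rewrite /= eI derive1E vI.
Qed.

Lemma Re_inversion_integrand g x t :
  complex.Re (inversion_integrand g x t) = kerA x t * ReF g t.
Proof. by rewrite /inversion_integrand !Re_div_real /kerA invfM /ReF; ring. Qed.

Lemma Im_inversion_integrand g x t :
  complex.Im (inversion_integrand g x t) = kerA x t * ImF g t.
Proof. by rewrite /inversion_integrand !Im_div_real /kerA invfM /ImF; ring. Qed.

Lemma extension_inversion_integrable f x : L2w a f -> 0 < x ->
  cintegrable (@Rpos R) (inversion_integrand (H f) x).
Proof.
move=> /LH /L2wP [gR gI] x0; have [C dA] := dominating_kerA a_gt0 a_lt.
have d1 := dominated_refl dA; split.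
- apply: eq_integ (dominated_integ dA d1 gR x0) => t _; rewrite /ReF.
  by rewrite Re_inversion_integrand.
- apply: eq_integ (dominated_integ dA d1 gI x0) => t _; rewrite /ImF.
  by rewrite Im_inversion_integrand.
Qed.

Lemma extension_inversion f : L2w a f -> {ae mu, forall x : R, 0 < x ->
  f x = (pi^-1)%:C * cintegral (@Rpos R) (inversion_integrand (H f) x) - H (H f) x}.
Proof.
move=> Lf; have [hR hI] := extension_hlim Lf; have [kR kI] := extension_hlim (LH Lf).
have /L2wP [fR fI] := Lf.
have eR := hlim_left_inverse a_gt0 a_lt fR hR kR.
have eI := hlim_left_inverse a_gt0 a_lt fI hI kI.
have st x : (Rpos x -> ReF f x = A (ReF (H f)) x - ReF (H (H f)) x) ->
    (Rpos x -> ImF f x = A (ImF (H f)) x - ImF (H (H f)) x) -> 0 < x ->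
    f x = (pi^-1)%:C * cintegral (@Rpos R) (inversion_integrand (H f) x) - H (H f) x.
  rewrite RposE => h1 h2 x0; apply: complex_eq.
    have := h1 x0; rewrite /ReF => ->; rewrite cReD cReN Re_realM; congr (_ * _ - _).
    by apply: eq_Ipos => t _; rewrite /ReF Re_inversion_integrand.
  have := h2 x0; rewrite /ImF => ->; rewrite cImD cImN Im_realM; congr (_ * _ - _).
  by apply: eq_Ipos => t _; rewrite /ImF Im_inversion_integrand.
exact: ae_imp2 st eR eI.
Qed.

Lemma cot_ge0 : 0 <= cot (pi * a).
Proof.
rewrite /cot [pi * a]mulrC divr_ge0// ?(ltW (sin_api_gt0 a_gt0 a_lt))//.
have pi0 := pi_gt0 R.
by rewrite cos_ge0_pihalf//; apply/andP; split; move: a_gt0 a_lt => ? ?; nra.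
Qed.

Lemma extension_bounds f : L2w a f ->
  (a <= 1 / 4 -> (wnorm a f <= wnorm a (H f))%E /\
     (wnorm a (H f) <= (cot (pi * a))%:E * wnorm a f)%E) /\
  (1 / 4 <= a -> ((cot (pi * a))%:E * wnorm a f <= wnorm a (H f))%E /\
     (wnorm a (H f) <= wnorm a f)%E).
Proof.
move=> Lf; have [hR hI] := extension_hlim Lf; have /L2wP [fR fI] := Lf; have LHf := LH Lf.
have [bR bR'] := hlim_bounds a_gt0 a_lt fR hR; have [bI bI'] := hlim_bounds a_gt0 a_lt fI hI.
have le1 g g' : L2w a g -> L2w a g' -> csqnorm a g <= csqnorm a g' ->
    (wnorm a g <= wnorm a g')%E.
  by move=> Lg Lg' h; rewrite -[leRHS]mul1e; apply: wnorm_le; rewrite ?expr1n ?mul1r.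
have ct := cot_ge0.
split=> ha.
- have [r1 r2] := bR ha; have [i1 i2] := bI ha; split.
    by apply: le1 => //; exact: lerD.
  by apply: wnorm_le => //; rewrite mulrDr; exact: lerD.
- have [r1 r2] := bR' ha; have [i1 i2] := bI' ha; split; last first.
    by apply: le1 => //; exact: lerD.
  rewrite !wnormE// -EFinM lee_fin -[cot _]ger0_norm// -sqrtr_sqr -sqrtrM ?sqr_ge0//.
  by apply: ler_wsqrtr; rewrite mulrDr; exact: lerD.
Qed.

End Extension.

End HalfHilbert.

Theorem theorem1 (R : realType) (alpha : R)
    (alpha_gt0 : 0 < alpha) (alpha_lt_half : alpha < 1 / 2) :
  (exists H : (R -> R[i]) -> (R -> R[i]), half_hilbert_extension alpha H) /\
  forall H : (R -> R[i]) -> (R -> R[i]), half_hilbert_extension alpha H ->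
    [/\ invertible_operator alpha H,
        (forall f : R -> R[i], L2w alpha f ->
          [/\ (forall x, 0 < x ->
                 cintegrable (@Rpos R) (fun t => (ln `|1 - x / t|)%:C * f t)),
              {ae lebesgue_measure, forall x : R, 0 < x ->
                 cderivable (log_potential f) x /\
                 H f x = - (pi^-1)%:C * cderive1 (log_potential f) x},
              (forall x, 0 < x ->
                 cintegrable (@Rpos R) (inversion_integrand (H f) x)) &
              {ae lebesgue_measure, forall x : R, 0 < x ->
                 f x = (pi^-1)%:C
                         * cintegral (@Rpos R) (inversion_integrand (H f) x)
                       - H (H f) x}]),
        (alpha <= 1 / 4 -> forall f : R -> R[i], L2w alpha f ->
          (wnorm alpha f <= wnorm alpha (H f))%E /\
          (wnorm alpha (H f) <= (cot (pi * alpha))%:E * wnorm alpha f)%E) &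
        (1 / 4 <= alpha -> forall f : R -> R[i], L2w alpha f ->
          ((cot (pi * alpha))%:E * wnorm alpha f <= wnorm alpha (H f))%E /\
          (wnorm alpha (H f) <= wnorm alpha f)%E)].
Proof.
split; first by exists (complexify (hilb alpha)); exact: half_hilbert_extension_exists.
move=> H HH; split.
- exact: (extension_invertible alpha_gt0 alpha_lt_half HH).
- move=> f Lf; split.
  + by move=> x; exact: (extension_log_integrable alpha_gt0 alpha_lt_half HH Lf).
  + exact: (extension_log_derive alpha_gt0 alpha_lt_half HH Lf).
  + by move=> x; exact: (extension_inversion_integrable alpha_gt0 alpha_lt_half HH Lf).
  + exact: (extension_inversion alpha_gt0 alpha_lt_half HH Lf).
- by move=> ha f Lf; have [h _] := extension_bounds alpha_gt0 alpha_lt_half HH Lf; exact: h.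
- by move=> ha f Lf; have [_ h] := extension_bounds alpha_gt0 alpha_lt_half HH Lf; exact: h.
Qed.
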